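(* Let $X$ be the jump diffusion described in the context, with i.i.d. jumps $C_i$ of phase-type $(\vec\beta,B)$ with $K$ phases, so that all jumps of $X$ are negative. Put $\mathbf b=(-B)\mathbf 1$. Let $q\ge0$, $l<a<b$ and $a\le x\le b$, and put $$W_q(x,a):=H_q(x)-\Psi_{q,C}(x,a)\,H_q(a)-\vec\Psi_{q,J}(x,a)\int_0^{a-l}e^{By}\,\mathbf b\,H_q(a-y)\,dy .$$ Then: (i) $$\overline{\Psi}_q^{\,b}(x,a):=\mathbb E_x\big[e^{-qT_{b,+}};\,T_{b,+}<T_{a,-}\big]=\frac{W_q(x,a)}{W_q(b,a)} .$$ (ii) For $y>0$, $$\mathbb E_x\big[e^{-qT_{a,-}};\,T_{a,-}<T_{b,+},\ a-X_{T_{a,-}}\in dy\big]=\Big[\vec\Psi_{q,J}(x,a)-\overline{\Psi}_q^{\,b}(x,a)\,\vec\Psi_{q,J}(b,a)\Big]e^{By}\,\mathbf b\,dy .$$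
   Context: Process. $X$ is a strong Markov process solving $$dX_t=c(X_t)\,dt+\sigma(X_t)\,dB_t-dJ_t,\qquad J_t=\sum_{i=1}^{N_\lambda(t)}C_i ,$$ and absorbed when it leaves the half-line $(l,\infty)$, where $l\in\mathbb R$. Here $(B_t)$ is a standard Brownian motion, $N_\lambda$ an independent Poisson process of intensity $\lambda>0$, the $C_i$ are i.i.d., independent of the Brownian motion and of $N_\lambda$, and $c(x)>0$, $\sigma(x)\ge 0$ for $x>l$ ($\sigma\equiv 0$ is allowed). It is assumed that the coefficients are such that this process is well defined. Phase-type jumps. $B$ is a nonsingular $K\times K$ subgenerator matrix (nonnegative off-diagonal entries, nonpositive row sums), $\vec\beta$ is a probability row vector, $\mathbf 1$ is the column vector of ones, and $P(C_i>x)=\vec\beta e^{Bx}\mathbf 1$, with density $\vec\beta e^{Bx}\mathbf b$. Each $C_i$ is realized as the absorption time of a continuous-time Markov chain on phases $\{1,\dots,K\}$ with initial law $\vec\beta$ and subgenerator $B$ (independent for different $i$), the jump being thought of as traversed downwards at unit speed. If $X$ goes below $a$ by a jump (i.e. $X_{T_{a,-}}<a$), $J_c\in\{1,\dots,K\}$ denotes the phase of the chain of that jump at the moment the level $a$ is crossed, i.e. at chain time $X_{T_{a,-}-}-a$. First passage times. $T_{b,+}=\inf\{t\ge0: X_t>b\}$, $T_{a,-}=\inf\{t\ge 0:X_t<a\}$ for $a>l$, and $T_{l,-}$ is the first exit time from $(l,\infty)$; $\inf\emptyset=+\infty$ and $e^{-q\cdot\infty}:=0$ (also for $q=0$). The function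 $H_q$. $H_q:(l,\infty)\to(0,\infty)$ is the function, unique up to a multiplicative constant, such that $$\mathbb E_x\big[e^{-qT_{b,+}};\,T_{b,+}<T_{l,-}\big]=\frac{H_q(x)}{H_q(b)},\qquad l<x\le b .$$ Killed ruin probabilities (one-sided, no upper barrier). $\Psi_{q,C}(x,a)=\mathbb E_x[e^{-qT_{a,-}};T_{a,-}<\infty,X_{T_{a,-}}=a]$ (ruin by creeping), and $\vec\Psi_{q,J}(x,a)$ is the row vector whose $k$-th component is $\mathbb E_x[e^{-qT_{a,-}};T_{a,-}<\infty,X_{T_{a,-}}<a,J_c=k]$. *)

(* Defs.v *)
(* Library world: MathComp + MathComp-Analysis *)
From HB Require Import structures.
From mathcomp Require Import all_boot all_order all_algebra.
From mathcomp Require Import all_classical all_reals all_analysis.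
Set Implicit Arguments.
Unset Strict Implicit.
Unset Printing Implicit Defensive.
Import Order.TTheory GRing.Theory Num.Theory.
Import numFieldNormedType.Exports.
Local Open Scope classical_set_scope.
Local Open Scope ring_scope.

Section PhaseType.
Context {R : realType} {K : nat}.
Implicit Types (B : 'M[R]_K) (beta : 'rV[R]_K).

Definition expmx B : 'M[R]_K :=
  \matrix_(i, j) limn (series (fun n => (n`!%:R^-1 *: B ^+ n) i j)).

Definition nonsingular_subgenerator B : Prop :=
  [/\ forall i j, i != j -> 0 <= B i j,
      forall i, \sum_j B i j <= 0
    & B \in unitmx].

Definition probability_row beta : Prop :=
  (forall i, 0 <= beta 0 i) /\ \sum_i beta 0 i = 1.

Definition exit_rates B : 'cV[R]_K := - B *m const_mx 1.

(* Chains with subgenerator B live on [option 'I_K]; [None] is the absorbing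
   state. *)
Definition phase_init beta (s : option 'I_K) : R :=
  if s is Some i then beta 0 i else 0.

Definition phase_trans B (v : R) (s s' : option 'I_K) : R :=
  match s, s' with
  | Some i, Some j => expmx (v *: B) i j
  | Some i, None => 1 - \sum_j expmx (v *: B) i j
  | None, Some _ => 0
  | None, None => 1
  end.

End PhaseType.

Section Probability.
Context {R : realType} {d : measure_display} {Om : measurableType d}.
Implicit Types (P : {measure set Om -> \bar R}) (F : R -> set_system Om).

(* Processes are indexed by all of R; only times t >= 0 are meaningful. *)
Definition sigma_path {S : Type} (G : set_system S) (Z : R -> Om -> S) :
    set_system Om :=
  <<s \bigcup_(t in [set t | 0 <= t]) preimage_set_system setT (Z t) G >>.

Definition independent P (G1 G2 : set_system Om) : Prop :=
  forall A1 A2, G1 A1 -> G2 A2 -> P (A1 `&` A2) = (P A1 * P A2)%E.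

Definition mutually_independent P {I : choiceType} (G : I -> set_system Om) :
    Prop :=
  forall (s : seq I) (A : I -> set Om), uniq s ->
    (forall i, i \in s -> G i (A i)) ->
    P (\bigcap_(i in [set` s]) A i) = (\prod_(i <- s) P (A i))%E.

Definition filtration F : Prop :=
  [/\ forall t, 0 <= t -> sigma_algebra setT (F t),
      forall t, 0 <= t -> F t `<=` d.-measurable
    & forall s t, 0 <= s -> s <= t -> F s `<=` F t].

Definition adapted {S : Type} (G : set_system S) F (Z : R -> Om -> S) : Prop :=
  forall t, 0 <= t -> forall D, G D -> F t (Z t @^-1` D).

Definition optional_time F (T : Om -> \bar R) : Prop :=
  (forall w, (0 <= T w)%E) /\
  forall t, 0 <= t -> F t [set w | (T w < t%:E)%E].

(* The sigma-algebra of events prior to T, for the right-continuous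
   enlargement of F. *)
Definition past F (T : Om -> \bar R) : set_system Om :=
  [set A | d.-measurable A /\
           forall t, 0 <= t -> F t (A `&` [set w | (T w < t%:E)%E])].

Definition cadlag (f : R -> R) : Prop :=
  forall t, 0 <= t ->
    f @ t^'+ --> f t /\ (0 < t -> cvg (f @ t^'-)).

Definition brownian_motion P F (B : R -> Om -> R) : Prop :=
  [/\ adapted measurable F B,
      {ae P, forall w, B 0 w = 0},
      forall w, {within [set t | 0 <= t], continuous (B ^~ w)},
      forall s t, 0 <= s -> s < t ->
        independent P (F s)
          (preimage_set_system setT (fun w => B t w - B s w) measurable)
    & forall s t, 0 <= s -> s < t -> forall D, measurable D ->
        P [set w | D (B t w - B s w)] = normal_prob 0 (Num.sqrt (t - s)) D].

Definition poisson_process P F (lam : R) (N : R -> Om -> nat) : Prop :=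
  [/\ adapted setT F N,
      forall w, [/\ N 0 w = 0%N,
        forall s t, 0 <= s -> s <= t -> (N s w <= N t w)%N
      & forall t, 0 <= t -> \forall s \near t^'+, N s w = N t w],
      forall s t, 0 <= s -> s < t ->
        independent P (F s)
          (preimage_set_system setT (fun w => N t w - N s w)%N setT)
    & forall s t, 0 <= s -> s < t -> forall n,
        P [set w | (N t w - N s w)%N = n] =
        (poisson_pmf (lam * (t - s)) n)%:E].

Definition phase_chain {K : nat} P (beta : 'rV[R]_K) (B : 'M[R]_K)
    (Y : R -> Om -> option 'I_K) : Prop :=
  [/\ forall t, 0 <= t -> forall s, d.-measurable [set w | Y t w = s],
      forall w t, 0 <= t -> \forall u \near t^'+, Y u w = Y t w,
      forall s, P [set w | Y 0 w = s] = (phase_init beta s)%:E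
    & forall u v, 0 <= u -> 0 <= v -> forall A s s',
        sigma_path setT (fun t => Y (Num.min t u)) A ->
        P (A `&` [set w | Y u w = s] `&` [set w | Y (u + v) w = s']) =
        (P (A `&` [set w | Y u w = s]) * (phase_trans B v s s')%:E)%E].

Definition absorption_time {K : nat} (Y : R -> Om -> option 'I_K) (w : Om) : R :=
  inf [set u | 0 <= u /\ Y u w = None].

(* The integrand  \sum_(i < n) xi_i 1_(t_i, t_(i+1)]  with bounded
   F_(t_i)-measurable xi_i. *)
Record simple_integrand F := SimpleIntegrand {
  si_size : nat;
  si_time : nat -> R;
  si_coef : nat -> Om -> R;
  si_time0 : 0 <= si_time 0%N;
  si_timeS : forall i, si_time i <= si_time i.+1;
  si_adapted : forall i D, measurable D -> F (si_time i) (si_coef i @^-1` D);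
  si_bounded : exists M, forall i w, `|si_coef i w| <= M }.

Definition si_val F (S : simple_integrand F) (s : R) (w : Om) : R :=
  \sum_(i < si_size S)
    si_coef S i w * (si_time S i < s <= si_time S i.+1)%R%:R.

Definition si_integral F (S : simple_integrand F) (B : R -> Om -> R)
    (t : R) (w : Om) : R :=
  \sum_(i < si_size S)
    si_coef S i w * (B (Num.min t (si_time S i.+1)) w -
                     B (Num.min t (si_time S i)) w).

Definition cvg0_in_probability P (Z : nat -> Om -> \bar R) : Prop :=
  forall e : R, 0 < e ->
    (fun n => P [set w | (e%:E <= `|Z n w|)%E]) @ \oo --> 0%E.

(* I is the continuous version of the Ito integral  \int_0^t G_s dB_s:  the
   limit in probability of integrals of simple integrands that approximate G in
   L^2([0, t], ds), in probability, for every t. *)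
Definition ito_integral P F (B : R -> Om -> R) (G I : R -> Om -> R) : Prop :=
  [/\ forall t, 0 <= t -> measurable_fun setT (I t),
      {ae P, forall w, {within [set t | 0 <= t], continuous (I ^~ w)}}
    & exists S : nat -> simple_integrand F, forall t, 0 <= t ->
        cvg0_in_probability P (fun n w =>
          \int[lebesgue_measure]_(s in `[0%R, t])
             ((si_val (S n) s w - G s w) ^+ 2)%:E)%E /\
        cvg0_in_probability P (fun n w =>
          (si_integral (S n) B t w - I t w)%:E)].

End Probability.

Section JumpDiffusion.
Context {R : realType} {d : measure_display} {Om : measurableType d} {K : nat}.

Definition hitting (S : set R) (X : R -> Om -> R) (w : Om) : \bar R :=
  ereal_inf [set t%:E | t in [set t | 0 <= t /\ S (X t w)]].

Definition jump_size (Y : nat -> R -> Om -> option 'I_K) (i : nat) (w : Om) : R :=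
  absorption_time (Y i) w.

Definition jump_sum (N : R -> Om -> nat) (Y : nat -> R -> Om -> option 'I_K)
    (t : R) (w : Om) : R :=
  \sum_(i < N t w) jump_size Y i w.

Definition noise (B : R -> Om -> R) (N : R -> Om -> nat)
    (Y : nat -> R -> Om -> option 'I_K) (k : option (option nat)) :
    set_system Om :=
  match k with
  | None => sigma_path measurable B
  | Some None => sigma_path setT N
  | Some (Some i) => sigma_path setT (Y i)
  end.

Definition future_noise (B : R -> Om -> R) (N : R -> Om -> nat)
    (Y : nat -> R -> Om -> option 'I_K) (s : R) : set_system Om :=
  <<s sigma_path measurable (fun u w => B (s + u) w - B s w)
      `|` sigma_path setT (fun u w => N (s + u)%R w - N s w)%N
      `|` \bigcup_i sigma_path setT (fun v w => Y (N s w + i)%N v w) >>.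

(* The equation, stopped at the exit time Tl from (l, +oo). It is an equality
   in \bar R with a finite left-hand side, so the drift integral is finite. *)
Definition solves_sde (P : {measure set Om -> \bar R}) (F : R -> set_system Om)
    (l : R) (c sigma : R -> R) (X B : R -> Om -> R) (N : R -> Om -> nat)
    (Y : nat -> R -> Om -> option 'I_K) : Prop :=
  let Tl := hitting [set z | z <= l] X in
  exists2 I : R -> Om -> R,
    ito_integral P F B
      (fun s w => if (s%:E < Tl w)%E then sigma (X s w) else 0) I
  & {ae P, forall w, forall t, 0 <= t ->
      ((X t w)%:E =
       (X 0 w)%:E
       + \int[lebesgue_measure]_(s in [set s | (0 <= s <= t)%R /\ (s%:E < Tl w)%E])
           (c (X s w))%:E
       + (I t w)%:E
       - (jump_sum N Y (fine (mine t%:E (Tl w))) w)%:E)%E}.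

(* Strong Markov property at optional times, for finite-dimensional
   distributions of the path after T. *)
Definition strong_markov (P : R.-pker R ~> Om) (F : R -> set_system Om)
    (X : R -> Om -> R) : Prop :=
  forall (x : R) (T : Om -> \bar R), optional_time F T ->
  forall A, past F T A ->
  forall (n : nat) (u : 'I_n -> R) (D : 'I_n -> set R),
    (forall i, 0 <= u i) -> (forall i, measurable (D i)) ->
    let AT := A `&` [set w | (T w < +oo)%E] in
    P x (AT `&` [set w | forall i, D i (X (fine (T w) + u i) w)]) =
    (\int[P x]_(w in AT)
       P (X (fine (T w)) w) [set w' | forall i, D i (X (u i) w')])%E.

(* The state space is all of R: below l the process is frozen, at the position
   reached by the jump that took it out of (l, +oo). Jumps are numbered from 0;
   the chain [jd_Y i] realises the i-th jump. *)
Record jump_diffusion (l lam : R) (c sigma : R -> R)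
    (beta : 'rV[R]_K) (B : 'M[R]_K) := JumpDiffusion {
  jd_P : R.-pker R ~> Om;
  jd_F : R -> set_system Om;
  jd_X : R -> Om -> R;
  jd_W : R -> Om -> R;
  jd_N : R -> Om -> nat;
  jd_Y : nat -> R -> Om -> option 'I_K;
  jd_filtration : filtration jd_F;
  jd_adapted : adapted measurable jd_F jd_X;
  jd_cadlag : forall w, cadlag (jd_X ^~ w);
  jd_start : forall x, {ae jd_P x, forall w, jd_X 0 w = x};
  jd_absorbed : forall w s t, 0 <= s -> s <= t ->
    jd_X s w <= l -> jd_X t w = jd_X s w;
  jd_markov : strong_markov jd_P jd_F jd_X;
  jd_brownian : forall x, l < x -> brownian_motion (jd_P x) jd_F jd_W;
  jd_poisson : forall x, l < x -> poisson_process (jd_P x) jd_F lam jd_N;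
  jd_chain : forall x, l < x -> forall i, phase_chain (jd_P x) beta B (jd_Y i);
  jd_marks : forall t i v s, 0 <= t -> 0 <= v ->
    jd_F t [set w | (i < jd_N t w)%N /\ jd_Y i v w = s];
  jd_independent : forall x, l < x ->
    mutually_independent (jd_P x) (noise jd_W jd_N jd_Y);
  jd_future : forall x, l < x -> forall s, 0 <= s ->
    independent (jd_P x) (jd_F s) (future_noise jd_W jd_N jd_Y s);
  jd_sde : forall x, l < x ->
    solves_sde (jd_P x) jd_F l c sigma jd_X jd_W jd_N jd_Y }.

Definition discount (q : R) (T : \bar R) : R :=
  if T is t%:E then expR (- q * t) else 0.

Context {l lam : R} {c sigma : R -> R} {beta : 'rV[R]_K} {B : 'M[R]_K}.
Variable Z : jump_diffusion l lam c sigma beta B.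

Definition T_above (b : R) : Om -> \bar R := hitting [set z | b < z] (jd_X Z).
Definition T_below (a : R) : Om -> \bar R := hitting [set z | z < a] (jd_X Z).
Definition T_exit : Om -> \bar R := hitting [set z | z <= l] (jd_X Z).

Definition X_at (T : Om -> \bar R) (w : Om) : R := jd_X Z (fine (T w)) w.

Definition X_before (T : Om -> \bar R) (w : Om) : R :=
  lim (jd_X Z ^~ w @ (fine (T w))^'-).

(* The jump at time T_below a has (0-based) index N(T_below a) - 1. *)
Definition crossing_phase (a : R) (w : Om) : option 'I_K :=
  let T := T_below a in
  jd_Y Z (jd_N Z (fine (T w)) w).-1 (X_before T w - a) w.

Definition is_H (q : R) (H : R -> R) : Prop :=
  (forall x, l < x -> 0 < H x) /\
  forall x b, l < x -> x <= b ->
    \int[jd_P Z x]_(w in [set w | (T_above b w < T_exit w)%E])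
       discount q (T_above b w) = H x / H b.

Definition Psi_C (q x a : R) : R :=
  \int[jd_P Z x]_(w in [set w | (T_below a w < +oo)%E /\
                                X_at (T_below a) w = a])
     discount q (T_below a w).

(* A crossing by a jump happens at a positive time: the left limit does not make
   sense at time 0, and for x >= a time 0 contributes nothing. *)
Definition Psi_J (q x a : R) : 'rV[R]_K :=
  \row_k
  \int[jd_P Z x]_(w in [set w | [/\ (0 < T_below a w < +oo)%E,
                                    X_at (T_below a) w < a
                                  & crossing_phase a w = Some k]])
     discount q (T_below a w).

Definition Psi_bar (q b x a : R) : R :=
  \int[jd_P Z x]_(w in [set w | (T_above b w < T_below a w)%E])
     discount q (T_above b w).

Definition W_fun (q : R) (H : R -> R) (x a : R) : R :=
  H x - Psi_C q x a * H a
  - (Psi_J q x a *m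
     \col_k \int[lebesgue_measure]_(y in `[0, a - l])
        ((expmx (y *: B) *m exit_rates B) k 0 * H (a - y))) 0 0.

End JumpDiffusion.

(* Main.v *)
(* Write sigma, tau and zeta for T_below a, T_above b and T_exit, and let
   I_y(G) = E_y[exp(-q sigma) G(a - X_sigma)].
   - Overshoot law: if sigma is the time of the i-th jump then, V being the
     value before that jump, the jump is larger than V - a + y exactly when its
     chain is not yet absorbed at time V - a + y. The chain is independent of
     everything before the jump, so given the phase k at time V - a this has
     probability (exp(y B) 1)_k. Hence, for y >= a, I_y(G) equals
     Psi_C G(0) + sum_k Psi_J,k int_0^oo (exp(t B) b)_k G(t) dt.
   - Strong Markov property at tau, where X_tau = b because there are no upward
     jumps: E_x[exp(-q sigma) G(a - X_sigma); sigma < tau] = I_x(G) - Psi_bar I_b(G).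
     Indicator functions G give (ii).
   - Strong Markov property at sigma: H(x)/H(b) is Psi_bar plus the same
     quantity for G(y) = H(a - y)/H(b), where H vanishes on (-oo, l]. Hence
     W(x) = H(b) (H(x)/H(b) - I_x(G)) = Psi_bar W(b).
   - W(b) >= H(b) - H(a) > 0, because from a the first jump occurs before tau
     and is larger than b - l with positive probability.
   The independence of the i-th chain and the past of the i-th jump time is only
   available at deterministic times; it is transferred to the jump time by
   putting that time on the grids k/(n+1). *)

Require Import Defs.
From HB Require Import structures.
From mathcomp Require Import all_boot all_order all_algebra.
From mathcomp Require Import all_classical all_reals all_analysis.
From mathcomp Require Import measurable_realfun ring lra.
Set Implicit Arguments.
Unset Strict Implicit.
Unset Printing Implicit Defensive.
Import Order.TTheory GRing.Theory Num.Theory.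
Import numFieldNormedType.Exports.
Local Open Scope classical_set_scope.
Local Open Scope ring_scope.

(** * First passage times of right-continuous paths *)

(** Passage times into open sets are controlled only through events T < t, so everything is set up
    for optional times and the past of the right-continuous enlargement. The strong Markov
    hypothesis speaks of finitely many coordinates after T, while passage times depend on the whole
    path; hence a space of right-continuous absorbed paths, where agreement on cylinders extends to
    all measurable functionals. Absorption makes the exit from (l, +oo), an entrance into a closed
    set, as tractable as an entrance into an open one. Two objects lack regularity of their own. The
    exit density of a phase is known to be nonnegative only if the chain can visit that phase; the
    other phases are set aside throughout, since their crossing mass is zero. The function H is not
    assumed measurable; on (l, b] it is H b times an expectation that depends measurably on the
    starting point. The expectations of the statement are finite parts of extended integrals, so
    identities are proved in the extended reals and finiteness is checked before passing to R. *)

Section RightContinuous.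
Context {R : realType}.
Implicit Types (S : set R) (f : R -> R) (s t u : R).

(** Rounding strictly to the right, onto countably many values: a right-continuous process at a
    random time is the limit of its values at the rounded times, and on each cell the rounded time
    is a constant. *)
Definition grid_up (n : nat) t : R := (Num.truncn (t * n.+1%:R)).+1%:R / n.+1%:R.

Lemma grid_up_gt n t : 0 <= t -> t < grid_up n t.
Proof. by move=> t0; rewrite /grid_up ltr_pdivlMr ?ltr0n// truncnS_gt. Qed.

Lemma grid_up_le n t : 0 <= t -> grid_up n t <= t + n.+1%:R^-1.
Proof.
move=> t0; rewrite /grid_up ler_pdivrMr ?ltr0n// mulrDl mulVf ?pnatr_eq0//.
rewrite -natr1 lerD2r.
by have /andP[] := truncn_itv (mulr_ge0 t0 (ler0n R n.+1)).
Qed.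

Lemma cvg_invn : (n.+1%:R^-1 : R) @[n --> \oo] --> 0.
Proof. exact: cvg_harmonic. Qed.

Lemma cvg_grid_up t : 0 <= t -> grid_up n t @[n --> \oo] --> t.
Proof.
move=> t0; apply: (@squeeze_cvgr _ _ _ _ (fun=> t) (fun n => t + n.+1%:R^-1)).
- by apply: nearW => n; rewrite ltW ?grid_up_gt//= grid_up_le.
- exact: cvg_cst.
- rewrite -[X in _ --> X]addr0; apply: cvgD; [exact: cvg_cst|exact: cvg_invn].
Qed.

Definition rcontinuous f := forall t, 0 <= t -> f @ t^'+ --> f t.

Lemma right_continuous_grid_up f t : rcontinuous f -> 0 <= t ->
  f (grid_up n t) @[n --> \oo] --> f t.
Proof.
move=> rf t0; have /cvg_at_rightP := rf t t0; apply; split.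
  by move=> n; exact: grid_up_gt.
exact: cvg_grid_up.
Qed.

(* [hitting S X w] unfolds to [first_time S (X ^~ w)]. *)
Definition first_time S f : \bar R :=
  ereal_inf [set t%:E | t in [set t | 0 <= t /\ S (f t)]].

(** The only openness that measurability of passage times requires. It holds for open sets along
    right-continuous paths and for ]-oo, l] along paths absorbed there. *)
Definition right_open S f := forall t, 0 <= t -> S (f t) ->
  \forall u \near t^'+, S (f u).

Lemma first_time_ge0 S f : (0 <= first_time S f)%E.
Proof. by apply/ereal_infP => _ [t [t0 _] <-]; rewrite lee_fin. Qed.

Lemma first_time_le S f t : 0 <= t -> S (f t) -> (first_time S f <= t%:E)%E.
Proof. by move=> t0 St; apply: ereal_inf_lbound; exists t. Qed.

Lemma first_time_gt S f t : 0 <= t -> (t%:E < first_time S f)%E -> ~ S (f t).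
Proof. by move=> t0 + St; rewrite ltNge first_time_le. Qed.

Lemma first_time_lt S f t : (first_time S f < t%:E)%E ->
  exists s, [/\ 0 <= s, s < t & S (f s)].
Proof.
by move=> /ereal_inf_lt[_ [s [s0 Ss] <-]]; rewrite lte_fin => st; exists s.
Qed.

(** A visit persists for a short while to the right, hence contains a rational time still before
    [t]; this turns the event into a countable union. *)
Lemma first_time_lt_rat S f t : right_open S f -> (first_time S f < t%:E)%E ->
  exists r : rat, [/\ 0 <= ratr r :> R, ratr r < t & S (f (ratr r))].
Proof.
move=> oS /first_time_lt[s [s0 st Ss]].
have [e /= e0 He] := oS _ s0 Ss.
have sm : s < Num.min t (s + e) by rewrite lt_min st ltrDl.
have [r] := rat_in_itvoo sm; rewrite in_itv/= lt_min => /and3P[sr rt re].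
exists r; split; [exact: le_trans (ltW sr)|by []|].
apply: He => //=; rewrite /ball_/= distrC gtr0_norm ?subr_gt0//.
by rewrite ltrBlDl.
Qed.

Lemma first_time_near S f t e : first_time S f = t%:E -> 0 < e ->
  exists s, [/\ t <= s, s < t + e & S (f s)].
Proof.
move=> Tt e0; have : (first_time S f < (t + e)%:E)%E.
  by rewrite Tt lte_fin ltrDl.
move=> /first_time_lt[s [s0 st Ss]]; exists s; split => //.
by rewrite -lee_fin -Tt first_time_le.
Qed.

Lemma first_time_fine S f : (first_time S f < +oo)%E ->
  exists2 t, 0 <= t & first_time S f = t%:E.
Proof.
move=> Tfin; have T0 := first_time_ge0 S f.
have Tn : first_time S f \is a fin_num by rewrite ge0_fin_numE.
by exists (fine (first_time S f)); rewrite ?fine_ge0// fineK.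
Qed.

(** Either the infimum is attained, or visits occur arbitrarily soon after [t] and right continuity
    makes [f t] a limit of points of [S]. *)
Lemma first_time_closure S f t : first_time S f = t%:E -> rcontinuous f ->
  closure S (f t).
Proof.
move=> Tt rf A; rewrite nbhsE => -[U [oU Uft] UA].
have t0 : 0 <= t by rewrite -lee_fin -Tt first_time_ge0.
have nU : nbhs (f t) U by exact: open_nbhs_nbhs.
have [e /= e0 He] := rf t t0 _ nU.
have [s [ts ste Ss]] := first_time_near Tt e0.
exists (f s); split => //; apply: UA.
move: ts; rewrite le_eqVlt => /orP[/eqP <-//|ts].
apply: (He s) => //=; rewrite /ball_/= distrC gtr0_norm ?subr_gt0//.
by rewrite ltrBlDl.
Qed.

Lemma first_time_shift S f s : 0 <= s ->
  (forall u, 0 <= u -> u < s -> ~ S (f u)) ->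
  first_time S f = (s%:E + first_time S (fun u => f (s + u)%R))%E.
Proof.
move=> s0 nS; apply/eqP; rewrite eq_le; apply/andP; split.
  rewrite -leeBlDl//; apply/ereal_infP => _ [u [u0 Su] <-].
  rewrite leeBlDl// -EFinD; apply: first_time_le => //; exact: addr_ge0.
apply/ereal_infP => _ [u [u0 Su] <-].
have su : s <= u by rewrite leNgt; apply/negP => us; exact: nS Su.
rewrite -leeBrDl// -EFinB; apply: first_time_le; first by rewrite subr_ge0.
by rewrite addrCA subrr addr0.
Qed.

Lemma first_time_open S f : open S -> rcontinuous f -> right_open S f.
Proof.
move=> oS rf t t0 St; apply: (rf t t0); exact: open_nbhs_nbhs.
Qed.

Lemma first_time_below_le a f t : first_time [set z | z < a] f = t%:E ->
  rcontinuous f -> f t <= a.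
Proof.
move=> Tt rf; have C := first_time_closure Tt rf.
have /closure_id clo : closed [set z : R | z <= a] by exact: closed_le.
suff : [set z | z <= a] (f t) by [].
by rewrite clo; apply: closureS C => z /=; exact: ltW.
Qed.

Lemma first_time_above_ge b f t : first_time [set z | b < z] f = t%:E ->
  rcontinuous f -> b <= f t.
Proof.
move=> Tt rf; have C := first_time_closure Tt rf.
have /closure_id clo : closed [set z : R | b <= z] by exact: closed_ge.
suff : [set z | b <= z] (f t) by [].
by rewrite clo; apply: closureS C => z /=; exact: ltW.
Qed.

Lemma first_time_le_le l f t : first_time [set z | z <= l] f = t%:E ->
  rcontinuous f -> f t <= l.
Proof.
move=> Tt rf; have := first_time_closure Tt rf.
by have /closure_id <- : closed [set z : R | z <= l] by exact: closed_le.
Qed.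

End RightContinuous.

Section RandomTimes.
Context {R : realType} {d : measure_display} {Om : measurableType d}.
Implicit Types (Z : R -> Om -> R) (T : Om -> R).

Lemma measurable_eval Z T :
  (forall t, 0 <= t -> measurable_fun setT (Z t)) ->
  (forall w, rcontinuous (Z ^~ w)) ->
  measurable_fun setT T -> (forall w, 0 <= T w) ->
  measurable_fun setT (fun w => Z (T w) w).
Proof.
move=> mZ rZ mT T0.
apply: (@measurable_fun_cvg _ _ R _ (fun n w => Z (grid_up n (T w)) w)); last first.
  by move=> w _; exact: (right_continuous_grid_up (rZ w)).
move=> n _ D mD; rewrite setTI.
rewrite (_ : _ @^-1` _ = \bigcup_k
    (T @^-1` `[k%:R / n.+1%:R, k.+1%:R / n.+1%:R[ `&`
     (Z (k.+1%:R / n.+1%:R) @^-1` D))).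
  apply: bigcup_measurable => k _; apply: measurableI.
    by rewrite -[X in measurable X]setTI; exact: mT.
  by rewrite -[X in measurable X]setTI; apply: mZ => //; exact: divr_ge0.
apply/seteqP; split => w /=.
  move=> Dw; exists (Num.truncn (T w * n.+1%:R)) => //; split => //=.
  rewrite in_itv/= ler_pdivrMr ?ltr0n// ltr_pdivlMr ?ltr0n//.
  exact: truncn_itv (mulr_ge0 _ _).
move=> [k _ [/=]]; rewrite in_itv/= ler_pdivrMr ?ltr0n// ltr_pdivlMr ?ltr0n// => kT.
by rewrite /grid_up (truncn_def kT).
Qed.

Lemma sigma_algebra_bigcup_count {J : countType} (G : set_system Om) (I : set J)
    (A : J -> set Om) : sigma_algebra setT G -> (forall r, I r -> G (A r)) ->
  G (\bigcup_(r in I) A r).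
Proof.
move=> [G0 GC GU] GA.
pose B n := if unpickle n is Some r then if `[< I r >] then A r else set0
  else set0.
rewrite (_ : \bigcup_(r in I) A r = \bigcup_n B n).
  apply: GU => n; rewrite /B; case: unpickle => [r|//].
  by case: asboolP => // /GA.
apply/seteqP; split => [w [r Ir Arw]|w [n _]].
  by exists (pickle r) => //; rewrite /B pickleK; case: asboolP.
rewrite /B; case: unpickle => [r|//]; case: asboolP => // Ir Arw.
by exists r.
Qed.

Lemma hitting_lt_bigcup S Z t : (forall w, right_open S (Z ^~ w)) ->
  [set w | (hitting S Z w < t%:E)%E] =
  \bigcup_(r in [set r : rat | 0 <= ratr r :> R /\ ratr r < t])
    (Z (ratr r) @^-1` S).
Proof.
move=> oS; apply/seteqP; split => w /=.
  by move=> /(first_time_lt_rat (oS w))[r [r0 rt Sr]]; exists r.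
move=> [r /= [r0 rt] Sr]; apply: le_lt_trans (_ : (ratr r)%:E < _)%E.
  exact: (@first_time_le _ S (Z ^~ w)).
by rewrite lte_fin.
Qed.

(** [G] is arbitrary and only times before [t] are consulted, so the same argument gives
    measurability and, with [G] the past at [t], optional times. *)
Lemma hitting_lt_measurable S Z t (G : set_system Om) :
  (forall w, right_open S (Z ^~ w)) -> sigma_algebra setT G ->
  (forall s, 0 <= s -> s < t -> G (Z s @^-1` S)) ->
  G [set w | (hitting S Z w < t%:E)%E].
Proof.
move=> oS sG GZ; rewrite hitting_lt_bigcup//.
by apply: sigma_algebra_bigcup_count => // r [r0 rt]; exact: GZ.
Qed.

Lemma measurable_emeasurable_lt (T : Om -> \bar R) :
  (forall t, measurable [set w | (T w < t%:E)%E]) -> measurable_fun setT T.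
Proof.
move=> mT.
apply: (measurability _ (ErealGenInftyO.measurableE R)) => _ /= -[_ [r ->] <-].
rewrite setTI; have := mT r.
by congr (measurable _); apply/seteqP; split => w /=; rewrite in_itv.
Qed.

Lemma measurable_hitting S Z : (forall w, right_open S (Z ^~ w)) ->
  (forall t, 0 <= t -> measurable (Z t @^-1` S)) ->
  measurable_fun setT (hitting S Z).
Proof.
move=> oS mZ; apply: measurable_emeasurable_lt => t.
apply: (@hitting_lt_measurable S Z t measurable) => //.
  exact: sigma_algebra_measurable.
by move=> s s0 _; exact: mZ.
Qed.

End RandomTimes.

(** * Path space and the strong Markov property for functionals *)

Section ImageMeasure.
Context {d1 d2} {T1 : measurableType d1} {T2 : measurableType d2} {R : realType}.

Definition image_measure (m : {measure set T1 -> \bar R}) (f : T1 -> T2)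
    (mf : measurable_fun setT f) : {measure set T2 -> \bar R} :=
  measure_function_pushforward__canonical__measure_function_Measure m mf.

Lemma integral_image_measure (m : {measure set T1 -> \bar R}) (f : T1 -> T2)
    (mf : measurable_fun setT f) D (g : T2 -> \bar R) : measurable D ->
  measurable_fun D g -> (forall y, D y -> (0 <= g y)%E) ->
  (\int[image_measure m mf]_(y in D) g y = \int[m]_(x in f @^-1` D) g (f x))%E.
Proof.
move=> mD mg g0; apply: (ge0_integral_pushforward mf) => //.
by move=> y /set_mem /g0.
Qed.

End ImageMeasure.

Section RealMeasureUniqueness.
Context {R : realType}.
Variables m1 m2 : {measure set R -> \bar R}.
Hypothesis m1T : (m1 setT < +oo)%E.

Let bounded_by_setT A : measurable A -> (m1 A < +oo)%E.
Proof. by move=> mA; apply: le_lt_trans m1T; apply: le_measure; rewrite ?inE. Qed.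

Lemma real_measure_unique_lt : (forall r, m1 `]-oo, r[%classic = m2 `]-oo, r[%classic) ->
  forall A, measurable A -> m1 A = m2 A.
Proof.
move=> m12; apply: (@measure_unique _ R R (@RGenInftyO.G R)
    (fun k => `]-oo, k%:R[%classic)).
- exact: RGenInftyO.measurableE.
- move=> _ _ [r ->] [s ->]; exists (Num.min r s).
  by apply/seteqP; split => y /=; rewrite !in_itv/= lt_min => /andP.
- by move=> k; exists k%:R.
- apply/seteqP; split => // y _; exists (Num.truncn y).+1 => //=.
  by rewrite in_itv/= truncnS_gt.
- by move=> _ [r ->].
- by move=> k; exact: bounded_by_setT.
Qed.

Lemma real_measure_unique_gt : (forall r, m1 `]r, +oo[%classic = m2 `]r, +oo[%classic) ->
  forall A, measurable A -> m1 A = m2 A.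
Proof.
move=> m12; apply: (@measure_unique _ R R (@RGenOInfty.G R)
    (fun k => `](- k%:R), +oo[%classic)).
- exact: RGenOInfty.measurableE.
- move=> _ _ [r ->] [s ->]; exists (Num.max r s).
  by apply/seteqP; split => y /=; rewrite !in_itv/= !andbT gt_max => /andP.
- by move=> k; exists (- k%:R).
- apply/seteqP; split => // y _; exists (Num.truncn (- y)).+1 => //=.
  by rewrite in_itv/= andbT ltrNl truncnS_gt.
- by move=> _ [r ->].
- by move=> k; exact: bounded_by_setT.
Qed.

End RealMeasureUniqueness.

Section Indicator.
Context {T : Type} {R : numDomainType}.

Lemma indic_ge0 (A : set T) w : 0 <= (\1_A w : R).
Proof. exact: ler0n. Qed.

Lemma indic_le1 (A : set T) w : (\1_A w : R) <= 1.
Proof. by rewrite indicE; case: (_ \in _); rewrite ?lexx ?ler01. Qed.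

End Indicator.

Section WeightedLaw.
Context {d0 d1 d2} {T0 : measurableType d0} {T1 : measurableType d1}
  {T2 : measurableType d2} {R : realType}.
Variables (P : R.-pker T0 ~> T1) (phi : T1 -> T2) (wt : T1 -> R).
Hypotheses (mphi : measurable_fun setT phi) (mwt : measurable_fun setT wt)
  (wt0 : forall w, 0 <= wt w) (wt1 : forall w, wt w <= 1).

(** Composing this mass with [P] yields the image under [phi] of the measure with density [wt]
    relative to [P x]; sigma-additivity is supplied by kernel composition. Many identities between
    expectations below are reduced to the equality of two such laws. *)
Definition weighted_dirac (xw : T0 * T1) : {measure set T2 -> \bar R} :=
  mscale (NngNum (wt0 xw.2)) (dirac (phi xw.2)).

Let weighted_dirac_measurable U : measurable U ->
  measurable_fun setT (weighted_dirac ^~ U).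
Proof.
move=> mU; rewrite /weighted_dirac /mscale/=.
apply: emeasurable_funM; apply/measurable_EFinP.
  exact: measurableT_comp.
rewrite (_ : (fun x : T0 * T1 => _) = (\1_U : T2 -> R) \o phi \o snd)//.
by apply: measurableT_comp => //; exact: measurableT_comp.
Qed.

HB.instance Definition _ := isKernel.Build _ _ _ _ _ weighted_dirac
  weighted_dirac_measurable.

Let weighted_dirac_uub : measure_fam_uub weighted_dirac.
Proof.
exists 2 => -[y w]; rewrite /weighted_dirac /= /mscale/= diracT mule1 lte_fin.
by rewrite (le_lt_trans (wt1 _))// ltr1n.
Qed.

HB.instance Definition _ := Kernel_isFinite.Build _ _ _ _ _ weighted_dirac
  weighted_dirac_uub.

Definition weighted_law x : {measure set T2 -> \bar R} := mkcomp P weighted_dirac x.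

Lemma integral_weighted_law x D (g : T2 -> \bar R) : measurable D ->
  measurable_fun setT g -> (forall y, 0 <= g y)%E ->
  (\int[weighted_law x]_(y in D) g y =
   \int[P x]_(w in phi @^-1` D) ((wt w)%:E * g (phi w)))%E.
Proof.
move=> mD mg g0.
rewrite integral_mkcond integral_kcomp//; last 2 first.
- by move=> y; rewrite patchE; case: ifP.
- by apply/(measurable_restrictT _ _).1 => //; exact: measurable_funTS.
rewrite [RHS]integral_mkcond; apply: eq_integral => w _.
rewrite /weighted_dirac ge0_integral_mscale//=; last 2 first.
- by apply/(measurable_restrictT _ _).1 => //; exact: measurable_funTS.
- by move=> y _; rewrite patchE; case: ifP.
rewrite integral_dirac//; last first.
  by apply/(measurable_restrictT _ _).1 => //; exact: measurable_funTS.
rewrite diracT mul1e !patchE.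
have -> : (w \in phi @^-1` D) = (phi w \in D) by apply/idP/idP; rewrite !inE.
by case: ifP; rewrite ?mule0.
Qed.

Lemma weighted_lawE x D : measurable D ->
  (weighted_law x D = \int[P x]_(w in phi @^-1` D) (wt w)%:E)%E.
Proof.
move=> mD; rewrite -[LHS]mul1e -integral_cst// integral_weighted_law//.
by apply: eq_integral => w _; rewrite mule1.
Qed.

Lemma weighted_law_lty x : (weighted_law x setT < +oo)%E.
Proof.
rewrite weighted_lawE// preimage_setT; apply: (@le_lt_trans _ _ (\int[P x]_w 1)%E).
  apply: ge0_le_integral => //.
  - by move=> w _; rewrite lee_fin.
  - by apply/measurable_EFinP.
  - by move=> w _; rewrite lee_fin.
by rewrite integral_cst// mul1e prob_kernel ltry.
Qed.

End WeightedLaw.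

Section PathSpace.
Context {R : realType} (l : R).

Definition absorbed_path (f : R -> R) :=
  forall s t, 0 <= s -> s <= t -> f s <= l -> f t = f s.

(** Right continuity and absorption are what passage times need in order to be measurable. Values at
    negative times are unconstrained, which is why coordinates are used at nonnegative times
    only. *)
Record path := Path {
  path_fun :> R -> R;
  path_right_continuous : rcontinuous path_fun;
  path_absorbed : absorbed_path path_fun }.

Lemma right_continuous_cst : rcontinuous (fun _ : R => 0 : R).
Proof. by move=> t t0; exact: cvg_cst. Qed.

Definition path0 := Path right_continuous_cst (fun _ _ _ _ _ => erefl).

HB.instance Definition _ := gen_eqMixin path.
HB.instance Definition _ := gen_choiceMixin path.
HB.instance Definition _ := isPointed.Build path path0.

(** Exactly the kind of events for which [strong_markov] is stated; they are stable under
    intersection, so they determine a finite measure. *)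
Definition cylinder : set_system path := [set E | exists n (u : 'I_n -> R)
  (D : 'I_n -> set R), [/\ forall i, 0 <= u i, forall i, measurable (D i)
    & E = [set p : path | forall i, D i (p (u i))]]].

Definition path_space := g_sigma_algebraType cylinder.

Definition coordinate (t : R) (p : path_space) : R := path_fun p t.

Lemma measurable_coordinate t : 0 <= t ->
  measurable_fun setT (coordinate t).
Proof.
move=> t0 _ D mD; rewrite setTI; apply: sub_sigma_algebra.
exists 1%N, (fun=> t), (fun=> D); split => //.
by apply/seteqP; split => p /=; [move=> Dp _|move=> /(_ ord0)].
Qed.

Lemma cylinder_setI : setI_closed cylinder.
Proof.
move=> _ _ [n [u [D [u0 mD ->]]]] [m [v [E [v0 mE ->]]]].
pose pick (T : Type) (f : 'I_n -> T) (g : 'I_m -> T) (i : 'I_(n + m)) :=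
  match fintype.split i with inl j => f j | inr j => g j end.
exists (n + m)%N, (pick _ u v), (pick _ D E); split.
- by move=> i; rewrite /pick; case: fintype.split.
- by move=> i; rewrite /pick; case: fintype.split.
apply/seteqP; split => p /=.
  by move=> [Dp Ep] i; rewrite /pick; case: fintype.split.
move=> H; split => i.
  by have := H (unsplit (inl i)); rewrite /pick unsplitK.
by have := H (unsplit (inr i)); rewrite /pick unsplitK.
Qed.

Lemma cylinder_setT : cylinder setT.
Proof.
exists 0%N, (fun=> 0), (fun=> setT); split => //.
by apply/seteqP; split.
Qed.

Lemma measurable_to_path {d} {Om : measurableType d} (g : Om -> path_space) :
  (forall t, 0 <= t -> measurable_fun setT (fun w => path_fun (g w) t)) ->
  measurable_fun setT g.
Proof.
move=> mg; apply: (measurability (cylinder : set (set path_space)) erefl).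
move=> _ [_ [n [u [D [u0 mD ->]]]] <-]; rewrite setTI.
rewrite (_ : _ @^-1` _ =
    \bigcap_(i in [set: 'I_n]) ((fun w => path_fun (g w) (u i)) @^-1` D i)).
  apply: fin_bigcap_measurable; first exact: finite_finset.
  by move=> i _; rewrite -[X in measurable X]setTI; exact: mg.
by apply/seteqP; split => w /= H i; [move=> _; exact: H|exact: H].
Qed.

Lemma path_measure_unique (m1 m2 : {measure set path_space -> \bar R}) :
  (m1 setT < +oo)%E -> (forall E, cylinder E -> m1 E = m2 E) ->
  forall E, measurable E -> m1 E = m2 E.
Proof.
move=> m1T m12; apply: (@measure_unique _ _ path_space cylinder (fun=> setT)) => //.
- exact: cylinder_setI.
- by move=> _; exact: cylinder_setT.
- by rewrite bigcup_const.
Qed.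

End PathSpace.

Section StrongMarkovFunctional.
Context {R : realType} {d : measure_display} {Om : measurableType d} {K : nat}.
Context {l lam : R} {c sigma : R -> R} {beta : 'rV[R]_K} {B : 'M[R]_K}.
Variable Z : @jump_diffusion R d Om K l lam c sigma beta B.

Local Notation X := (jd_X Z).
Local Notation P := (jd_P Z).
Local Notation F := (jd_F Z).

Lemma past_time_measurable t A : 0 <= t -> F t A -> measurable A.
Proof. by move=> t0; case: (jd_filtration Z) => _ + _; apply. Qed.

Lemma X_measurable t : 0 <= t -> measurable_fun setT (X t).
Proof.
move=> t0 _ D mD; rewrite setTI; apply: (past_time_measurable t0).
exact: (jd_adapted Z).
Qed.

Lemma X_right_continuous w : rcontinuous (X ^~ w).
Proof. by move=> t t0; case: (jd_cadlag Z w t0). Qed.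

Lemma X_absorbed w : absorbed_path l (X ^~ w).
Proof. by move=> s t s0 st; exact: jd_absorbed. Qed.

(** Truncating at 0 makes this a legitimate path for every real [t], so that [path_from] is a total
    function. *)
Definition shifted_path (t : R) (w : Om) : R -> R := fun u => X (Num.max 0 t + u) w.

Lemma shifted_path_right_continuous t w : rcontinuous (shifted_path t w).
Proof.
move=> u u0; have tu0 : 0 <= Num.max 0 t + u by rewrite addr_ge0// le_max lexx.
have /cvg_at_rightP H := @X_right_continuous w _ tu0.
apply/cvg_at_rightP => v [uv vu]; apply: H; split.
  by move=> n; rewrite ltrD2l.
by apply: cvgD => //; exact: cvg_cst.
Qed.

Lemma shifted_path_absorbed t w : absorbed_path l (shifted_path t w).
Proof.
move=> u v u0 uv; apply: X_absorbed; last by rewrite lerD2l.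
by rewrite addr_ge0// le_max lexx.
Qed.

Definition path_from (t : R) (w : Om) : path_space l :=
  Path (@shifted_path_right_continuous t w) (@shifted_path_absorbed t w).

Lemma path_from0E w : path_fun (path_from 0 w) = X ^~ w.
Proof. by apply/funext => u; rewrite /= /shifted_path maxxx add0r. Qed.

Lemma X_eval_measurable (T : Om -> R) : measurable_fun setT T ->
  (forall w, 0 <= T w) -> measurable_fun setT (fun w => X (T w) w).
Proof.
move=> mT T0; apply: measurable_eval => //; first exact: X_measurable.
exact: X_right_continuous.
Qed.

Lemma measurable_path_from (T : Om -> R) : measurable_fun setT T ->
  measurable_fun setT (fun w => path_from (T w) w).
Proof.
move=> mT; apply: measurable_to_path => t t0 /=; rewrite /shifted_path.
apply: (X_eval_measurable (T := fun w => Num.max 0 (T w) + t)).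
  by apply: measurable_funD => //; exact: measurable_maxr.
by move=> w; rewrite addr_ge0// le_max lexx.
Qed.

Section Bind.
Variables (V : Om -> R) (mV : measurable_fun setT V) (A : set Om)
  (mA : measurable A).

Let mX0 : measurable_fun setT (path_from 0).
Proof. exact: (measurable_path_from (T := fun=> 0)). Qed.

(** For [w] in [A], the law of a fresh path started at [V w]; otherwise zero. Averaged over [w], it
    is the right-hand side of the strong Markov property seen as a measure on path space. *)
Definition restart_measure (xw : R * Om) : {measure set (path_space l) -> \bar R} :=
  mscale (NngNum (ler0n R (xw.2 \in A))) (image_measure (P (V xw.2)) mX0).

Let restart_measurable U : measurable U ->
  measurable_fun setT (restart_measure ^~ U).
Proof.
move=> mU; rewrite /restart_measure /mscale/=.
apply: emeasurable_funM.
  apply/measurable_EFinP.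
  rewrite (_ : (fun x : R * Om => _) = (\1_A : Om -> R) \o snd)//.
  apply: measurableT_comp => //; exact: measurable_indic.
rewrite /image_measure/= /pushforward.
have mXU : measurable (path_from 0 @^-1` U).
  by rewrite -[X in measurable X]setTI; exact: mX0.
apply: (measurableT_comp (measurable_kernel P _ mXU)).
exact: measurableT_comp.
Qed.

HB.instance Definition _ := isKernel.Build _ _ _ _ _ restart_measure
  restart_measurable.

Let restart_uub : measure_fam_uub restart_measure.
Proof.
exists 2 => -[y w]; rewrite /restart_measure /= /mscale/=.
rewrite /image_measure/= /pushforward preimage_setT prob_kernel mule1 lte_fin.
by case: (_ \in _); rewrite ltr_nat.
Qed.

HB.instance Definition _ := Kernel_isFinite.Build _ _ _ _ _ restart_measure
  restart_uub.

Definition restart_law x : {measure set (path_space l) -> \bar R} :=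
  mkcomp P restart_measure x.

Lemma restart_integral x (Phi : path_space l -> \bar R) :
  (forall p, 0 <= Phi p)%E -> measurable_fun setT Phi ->
  (\int[restart_law x]_p Phi p =
   \int[P x]_(w in A) \int[P (V w)]_w' Phi (path_from 0 w'))%E.
Proof.
move=> Phi0 mPhi; rewrite /restart_law integral_kcomp// [RHS]integral_mkcond.
apply: eq_integral => w _; rewrite patchE /restart_measure.
rewrite ge0_integral_mscale//= integral_image_measure//.
by case: (w \in A); rewrite ?mul1e ?mul0e.
Qed.

End Bind.

Section AtOptionalTime.
Variables (T : Om -> \bar R) (oT : optional_time F T).

Lemma optional_time_measurable : measurable_fun setT T.
Proof.
apply: measurable_emeasurable_lt => t; case: (leP 0 t) => t0.
  by apply: (past_time_measurable t0); case: oT => _; apply.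
rewrite (_ : [set _ | _] = set0)//; apply/seteqP; split => w //=.
by move=> /(le_lt_trans (oT.1 w)); rewrite lte_fin ltNge (ltW t0).
Qed.

Lemma measurable_fine_time : measurable_fun setT (fun w => fine (T w)).
Proof. exact/measurableT_comp/optional_time_measurable. Qed.

Lemma X_at_measurable : measurable_fun setT (X_at Z T).
Proof.
apply: X_eval_measurable; first exact: measurable_fine_time.
by move=> w; apply: fine_ge0; exact: oT.1.
Qed.

Lemma measurable_time_finite : measurable [set w | (T w < +oo)%E].
Proof.
rewrite -[X in measurable X]setTI.
exact: (emeasurable_fun_infty_o measurableT optional_time_measurable).
Qed.

(** Both sides integrate [Phi] against finite measures on path space: the law of the path after [T]
    on the event, and the law of the restarted paths. The hypothesis [strong_markov] says that they
    agree on cylinders. *)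
Lemma strong_markov_path x A (Phi : path_space l -> R) :
  past F T A -> (forall p, 0 <= Phi p) -> measurable_fun setT Phi ->
  (\int[P x]_(w in A `&` [set w | (T w < +oo)%E])
     (Phi (path_from (fine (T w)) w))%:E =
   \int[P x]_(w in A `&` [set w | (T w < +oo)%E])
     \int[P (X_at Z T w)]_w' (Phi (path_from 0 w'))%:E)%E.
Proof.
move=> pA Phi0 mPhi; set AT := _ `&` [set w | (T w < +oo)%E].
have mAT : measurable AT.
  by apply: measurableI; [case: pA|exact: measurable_time_finite].
have mth : measurable_fun setT (fun w => path_from (fine (T w)) w).
  exact/measurable_path_from/measurable_fine_time.
pose m1 := weighted_law P mth (measurable_indic mAT) (indic_ge0 AT) x.
pose m2 := restart_law X_at_measurable mAT x.
have m1E E : measurable E ->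
    m1 E = P x (AT `&` [set w | E (path_from (fine (T w)) w)]).
  move=> mE; rewrite /m1 weighted_lawE//.
  rewrite integral_indic//.
  by rewrite -[X in measurable X]setTI; exact: (mth measurableT).
have m2E E : measurable E -> m2 E =
    (\int[P x]_(w in AT) P (X_at Z T w) [set w' | E (path_from 0 w')])%E.
  move=> mE; rewrite /m2 /restart_law /mkcomp /= /kcomp [RHS]integral_mkcond.
  apply: eq_integral => w _; rewrite patchE /restart_measure /= /mscale/=.
  by case: (w \in AT); rewrite ?mul1e ?mul0e.
suff m12 : forall E, measurable E -> m1 E = m2 E.
  transitivity (\int[m1]_p (Phi p)%:E)%E.
    rewrite integral_weighted_law//; last exact/measurable_EFinP.
    rewrite preimage_setT [LHS]integral_mkcond; apply: eq_integral => w _.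
    by rewrite patchE indicE; case: (w \in AT); rewrite ?mul1e ?mul0e.
  rewrite (eq_measure_integral m2) => [|E mE _]; last exact: m12.
  by rewrite restart_integral//; exact/measurable_EFinP.
apply: path_measure_unique => //.
  by apply: weighted_law_lty; exact: indic_le1.
move=> _ [n [u [D [u0 mD ->]]]].
have mC : measurable ([set p : path_space l | forall i, D i (path_fun p (u i))]).
  by apply: sub_sigma_algebra; exists n, u, D.
rewrite m1E// m2E//.
transitivity (P x (AT `&` [set w | forall i, D i (X (fine (T w) + u i) w)])).
  congr (P x (AT `&` _)).
  by apply/seteqP; split => w /= H i; have := H i; rewrite /shifted_path
    max_r// fine_ge0//; exact: oT.1.
have -> := @jd_markov _ _ _ _ _ _ _ _ _ _ Z x T oT A pA n u D u0 mD.
apply: eq_integral => w _; congr (P _ _).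
by apply/seteqP; split => w' /= H i; have := H i; rewrite /shifted_path
  maxxx add0r.
Qed.

(* The weighted laws of [T] on both sides agree on every measurable set of
   times, since [T] is measurable with respect to its own past. *)
Lemma strong_markov_discount x A q (Phi : path_space l -> R) : 0 <= q ->
  past F T A -> (forall p, 0 <= Phi p) -> (forall p, Phi p <= 1) ->
  measurable_fun setT Phi ->
  (\int[P x]_(w in A `&` [set w | (T w < +oo)%E])
     (discount q (T w) * Phi (path_from (fine (T w)) w))%:E =
   \int[P x]_(w in A `&` [set w | (T w < +oo)%E])
     ((discount q (T w))%:E *
      \int[P (X_at Z T w)]_w' (Phi (path_from 0 w'))%:E))%E.
Proof.
move=> q0 pA Phi0 Phi1 mPhi; set AT := _ `&` [set w | (T w < +oo)%E].
have mA : measurable A by case: pA.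
have mAT : measurable AT by apply: measurableI => //; exact: measurable_time_finite.
have mth : measurable_fun setT (fun w => path_from (fine (T w)) w).
  exact/measurable_path_from/measurable_fine_time.
pose G v := (\int[P v]_w' (Phi (path_from 0 w'))%:E)%E.
have mPhi0 : measurable_fun setT (fun w' => Phi (path_from 0 w')).
  apply: (measurableT_comp mPhi).
  exact: (measurable_path_from (T := fun=> 0)).
have G0 v : (0 <= G v)%E by apply: integral_ge0 => w' _; rewrite lee_fin.
have G1 v : (G v <= 1)%E.
  apply: (@le_trans _ _ (\int[P v]_w' 1)%E).
    apply: ge0_le_integral => //.
    - by move=> w _; rewrite lee_fin.
    - exact/measurable_EFinP.
    - by move=> w _; rewrite lee_fin.
  by rewrite integral_cst// mul1e prob_kernel.
have GE v : (fine (G v))%:E = G v.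
  by rewrite fineK// ge0_fin_numE// (le_lt_trans (G1 v))// ltry.
have mG : measurable_fun setT (fun w => fine (G (X_at Z T w))).
  apply: measurableT_comp => //.
  have : measurable_fun setT G.
    apply: measurable_fun_integral_kernel; first exact: measurable_kernel.
      by move=> w'; rewrite lee_fin.
    exact/measurable_EFinP.
  move=> H; exact: (measurableT_comp H X_at_measurable).
pose w1 w := \1_AT w * Phi (path_from (fine (T w)) w).
pose w2 w := \1_AT w * fine (G (X_at Z T w)).
have w10 w : 0 <= w1 w by rewrite mulr_ge0.
have w20 w : 0 <= w2 w by rewrite mulr_ge0// fine_ge0.
have w11 w : w1 w <= 1 by rewrite mulr_ile1// indic_le1.
have w21 w : w2 w <= 1.
  by rewrite mulr_ile1// ?indic_le1// ?fine_ge0// -lee_fin GE.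
have mw1 : measurable_fun setT w1.
  by apply: measurable_funM => //; exact: measurableT_comp.
have mw2 : measurable_fun setT w2 by apply: measurable_funM.
pose L1 := weighted_law P measurable_fine_time mw1 w10 x.
pose L2 := weighted_law P measurable_fine_time mw2 w20 x.
have L12 : forall D, measurable D -> L1 D = L2 D.
  apply: real_measure_unique_lt; first exact: weighted_law_lty.
  move=> r; rewrite /L1 /L2 !weighted_lawE//.
  have pAr : past F T (A `&` [set w | (T w < r%:E)%E]).
    split => [|t t0].
      apply: measurableI => //; rewrite -[X in measurable X]setTI.
      exact: (emeasurable_fun_infty_o measurableT optional_time_measurable).
    have [r0|r0] := leP r 0.
      rewrite (_ : (A `&` _) `&` _ = set0); last first.
        apply/seteqP; split => w //= [[_ /= Tr] _].
        by have := le_lt_trans (oT.1 w) Tr; rewrite lte_fin ltNge r0.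
      by have [sF _ _] := jd_filtration Z; have [] := sF t t0.
    rewrite (_ : (A `&` _) `&` _ = A `&` [set w | (T w < (Num.min r t)%:E)%E]); last first.
      apply/seteqP; split => w /=; rewrite EFin_min lt_min.
        by move=> [[Aw Tr] Tt]; split => //; rewrite Tr Tt.
      by move=> [Aw /andP[]].
    have [_ _ mF] := jd_filtration Z.
    have rt0 : 0 <= Num.min r t by rewrite le_min (ltW r0) t0.
    have rt : Num.min r t <= t by rewrite ge_min lexx orbT.
    by apply: (mF _ _ rt0 rt); case: pA => _; apply.
  have ATr : (A `&` [set w | (T w < r%:E)%E]) `&` [set w | (T w < +oo)%E] =
      AT `&` (fun w => fine (T w)) @^-1` `]-oo, r[.
    apply/seteqP; split => w /=; rewrite in_itv/=.
      move=> [[Aw Tr] Too]; split => //.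
      by rewrite -lte_fin fineK// ge0_fin_numE// oT.1.
    move=> [[Aw Too]]; rewrite -lte_fin fineK ?ge0_fin_numE ?oT.1//.
  transitivity (\int[P x]_(w in AT `&` (fun w => fine (T w)) @^-1` `]-oo, r[)
      (Phi (path_from (fine (T w)) w))%:E)%E.
    rewrite [RHS]integral_mkcondl; apply: eq_integral => w _.
    by rewrite patchE /w1 indicE; case: (w \in AT); rewrite ?mul1r ?mul0r.
  rewrite -ATr strong_markov_path// ATr.
  rewrite [LHS]integral_mkcondl; apply: eq_integral => w _.
  by rewrite patchE /w2 indicE; case: (w \in AT); rewrite ?mul1r ?mul0r// GE.
have mq : measurable_fun setT (fun y : R => (expR (- q * y))%:E).
  apply/measurable_EFinP; apply: (measurableT_comp (@measurable_expR R)).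
  exact: mulrl_measurable.
have e0 (y : R) : (0 <= (expR (- q * y))%:E)%E by rewrite lee_fin expR_ge0.
have key : (\int[L1]_y (expR (- q * y))%:E = \int[L2]_y (expR (- q * y))%:E)%E.
  by apply: eq_measure_integral => D mD _; exact: L12.
move: key; rewrite /L1 /L2 !integral_weighted_law// !preimage_setT => key.
transitivity (\int[P x]_w ((w1 w)%:E * (expR (- q * fine (T w)))%:E))%E.
  rewrite [LHS]integral_mkcond; apply: eq_integral => w _.
  rewrite patchE /w1 indicE; case: ifPn => [|_]; last by rewrite mul0r mul0e.
  rewrite inE => -[_ /= Too]; rewrite mul1r -EFinM mulrC.
  by move: Too (oT.1 w); case: (T w).
rewrite key [RHS]integral_mkcond; apply: eq_integral => w _.
rewrite patchE /w2 indicE; case: ifPn => [|_]; last by rewrite mul0r mul0e.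
rewrite inE => -[_ /= Too]; rewrite mul1r GE muleC.
by move: Too (oT.1 w); case: (T w).
Qed.

End AtOptionalTime.

End StrongMarkovFunctional.

(** * Matrix exponentials and phase-type survival functions *)

Lemma cvg_sumr {R : realType} {T I : Type} {F : set_system T} {FF : Filter F}
    (r : seq I) (f : I -> T -> R) (a : I -> R) :
  (forall i, f i t @[t --> F] --> a i) ->
  (\sum_(i <- r) f i t) @[t --> F] --> \sum_(i <- r) a i.
Proof.
move=> fa; elim: r => [|i r IH].
  rewrite big_nil (_ : (fun t => _) = fun=> 0); first exact: cvg_cst.
  by apply/funext => t; rewrite big_nil.
rewrite big_cons (_ : (fun t => _) = (fun t => f i t + \sum_(j <- r) f j t)).
  exact: cvgD.
by apply/funext => t; rewrite big_cons.
Qed.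

Section MatrixExponential.
Context {R : realType} {K : nat} (B : 'M[R]_K).

Let bnd := \sum_i \sum_j `|B i j|.

Let bnd_ge0 : 0 <= bnd. Proof. by apply: sumr_ge0 => i _; apply: sumr_ge0. Qed.

Lemma expr_scale_mx (y : R) n : (y *: B) ^+ n = y ^+ n *: B ^+ n.
Proof.
elim: n => [|n IH]; first by rewrite !expr0 scale1r.
by rewrite !exprS IH -[LHS]/((y *: B) *m (y ^+ n *: B ^+ n))
  -scalemxAl -scalemxAr scalerA.
Qed.

(** [bnd] dominates each column sum of absolute values, so the bound passes from one power to the
    next. *)
Lemma exp_mx_entry_le n i j : `|(B ^+ n) i j| <= bnd ^+ n.
Proof.
elim: n i j => [|n IH] i j.
  rewrite !expr0 -[1]/(1%:M) mxE; case: eqP => _; rewrite ?normr0 ?normr1//.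
rewrite !exprSr -[_ * _]/(B ^+ n *m B) mxE.
apply: le_trans (ler_norm_sum _ _ _) _; rewrite -[_ * bnd]/(bnd ^+ n * bnd).
apply: (@le_trans _ _ (\sum_m bnd ^+ n * `|B m j|)).
  by apply: ler_sum => m _; rewrite normrM ler_wpM2r.
rewrite -mulr_sumr ler_wpM2l ?exprn_ge0//.
by apply: ler_sum => m _; rewrite (bigD1 j)//= lerDl sumr_ge0.
Qed.

(** Power series coefficients of an entry of [expmx (y *: B) *m A]. With a general right factor [A]
    the family is stable under differentiation, which replaces [A] by [B *m A]. *)
Definition exp_coef p (A : 'M[R]_(K, p)) i j n : R := n`!%:R^-1 * (B ^+ n *m A) i j.

Lemma exp_coef_diffs p (A : 'M[R]_(K, p)) i j :
  pseries_diffs (exp_coef A i j) = exp_coef (B *m A) i j.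
Proof.
apply/funext => n; rewrite /pseries_diffs /exp_coef exprSr mulmxA.
rewrite factS natrM invfM mulrA mulrCA mulrA mulVf ?pnatr_eq0// mul1r.
by [].
Qed.

Lemma is_cvg_exp_coef p (A : 'M[R]_(K, p)) i j y :
  cvgn (pseries (exp_coef A i j) y).
Proof.
pose C := \sum_m `|A m j|.
apply: normed_cvg; apply: (@series_le_cvg _ _ (fun n => C * exp_coeff (bnd * `|y|) n)).
- by move=> n; exact: normr_ge0.
- move=> n; rewrite mulr_ge0//; first exact: sumr_ge0.
  by apply: exp_coeff_ge0; rewrite mulr_ge0.
- move=> n; have -> : C * exp_coeff (bnd * `|y|) n =
      n`!%:R^-1 * (bnd ^+ n * C * `|y| ^+ n).
    by rewrite /exp_coeff/= exprMn; ring.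
  rewrite /= /exp_coef !normrM normrX normfV normr_nat -mulrA.
  rewrite ler_wpM2l// ler_wpM2r ?exprn_ge0// mxE.
  apply: le_trans (ler_norm_sum _ _ _) _; rewrite /C mulr_sumr.
  by apply: ler_sum => m _; rewrite normrM ler_wpM2r// exp_mx_entry_le.
rewrite (_ : series _ = (fun n => C * series (exp_coeff (bnd * `|y|)) n)); last first.
  by apply/funext => n; rewrite /series/= mulr_sumr.
by apply: is_cvgMr; exact: is_cvg_series_exp_coeff.
Qed.

Lemma expmxE y i j : expmx (y *: B) i j = limn (pseries (exp_coef 1%:M i j) y).
Proof.
rewrite /expmx mxE; congr (limn _); apply/funext => n; rewrite /pseries /series/=.
by apply: eq_bigr => k _; rewrite expr_scale_mx /exp_coef mulmx1 !mxE mulrAC mulrA.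
Qed.

Lemma expmx_mulE p (A : 'M[R]_(K, p)) y i j :
  (expmx (y *: B) *m A) i j = limn (pseries (exp_coef A i j) y).
Proof.
apply/esym/cvg_lim => //.
rewrite mxE (_ : pseries _ _ = (fun n => \sum_m pseries (exp_coef 1%:M i m) y n * A m j)).
  apply: (cvg_sumr (f := fun m n => pseries (exp_coef 1%:M i m) y n * A m j)
    (a := fun m => expmx (y *: B) i m * A m j)) => m.
  by apply: cvgMl; rewrite expmxE; exact: is_cvg_exp_coef.
apply/funext => n; rewrite /pseries /series/=.
under [RHS]eq_bigr do rewrite mulr_suml.
rewrite exchange_big/=; apply: eq_bigr => k _.
rewrite /exp_coef mxE mulr_sumr mulr_suml; apply: eq_bigr => m _.
by rewrite mulmx1; ring.
Qed.

Lemma is_derive_expmx p (A : 'M[R]_(K, p)) (y : R) i j :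
  is_derive y (1 : R) (fun t : R => (expmx (t *: B) *m A) i j)
    ((expmx (y *: B) *m (B *m A)) i j).
Proof.
rewrite expmx_mulE -exp_coef_diffs.
rewrite (_ : (fun t => _) = (fun t => limn (pseries (exp_coef A i j) t))); last first.
  by apply/funext => t; rewrite expmx_mulE.
apply: (@pseries_snd_diffs _ _ (`|y| + 1)).
- exact: is_cvg_exp_coef.
- by rewrite exp_coef_diffs; exact: is_cvg_exp_coef.
- by rewrite !exp_coef_diffs; exact: is_cvg_exp_coef.
- by rewrite [ltRHS]ger0_norm ?ltrDl// addr_ge0.
Qed.

Lemma continuous_expmx p (A : 'M[R]_(K, p)) i j :
  continuous (fun t : R => (expmx (t *: B) *m A) i j).
Proof.
move=> y; apply: differentiable_continuous; apply/derivable1_diffP.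
exact: (@ex_derive _ _ _ _ _ _ _ (is_derive_expmx A y i j)).
Qed.

Lemma expmx0 : expmx (0 *: B) = 1%:M.
Proof.
apply/matrixP => i j; rewrite expmxE; apply: cvg_lim => //.
apply: cvg_near_cst; exists 1%N => // -[//|n] _ /=.
rewrite /pseries /series/= big_mkord big_ord_recl/= big1 ?addr0.
  by rewrite expr0 mulr1 /exp_coef mulmx1 expr0 fact0 invr1 mul1r.
by move=> k _; rewrite exprS mul0r mulr0.
Qed.

End MatrixExponential.

Lemma subr_le_double {R : realDomainType} (x y C : R) :
  `|x| <= C -> `|y| <= C -> x - y <= 2 * C.
Proof.
rewrite !ler_norml => /andP[? ?] /andP[? ?].
by rewrite mulr_natl mulr2n lerD// lerNl.
Qed.

(* [expmx (t *: B) k j] is the probability of the phase [j] at time [t] of a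
   chain started at [k], which makes these entries nonnegative. *)
Section SurvivalFunction.
Context {R : realType} {K : nat} (B : 'M[R]_K) (k : 'I_K).
Hypothesis B_sub : nonsingular_subgenerator B.

Definition survival (t : R) : R := \sum_j expmx (t *: B) k j.
Definition exit_density (t : R) : R := (expmx (t *: B) *m exit_rates B) k 0.

Lemma survivalE : survival = (fun t => (expmx (t *: B) *m const_mx 1) k (0 : 'I_1)).
Proof.
by apply/funext => t; rewrite mxE; apply: eq_bigr => j _; rewrite [const_mx _ _ _]mxE mulr1.
Qed.

Lemma survival0 : survival 0 = 1.
Proof.
rewrite /survival expmx0 (bigD1 k)//= mxE eqxx big1 ?addr0// => j jk.
by rewrite mxE eq_sym (negPf jk).
Qed.

Lemma is_derive_survival (t : R) : is_derive t 1 survival (- exit_density t).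
Proof.
rewrite survivalE (_ : - exit_density t = (expmx (t *: B) *m (B *m (const_mx 1 : 'cV[R]_K))) k 0).
  exact: (is_derive_expmx B (const_mx 1) t k 0).
by rewrite /exit_density /exit_rates mulNmx mulmxN mxE opprK.
Qed.

Lemma continuous_survival : continuous survival.
Proof. by rewrite survivalE; exact: continuous_expmx. Qed.

Lemma continuous_exit_density : continuous exit_density.
Proof. exact: continuous_expmx. Qed.

Hypothesis expmx_ge0 : forall t j, 0 <= t -> 0 <= expmx (t *: B) k j.

Lemma survival_ge0 t : 0 <= t -> 0 <= survival t.
Proof. by move=> t0; apply: sumr_ge0 => j _; exact: expmx_ge0. Qed.

Lemma exit_density_ge0 t : 0 <= t -> 0 <= exit_density t.
Proof.
move=> t0; rewrite /exit_density mxE; apply: sumr_ge0 => j _.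
rewrite mulr_ge0 ?expmx_ge0// /exit_rates mulNmx mxE oppr_ge0 mxE.
case: B_sub => _ /(_ j) + _; apply: le_trans.
by apply: ler_sum => m _; rewrite mxE mulr1.
Qed.

Lemma survival_noninc s t : 0 <= s -> s <= t -> survival t <= survival s.
Proof.
move=> s0 st; rewrite -lerN2.
apply: (@ger0_derive1_ndecry _ (fun u => - survival u) 0) => //.
- move=> u _; apply: derivableN.
  exact: (@ex_derive _ _ _ _ _ _ _ (is_derive_survival u)).
- move=> u; rewrite in_itv/= andbT => u0.
  rewrite derive1E (@derive_val _ _ _ _ _ _ _ (is_deriveN (is_derive_survival u))).
  by rewrite opprK exit_density_ge0// ltW.
- apply: continuous_subspaceT => u; apply: cvgN; exact: continuous_survival.
Qed.

Lemma survival_le1 t : 0 <= t -> survival t <= 1.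
Proof. by move=> t0; rewrite -survival0 survival_noninc. Qed.

(* [Q t = (expmx (t *: B) *m invmx B *m 1) k] is bounded and [Q' = survival] is
   nonincreasing, so [t * survival t <= Q t - Q 0] stays bounded. *)
Lemma survival_cvg0 : survival t @[t --> +oo] --> 0.
Proof.
pose Q (t : R) : R := (expmx (t *: B) *m (invmx B *m const_mx 1)) k (0 : 'I_1).
have dQ (t : R) : is_derive t (1 : R) (Q : R -> R) (survival t).
  have := is_derive_expmx B (invmx B *m const_mx 1) t k (0 : 'I_1).
  by rewrite (mulmxA B) mulmxV ?mul1mx ?survivalE//; case: B_sub.
pose C := \sum_j `|(invmx B *m const_mx 1 : 'cV[R]_K) j 0|.
have QC t : 0 <= t -> `|Q t| <= C.
  move=> t0; rewrite /Q mxE; apply: le_trans (ler_norm_sum _ _ _) _.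
  apply: ler_sum => j _; rewrite normrM ler_piMl//.
  rewrite ger0_norm ?expmx_ge0//; apply: le_trans (survival_le1 t0).
  by rewrite /survival (bigD1 j)//= lerDl sumr_ge0// => i _; exact: expmx_ge0.
have St t : 0 < t -> survival t <= 2 * C / t.
  move=> t0; rewrite ler_pdivlMr//.
  have [u] := @MVT R Q survival 0 t t0 (fun x _ => dQ x)
    (continuous_subspaceT (@continuous_expmx _ _ B _ _ k 0)).
  rewrite in_itv/= => /andP[u0 ut]; rewrite subr0 => E.
  apply: (@le_trans _ _ (survival u * t)).
    by rewrite ler_wpM2r ?(ltW t0)// survival_noninc// ltW.
  rewrite -E; exact: (subr_le_double (QC _ (ltW t0)) (QC 0 (lexx _))).
apply/cvgrPdist_le => e e0; near=> t.
have t0 : 0 < t by near: t; exact: nbhs_pinfty_gt.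
rewrite sub0r normrN ger0_norm ?survival_ge0 ?(ltW t0)//.
have tC : 2 * C / e <= t by near: t; apply: nbhs_pinfty_ge; exact: num_real.
apply: le_trans (St _ t0) _.
by rewrite ler_pdivrMr// [e * t]mulrC -ler_pdivrMr.
Unshelve. all: end_near. Qed.

(** [- survival] is an antiderivative of the density and tends to 0 at infinity, so no mass escapes
    there. *)
Lemma integral_exit_density y : 0 <= y ->
  (\int[lebesgue_measure]_(t in `]y, +oo[) (exit_density t)%:E = (survival y)%:E)%E.
Proof.
move=> y0.
have dS (u : R) : is_derive u (1 : R) (fun t => - survival t) (exit_density u).
  by rewrite -[X in is_derive _ _ _ X]opprK; exact: (is_deriveN (is_derive_survival u)).
rewrite integral_itv_obnd_cbnd; last first.
  apply/measurable_EFinP; apply: measurable_funTS.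
  exact: continuous_measurable_fun continuous_exit_density.
rewrite (@ge0_continuous_FTC2y R exit_density (fun t => - survival t) y 0).
- by rewrite sub0e EFinN oppeK.
- by move=> u yu; apply: exit_density_ge0; exact: le_trans yu.
- exact: continuous_subspaceT continuous_exit_density.
- by rewrite -[X in _ --> X]oppr0; apply: cvgN; exact: survival_cvg0.
- by move=> u _; exact: (@ex_derive _ _ _ _ _ _ _ (dS u)).
- apply: cvgN; apply: cvg_at_right_filter; exact: continuous_survival.
- by move=> u _; rewrite derive1E (@derive_val _ _ _ _ _ _ _ (dS u)).
Qed.

(** The factor exp(- B_kk t) cancels the diagonal term of the forward equation. What remains of the
    derivative is a sum of nonnegative off-diagonal terms, so the product stays above its value 1 at
    time 0. *)
Lemma diagonal_gt0 t : 0 <= t -> 0 < expmx (t *: B) k k.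
Proof.
move=> t0; case: B_sub => B_off _ _.
pose m (u : R) : R := (expmx (u *: B) *m 1%:M) k k.
pose h (u : R) := expR (- B k k * u) * m u.
pose dh (u : R) := expR (- B k k * u) * (\sum_(j | j != k) expmx (u *: B) k j * B j k).
have dhE (u : R) : is_derive u (1 : R) (h : R -> R) (dh u).
  have dm := is_derive_expmx B 1%:M u k k.
  have de : is_derive u (1 : R) (fun u : R => expR (- B k k * u)) (- B k k * expR (- B k k * u)).
    have dl : is_derive u (1 : R) (fun v : R => - B k k * v) (- B k k).
      rewrite -[X in is_derive _ _ _ X]mulr1.
      exact: (is_deriveZ (- B k k) (is_derive_id u (1 : R))).
    by rewrite mulrC; exact: (is_derive1_comp (is_derive_expR _) dl).
  apply: (is_derive_eq (is_deriveM de dm)).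
  rewrite /dh /m !mulmx1 mxE (bigD1 k)//= /GRing.scale/=.
  set s := \sum_(i < K | i != k) _; rewrite -[RHS]/(_ * s).
  by move: (B k k) s (expmx _ k k) (expR _) => b s e x; ring.
have h0 : h 0 = 1 by rewrite /h /m mulr0 expR0 mul1r expmx0 mulmx1 mxE eqxx.
have : h 0 <= h t.
  apply: (@ger0_derive1_ndecry _ h 0) => //.
  - move=> u; rewrite in_itv/= andbT => u0.
    rewrite derive1E (@derive_val _ _ _ _ _ _ _ (dhE u)) /dh.
    rewrite mulr_ge0 ?expR_ge0// sumr_ge0// => j jk.
    by rewrite mulr_ge0 ?expmx_ge0 ?B_off// ltW.
  - apply: derivable_within_continuous => u _.
    exact: (@ex_derive _ _ _ _ _ _ _ (dhE u)).
rewrite h0 /h /m mulmx1 => h1.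
have : 0 < expR (- B k k * t) * expmx (t *: B) k k by exact: lt_le_trans h1.
by rewrite pmulr_rgt0 ?expR_gt0.
Qed.

End SurvivalFunction.

(** * Poisson processes and phase chains *)

Section MeasureTools.
Context {R : realType} {d : measure_display} {Om : measurableType d}.
Variable P : {measure set Om -> \bar R}.

Lemma measure_disjointU A1 A2 : measurable A1 -> measurable A2 ->
  A1 `&` A2 = set0 -> (P (A1 `|` A2) = P A1 + P A2)%E.
Proof. exact: measureU. Qed.

Lemma measure_split A C : measurable A -> measurable C ->
  (P A = P (A `&` C) + P (A `&` ~` C))%E.
Proof.
move=> mA mC; rewrite -measure_disjointU -?setIUr ?setUv ?setIT//.
- exact: measurableI.
- by apply: measurableI => //; exact: measurableC.
- by rewrite setIACA setICr setI0.
Qed.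

Lemma fin_measure A : P setT = 1%E -> measurable A -> P A \is a fin_num.
Proof.
move=> P1 mA; rewrite ge0_fin_numE ?measure_ge0//.
apply: (@le_lt_trans _ _ (P setT)); last by rewrite P1 ltry.
by apply: le_measure; rewrite ?inE.
Qed.

Lemma measure_fin_partition (T : finType) (f : Om -> T) A :
  (forall s, measurable (f @^-1` [set s])) -> measurable A ->
  P A = (\sum_s P (A `&` f @^-1` [set s]))%E.
Proof.
move=> mf mA; rewrite -big_enum fsbig_seq ?enum_uniq//.
rewrite -measure_fin_bigcup//.
- congr (P _); apply/seteqP; split => w /=; last by move=> [s _ []].
  by move=> Aw; exists (f w) => //=; rewrite mem_enum.
- apply/trivIsetP => s t _ _ /eqP st; apply/seteqP; split => w //=.
  by move=> [[_ fs] [_ ft]]; apply: st; rewrite -fs.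
- by move=> s _; exact: measurableI.
Qed.

Lemma ae_forall_count {J : countType} (Q : J -> Om -> Prop) :
  (forall j, {ae P, forall w, Q j w}) -> {ae P, forall w, forall j, Q j w}.
Proof.
move=> aeQ.
have : {ae P, forall w, forall n, if unpickle n is Some j then Q j w else True}.
  apply: ae_foralln => n; case: unpickle => [j|]; first exact: aeQ.
  by apply: filterE.
by apply: filterS => w H j; have := H (pickle j); rewrite pickleK.
Qed.

Lemma ae_and (Q1 Q2 : Om -> Prop) : {ae P, forall w, Q1 w} ->
  {ae P, forall w, Q2 w} -> {ae P, forall w, Q1 w /\ Q2 w}.
Proof. exact: filterS2. Qed.

Lemma ae_null (A : set Om) (Q : Om -> Prop) : measurable A -> P A = 0%E ->
  (forall w, ~ Q w -> A w) -> {ae P, forall w, Q w}.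
Proof. by move=> mA A0 QA; exists A; split => // w /= /QA. Qed.

End MeasureTools.

(** Cells are open on the left and closed on the right, so that a jump at [t] is counted in the
    increment of [N] over its cell even when [t] is a grid point. *)
Lemma grid_cell {R : realType} n (t : R) : 0 < t ->
  exists k : nat, k%:R / n.+1%:R < t /\ t <= k.+1%:R / n.+1%:R.
Proof.
move=> t0; have n0 : (0 : R) < n.+1%:R by rewrite ltr0n.
have x0 : 0 < t * n.+1%:R by rewrite mulr_gt0.
have /andP[mx xm] := truncn_itv (ltW x0).
move: mx xm; set m := Num.truncn _ => mx xm.
have [mlt|] := boolP (m%:R < t * n.+1%:R).
  by exists m; rewrite ltr_pdivrMr// mlt ler_pdivlMr// ltW.
rewrite -leNgt => xle; have xE : t * n.+1%:R = m%:R by apply: le_anti; rewrite xle mx.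
case: m => [|m] in xE mx xm xle *; first by rewrite xE ltxx in x0.
exists m; rewrite ltr_pdivrMr// xE ltr_nat; split => //.
by rewrite ler_pdivlMr// xE.
Qed.

Section NoDoubleJump.
Context {R : realType} {d : measure_display} {Om : measurableType d}.
Variables (P : {measure set Om -> \bar R}) (F : R -> set_system Om) (lam : R)
  (N : R -> Om -> nat).
Hypotheses (P1 : P setT = 1%E) (fF : filtration F) (lam0 : 0 < lam)
  (pN : poisson_process P F lam N).

Lemma N_measurable t D : 0 <= t -> measurable (N t @^-1` D).
Proof.
by move=> t0; case: fF => _ mF _; apply: (mF t t0); case: pN => aN _ _ _; exact: aN.
Qed.

Lemma N_mono s t w : 0 <= s -> s <= t -> (N s w <= N t w)%N.
Proof. by case: pN => _ /(_ w)[_ + _] _ _; exact. Qed.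

Lemma N0 w : N 0 w = 0%N.
Proof. by case: pN => _ /(_ w)[]. Qed.

Lemma N_right_constant t w : 0 <= t -> \forall s \near t^'+, N s w = N t w.
Proof. by case: pN => _ /(_ w)[_ _ +] _ _; exact. Qed.

Lemma increment_measurable s t (D : set nat) : 0 <= s -> s <= t ->
  measurable [set w | D (N t w - N s w)%N].
Proof.
move=> s0 st; rewrite (_ : [set _ | _] =
  \bigcup_m (N s @^-1` [set m] `&` N t @^-1` [set n | D (n - m)%N])).
  apply: bigcup_measurable => m _.
  by apply: measurableI; apply: N_measurable => //; exact: le_trans st.
by apply/seteqP; split => w /=; [move=> Dw; exists (N s w)|move=> [m _ [/= <-]]].
Qed.

(** With r = lam (t - s) the probability is 1 - (1 + r) exp(-r), and exp(-r) >= 1 - r bounds it by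
    r^2. *)
Lemma increment_ge2_le s t : 0 <= s -> s < t ->
  (P [set w | (2 <= N t w - N s w)%N] <= ((lam * (t - s)) ^+ 2)%:E)%E.
Proof.
move=> s0 st; set r := lam * (t - s).
have r0 : 0 < r by rewrite mulr_gt0// subr_gt0.
have mI := increment_measurable (s := s) (t := t) _ s0 (ltW st).
have pI n : P [set w | (N t w - N s w)%N = n] = (r ^+ n / n`!%:R * expR (- r))%:E.
  by case: pN => _ _ _ /(_ s t s0 st n); rewrite /poisson_pmf r0.
have /esym := P1.
rewrite (_ : setT = [set w | (N t w - N s w)%N = 0%N] `|`
   ([set w | (N t w - N s w)%N = 1%N] `|` [set w | (2 <= N t w - N s w)%N])); last first.
  apply/seteqP; split => w // _ /=.
  by case: (_ - _)%N => [|[|n]]; [left|right;left|right;right].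
have m0 := mI [set 0%N]; have m1 := mI [set 1%N]; have m2 := mI [set n | (2 <= n)%N].
rewrite measure_disjointU//; last 2 first.
- exact: measurableU.
- apply/seteqP; split => w //= [-> []//].
rewrite measure_disjointU//; last first.
  by apply/seteqP; split => w //= [->].
rewrite (pI 0%N) (pI 1%N); set p2 := P _.
have : p2 \is a fin_num.
  exact: fin_measure.
case: p2 => // p _; rewrite -!EFinD lee_fin => -[].
rewrite expr0 expr1 fact0 invr1 !mul1r mulr1 => E.
have := expR_ge1Dx (- r); move: E; move: (expR _) => e E er.
have : (1 + r) * (1 - r) <= (1 + r) * e by rewrite ler_pM2l//; lra.
by rewrite expr2; nra.
Qed.

Lemma increment_gt0_prob s t : 0 <= s -> s < t ->
  (0 < P [set w | (1 <= N t w - N s w)%N])%E.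
Proof.
move=> s0 st; set r := lam * (t - s).
have r0 : 0 < r by rewrite mulr_gt0// subr_gt0.
have mI := increment_measurable (s := s) (t := t) _ s0 (ltW st).
have pI : P [set w | (N t w - N s w)%N = 0%N] = (expR (- r))%:E.
  case: pN => _ _ _ /(_ s t s0 st 0%N); rewrite /poisson_pmf r0 => ->.
  by rewrite expr0 fact0 invr1 !mul1r.
have /esym := P1.
rewrite (_ : setT = [set w | (N t w - N s w)%N = 0%N] `|`
   [set w | (1 <= N t w - N s w)%N]); last first.
  by apply/seteqP; split => w // _ /=; case: (_ - _)%N => [|n]; [left|right].
have m0 := mI [set 0%N]; have m1 := mI [set n | (1 <= n)%N].
rewrite measure_disjointU//; last by apply/seteqP; split => w //= [->].
rewrite pI lt0e measure_ge0 andbT; set p := P _ => E; apply/eqP => p0.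
move: E; rewrite p0 adde0 => -[/esym e1].
by have : expR (- r) < 1 by [rewrite expR_lt1 oppr_lt0|]; rewrite e1 ltxx.
Qed.

(* A double jump lies in a cell of each grid, and [P (N t - N s >= 2) = O((t - s)^2)]. *)
Definition double_jump (M : nat) : set Om := [set w | exists t, [/\ 0 < t, t <= M%:R
  & forall s, 0 <= s -> s < t -> (2 <= N t w - N s w)%N]].

Lemma double_jump_negligible M : P.-negligible (double_jump M).
Proof.
pose D n := \big[setU/set0]_(k < M * n.+1)
  [set w | (2 <= N (k.+1%:R / n.+1%:R) w - N (k%:R / n.+1%:R) w)%N].
have mesh k n : (k%:R / n.+1%:R : R) < k.+1%:R / n.+1%:R.
  by rewrite ltr_pM2r ?invr_gt0 ?ltr0n// ltr_nat.
have mDk k n : measurable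
    [set w | (2 <= N (k.+1%:R / n.+1%:R) w - N (k%:R / n.+1%:R) w)%N].
  by apply: (@increment_measurable _ _ [set m | (2 <= m)%N]); rewrite ?divr_ge0// ltW.
have mD n : measurable (D n) by apply: bigsetU_measurable => k _; exact: mDk.
have PD n : (P (D n) <= (M%:R * lam ^+ 2 / n.+1%:R)%:E)%E.
  apply: le_trans (Boole_inequality P (A := fun k : nat => _) (fun k _ => mDk k n)) _.
  apply: (@le_trans _ _ (\sum_(k < M * n.+1) ((lam / n.+1%:R) ^+ 2)%:E)%E).
    apply: lee_sum => k _.
    apply: le_trans (increment_ge2_le _ (mesh k n)) _; first by rewrite divr_ge0.
    by rewrite -mulrBl -natrB// subSnn mul1r.
  rewrite sumEFin sumr_const card_ord lee_fin -[leLHS]mulr_natl natrM.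
  have n0 : (n.+1%:R : R) != 0 by rewrite pnatr_eq0.
  by rewrite le_eqVlt; apply/orP; left; apply/eqP; field; rewrite addrC natr1.
exists (\bigcap_n D n); split.
- exact: bigcapT_measurable.
- apply/eqP; rewrite -measure_le0; apply/lee_addgt0Pr => e e0; rewrite add0e.
  have [n ne] : exists n : nat, M%:R * lam ^+ 2 / e < n.+1%:R.
    by exists (Num.truncn (M%:R * lam ^+ 2 / e)); exact: truncnS_gt.
  apply: (@le_trans _ _ (P (D n))).
    apply: le_measure; rewrite ?inE//; first exact: bigcapT_measurable.
    by move=> w; apply.
  apply: le_trans (PD n) _; rewrite lee_fin ler_pdivrMr ?ltr0n//.
  by rewrite [e * _]mulrC -ler_pdivrMr// ltW.
move=> w [t [t0 tM dj]] n _; rewrite /D -(bigcup_mkord _ (fun k : nat =>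
  [set w | (2 <= N (k.+1%:R / n.+1%:R) w - N (k%:R / n.+1%:R) w)%N])).
have [k [kt tk]] := grid_cell n t0.
have k0 : 0 <= (k%:R / n.+1%:R : R) by rewrite divr_ge0.
exists k => /=.
  rewrite -(@ltr_nat R) natrM; apply: lt_le_trans (_ : t * n.+1%:R <= _).
    by rewrite -ltr_pdivrMr ?ltr0n.
  by rewrite ler_wpM2r.
apply: leq_trans (dj _ k0 kt) _; apply: leq_sub2r.
by apply: N_mono => //; exact: ltW.
Qed.

Lemma ae_no_double_jump : {ae P, forall w, forall t, 0 < t ->
  exists s, [/\ 0 <= s, s < t & (N t w <= (N s w).+1)%N]}.
Proof.
have : P.-negligible (\bigcup_M double_jump M).
  exact/negligible_bigcup/double_jump_negligible.
apply: negligibleS => w /= /existsNP[t /not_implyP[t0 nt]].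
exists (Num.truncn t).+1 => //; exists t; split => //.
  by rewrite ltW// truncnS_gt.
move=> s s0 st; rewrite leqNgt; apply/negP => Nst; apply: nt; exists s; split => //.
by move: Nst; rewrite ltnS leq_subLR addn1.
Qed.

End NoDoubleJump.

Lemma sigma_algebra_setT {T : Type} (G : set_system T) : <<s G >> setT.
Proof. by have := sigma_algebraCD (@sigma_algebra0 T setT G); rewrite setD0. Qed.

Section PhaseChain.
Context {R : realType} {d : measure_display} {Om : measurableType d} {K : nat}.
Variables (P : {measure set Om -> \bar R}) (beta : 'rV[R]_K) (B : 'M[R]_K).
Variable Y : R -> Om -> option 'I_K.
Hypotheses (P1 : P setT = 1%E) (cY : phase_chain P beta B Y)
  (beta_prob : probability_row beta) (B_sub : nonsingular_subgenerator B).

Lemma chain_measurable t s : 0 <= t -> measurable (Y t @^-1` [set s]).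
Proof. by move=> t0; case: cY => mY _ _ _; exact: mY. Qed.

Lemma chain_right_constant t w : 0 <= t -> \forall u \near t^'+, Y u w = Y t w.
Proof. by case: cY => _ + _ _; exact. Qed.

Lemma chain_transition u v s s' : 0 <= u -> 0 <= v ->
  P (Y u @^-1` [set s] `&` Y (u + v) @^-1` [set s']) =
  (P (Y u @^-1` [set s]) * (phase_trans B v s s')%:E)%E.
Proof.
move=> u0 v0; case: cY => _ _ _ /(_ u v u0 v0 setT s s').
rewrite !setTI; apply; exact: sigma_algebra_setT.
Qed.

(** Depends on [beta] and [B] only, hence is common to the chains of all jumps. *)
Definition phase_law (v : R) (s' : option 'I_K) : R :=
  \sum_s phase_init beta s * phase_trans B v s s'.

Lemma chain_law v s : 0 <= v -> P (Y v @^-1` [set s]) = (phase_law v s)%:E.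
Proof.
move=> v0; rewrite (measure_fin_partition P (f := Y 0)); last 2 first.
- by move=> s'; exact: chain_measurable.
- exact: chain_measurable.
rewrite /phase_law -sumEFin; apply: eq_bigr => s' _.
rewrite setIC -[in Y v](add0r v) chain_transition//.
by case: cY => _ _ -> _; rewrite EFinM.
Qed.

Lemma phase_law_ge0 v s : 0 <= v -> 0 <= phase_law v s.
Proof. by move=> v0; rewrite -lee_fin -chain_law. Qed.

Lemma chain_stays u y k : 0 <= u -> 0 <= y ->
  P (Y u @^-1` [set Some k] `&` ~` (Y (u + y) @^-1` [set None])) =
  (phase_law u (Some k) * survival B k y)%:E.
Proof.
move=> u0 y0; have mk := chain_measurable (Some k) u0.
have mn : measurable (Y (u + y) @^-1` [set None]).
  by apply: chain_measurable; exact: addr_ge0.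
have := measure_split P mk mn; rewrite (chain_law _ u0) chain_transition// chain_law//.
rewrite /= -/(survival B k y) -EFinM; move: (P _) => p E.
have : p \is a fin_num by move: E; case: p.
case: p E => // p [E] _; congr (_%:E).
by apply: (addrI (phase_law u (Some k) * (1 - survival B k y))); rewrite -E; ring.
Qed.

(* Nonnegativity of [expmx] is not derived from [B] but read off transition
   probabilities, hence only available from phases that the chain visits; the
   other phases carry no mass. *)
Definition reachable k := exists2 u, 0 <= u & phase_law u (Some k) != 0.

Lemma reachable_expmx_ge0 k : reachable k -> forall t j, 0 <= t -> 0 <= expmx (t *: B) k j.
Proof.
move=> [u u0 pk] t j t0.
have : (0 <= P (Y u @^-1` [set Some k] `&` Y (u + t) @^-1` [set Some j]))%E by [].
rewrite chain_transition// chain_law// -EFinM lee_fin /=.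
by rewrite pmulr_rge0// lt0r pk phase_law_ge0.
Qed.

Lemma phase_law0 s : phase_law 0 s = phase_init beta s.
Proof.
have /eqP := chain_law s (lexx 0).
by case: cY => _ _ /(_ s) + _ => ->; rewrite eqe => /eqP.
Qed.

(** At rational times a passage from [None] to a phase has probability 0, and there are countably
    many pairs. Right constancy carries this to all times, through a rational time just after each
    of [u] and [v]. *)
Lemma ae_absorbed : {ae P, forall w, forall u v, 0 <= u -> u <= v ->
  Y u w = None -> Y v w = None}.
Proof.
have aeQ : {ae P, forall w, forall uvj : rat * rat * 'I_K, 0 <= ratr uvj.1.1 :> R ->
    ratr uvj.1.1 <= ratr uvj.1.2 :> R ->
    ~ (Y (ratr uvj.1.1) w = None /\ Y (ratr uvj.1.2) w = Some uvj.2)}.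
  apply: ae_forall_count => -[[p r] j] /=.
  have [p0|p0] := leP 0 (ratr p : R); last by apply: filterE.
  have [pr|pr] := leP (ratr p : R) (ratr r); last by apply: filterE.
  have rE : (ratr r : R) = ratr p + (ratr r - ratr p) by rewrite addrC subrK.
  apply: (ae_null (A := Y (ratr p) @^-1` [set None] `&` Y (ratr r) @^-1` [set Some j])).
  - by apply: measurableI; apply: chain_measurable => //; exact: le_trans pr.
  - by rewrite rE chain_transition ?subr_ge0//= mule0.
  - by move=> w /= H; apply: contrapT => nA; apply: H => _ _ YY; exact: nA.
apply: filterS aeQ => w H u v u0; rewrite le_eqVlt => /orP[/eqP <-//|uv] Yu.
have v0 : 0 <= v by apply: le_trans u0 _; exact: ltW.
have [e /= e0 He] := chain_right_constant w u0.
have [e' /= e'0 He'] := chain_right_constant w v0.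
have [p] : exists p : rat, ratr p \in `]u, (Num.min v (u + e)) [.
  by apply: rat_in_itvoo; rewrite lt_min uv ltrDl.
rewrite in_itv/= lt_min => /and3P[up pv pe].
have [r] : exists r : rat, ratr r \in `]v, (v + e') [.
  by apply: rat_in_itvoo; rewrite ltrDl.
rewrite in_itv/= => /andP[vr re].
have Yp : Y (ratr p) w = None.
  rewrite He//= /ball_/= distrC gtr0_norm ?subr_gt0//; lra.
have <- : Y (ratr r) w = Y v w.
  by apply: He' => //=; rewrite /ball_/= distrC gtr0_norm ?subr_gt0//; lra.
case E : (Y (ratr r) w) => [j|//]; exfalso.
apply: (H (p, r, j)) => //=; first exact: le_trans (ltW up).
exact/ltW/(lt_trans pv).
Qed.

Lemma reachable_init i : beta 0 i != 0 -> reachable i.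
Proof. by move=> bi; exists 0 => //; rewrite phase_law0. Qed.

Lemma not_absorbed_prob t : 0 <= t ->
  P (~` (Y t @^-1` [set None])) = (\sum_i beta 0 i * survival B i t)%:E.
Proof.
move=> t0; rewrite (measure_fin_partition P (f := Y 0)); last 2 first.
- by move=> s; exact: chain_measurable.
- by apply: measurableC; exact: chain_measurable.
(* The state [None] has initial mass 0, so only the genuine phases remain. *)
rewrite (bigD1 None)//= [X in (X + _)%E](_ : _ = 0%E); last first.
  apply/eqP; rewrite -measure_le0.
  apply: (@le_trans _ _ (P (Y 0 @^-1` [set None]))); last first.
    by rewrite chain_law// phase_law0.
  apply: le_measure; rewrite ?inE; [|exact: chain_measurable|exact: subIsetr].
  apply: measurableI; last exact: chain_measurable.
  by apply: measurableC; exact: chain_measurable.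
rewrite add0e -sumEFin (reindex_omap Some id)/=; last by case.
rewrite (eq_bigl xpredT); last by move=> i; rewrite eqxx.
apply: eq_bigr => i _; rewrite setIC.
have := @chain_stays 0 t i (lexx _) t0; rewrite add0r => ->.
by rewrite phase_law0.
Qed.

(** Survival tends to 0 from every initial phase of positive mass; the other phases carry the factor
    0. Each jump size is thereby almost surely the infimum of a nonempty set and not the default
    value of [inf]. *)
Lemma ae_eventually_absorbed : {ae P, forall w, exists2 u, 0 <= u & Y u w = None}.
Proof.
pose g (t : R) := \sum_i beta 0 i * survival B i t.
have g0 : g t @[t --> +oo] --> 0.
  rewrite (_ : 0 = \sum_(i < K) (0 : R)); last by rewrite big1.
  apply: (cvg_sumr (f := fun i t => beta 0 i * survival B i t) (a := fun=> 0)) => i.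
  have [->|bi] := eqVneq (beta 0 i) 0.
    by under eq_fun do rewrite mul0r; exact: cvg_cst.
  rewrite -[X in _ --> X](mulr0 (beta 0 i)); apply: cvgMr.
  by apply: survival_cvg0 => // t j t0; apply: reachable_expmx_ge0 => //; exact: reachable_init.
have mA n : measurable (~` (Y n%:R @^-1` [set None])).
  by apply: measurableC; exact: chain_measurable.
apply: (ae_null (A := \bigcap_n ~` (Y n%:R @^-1` [set None]))).
- exact: bigcapT_measurable.
- apply/eqP; rewrite -measure_le0; apply/lee_addgt0Pr => e e0; rewrite add0e.
  have /cvgrPdist_lt /(_ e e0)[M [_ HM]] := g0.
  pose n := (Num.truncn M).+1.
  apply: (@le_trans _ _ (P (~` (Y n%:R @^-1` [set None])))).
    apply: le_measure; rewrite ?inE//; first exact: bigcapT_measurable.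
    by move=> w; apply.
  rewrite not_absorbed_prob// lee_fin -/(g n%:R).
  have := HM n%:R (truncnS_gt M); rewrite /= sub0r normrN => /ltW; apply: le_trans.
  exact: ler_norm.
- move=> w nA n _ /= Yn; apply: nA; by exists n%:R.
Qed.

(** Some initial phase has positive mass, and a chain started there is found there at time [t] with
    positive probability. *)
Lemma not_absorbed_gt0 t : 0 <= t -> (0 < P (~` (Y t @^-1` [set None])))%E.
Proof.
move=> t0; rewrite not_absorbed_prob// lte_fin.
case: beta_prob => b0 b1.
have R1 i : beta 0 i != 0 -> forall t j, 0 <= t -> 0 <= expmx (t *: B) i j.
  by move=> bi; apply: reachable_expmx_ge0; exact: reachable_init.
have ge0 i : 0 <= beta 0 i * survival B i t.
  have [->|bi] := eqVneq (beta 0 i) 0; first by rewrite mul0r.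
  by rewrite mulr_ge0// survival_ge0//; exact: R1.
have [i bi] : exists i, beta 0 i != 0.
  apply: contrapT => nb; move: b1; rewrite big1 => [/esym/eqP|i _]; first by rewrite oner_eq0.
  by apply/eqP; apply: contrapT => /negP bi; apply: nb; exists i.
rewrite (bigD1 i)//=; apply: ltr_wpDr; first exact: sumr_ge0.
rewrite mulr_gt0//; first by rewrite lt0r bi b0.
rewrite /survival (bigD1 i)//=; apply: ltr_wpDr; first by apply: sumr_ge0 => j _; exact: R1.
by apply: diagonal_gt0 => //; exact: R1.
Qed.

End PhaseChain.

(** Strictness comes from right constancy: a chain alive at [v] remains alive for a while, so the
    infimum lies strictly beyond [v]. *)
Lemma absorption_gtP {R : realType} {d : measure_display} {Om : measurableType d}
    {K : nat} (Y : R -> Om -> option 'I_K) w v :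
  (forall t, 0 <= t -> \forall u \near t^'+, Y u w = Y t w) ->
  (forall u v, 0 <= u -> u <= v -> Y u w = None -> Y v w = None) ->
  (exists2 u, 0 <= u & Y u w = None) -> 0 <= v ->
  v < absorption_time Y w <-> Y v w <> None.
Proof.
move=> rY aY [u0 u00 Yu0] v0; rewrite /absorption_time.
have lbS : lbound [set u | 0 <= u /\ Y u w = None] 0 by move=> u [].
have hi : has_inf [set u | 0 <= u /\ Y u w = None].
  by split; [exists u0|exists 0].
split=> [vC Yv|Yv].
  have := ge_inf (proj2 hi) (conj v0 Yv : [set u | 0 <= u /\ Y u w = None] v).
  by rewrite leNgt vC.
have [e /= e0 He] := rY v v0.
apply: (@lt_le_trans _ _ (v + e / 2)); first by rewrite ltrDl divr_gt0.
apply: lb_le_inf; first by exists u0.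
move=> u /= [u1 Yu]; rewrite leNgt; apply/negP => uve; apply: Yv.
have [uv|vu] := leP u v; first exact: aY Yu.
rewrite -(He u)//= /ball_/= distrC gtr0_norm ?subr_gt0//.
rewrite ltrBlDl (lt_le_trans uve)// lerD2l ler_pdivrMr//; lra.
Qed.

(** * Jumps of the path *)

Section PathJumps.
Context {R : realType} {d : measure_display} {Om : measurableType d} {K : nat}.
Context {l lam : R} {c sigma : R -> R} {beta : 'rV[R]_K} {B : 'M[R]_K}.
Variable Z : @jump_diffusion R d Om K l lam c sigma beta B.
Hypotheses (lam0 : 0 < lam) (mc : measurable_fun `]l, +oo[ c)
  (c_gt0 : forall x, l < x -> 0 < c x) (B_sub : nonsingular_subgenerator B).
Local Notation X := (jd_X Z).
Local Notation P := (jd_P Z).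
Local Notation N := (jd_N Z).
Local Notation Y := (jd_Y Z).

(* The jumps of [N] are numbered from 0: [jumps_from t w i] says that the jump [i] is at [t]. *)
Definition left_limit (t : R) (w : Om) : R := lim (X ^~ w @ t^'-).

Definition jumps_from (t : R) (w : Om) (i : nat) : Prop :=
  N t w = i.+1 /\ exists2 s, 0 <= s < t & forall u, s <= u -> u < t -> N u w = i.

(** The almost sure properties of a path in one record, so that later arguments are pathwise off a
    single null set. [regular_path] goes no further than the exit time because the equation is
    stopped there. *)
Record regular (x : R) (w : Om) : Prop := Regular {
  regular_start : X 0 w = x;
  regular_N0 : N 0 w = 0%N;
  regular_N_mono : forall s t, 0 <= s -> s <= t -> (N s w <= N t w)%N;
  regular_N_right : forall t, 0 <= t -> \forall s \near t^'+, N s w = N t w;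
  regular_N_simple : forall t, 0 < t ->
    exists s, [/\ 0 <= s, s < t & (N t w <= (N s w).+1)%N];
  regular_path : forall t, 0 < t -> (t%:E <= T_exit Z w)%E ->
    ((exists2 s, 0 <= s < t & N s w = N t w) /\ X t w = left_limit t w) \/
    exists2 i, jumps_from t w i & X t w = left_limit t w - jump_size Y i w;
  regular_right : forall i t, 0 <= t -> \forall u \near t^'+, Y i u w = Y i t w;
  regular_absorbed : forall i u v, 0 <= u -> u <= v -> Y i u w = None -> Y i v w = None;
  regular_finite : forall i, exists2 u, 0 <= u & Y i u w = None }.

Lemma X_path_measurable w : measurable_fun setT (fun s : R => X (Num.max 0 s) w).
Proof.
apply: (@measurable_eval R _ R (fun t _ => X t w) (fun s : R => Num.max 0 s)).
- by move=> t _; exact: measurable_cst.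
- by move=> _ t t0; exact: X_right_continuous.
- exact: measurable_maxr.
- by move=> s; rewrite le_max lexx.
Qed.

Lemma T_exit_gt s w : 0 <= s -> (s%:E < T_exit Z w)%E -> l < X s w.
Proof.
move=> s0 sT; rewrite ltNge; apply/negP.
exact: (@first_time_gt R [set z | z <= l] (X ^~ w) s).
Qed.

Definition drift_domain t w : set R := [set s | (0 <= s <= t)%R /\ (s%:E < T_exit Z w)%E].

Lemma drift_measurable t w : measurable (drift_domain t w) /\
  measurable_fun (drift_domain t w) (fun s => (c (X s w))%:E).
Proof.
have mD : measurable (drift_domain t w).
  rewrite (_ : drift_domain t w = `[0, t] `&` (setT `&` [set y : R | (y%:E < T_exit Z w)%E])).
    have mE : measurable_fun setT (EFin \o @id R) by exact/measurable_EFinP.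
    apply: measurableI => //; exact: (emeasurable_fun_infty_o measurableT mE).
  by rewrite setTI; apply/seteqP; split => s /=; rewrite in_itv.
split => //; apply/measurable_EFinP.
apply: (@eq_measurable_fun _ _ _ _ _ (c \o (fun s : R => X (Num.max 0 s) w))).
  by move=> s; rewrite inE => -[/andP[s0 _] _] /=; rewrite max_r.
apply: (measurable_comp (F := `]l, +oo[%classic)) => //.
  move=> _ [s [/andP[s0 st] sT] <-] /=; rewrite in_itv/= andbT max_r//.
  exact: T_exit_gt.
exact: (measurable_funTS (X_path_measurable w)).
Qed.

Definition drift t w : \bar R :=
  (\int[lebesgue_measure]_(s in drift_domain t w) (c (X s w))%:E)%E.

Lemma drift_integrand_ge0 t w s : drift_domain t w s -> (0 <= (c (X s w))%:E)%E.
Proof.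
by move=> [/andP[s0 _] sT]; rewrite lee_fin ltW// c_gt0// T_exit_gt.
Qed.

(** Monotone convergence, thanks to the positivity of [c]; the domains exhaust all but the single
    time [t]. The integral may still be infinite at this stage. *)
Lemma drift_left_continuous t w : 0 < t ->
  drift (t - t / n.+1%:R) w @[n --> \oo] --> drift t w.
Proof.
move=> t0; pose u n := t - t / n.+1%:R.
have ut n : u n < t by rewrite gtrDl oppr_lt0 divr_gt0.
have und m n : (m <= n)%N -> u m <= u n.
  by move=> mn; rewrite lerD2l lerN2 ler_pM2l// lef_pV2 ?posrE ?ltr0n// ler_nat.
have -> : drift t w = (\int[lebesgue_measure]_(s in \bigcup_n drift_domain (u n) w)
    (c (X s w))%:E)%E.
  rewrite (_ : \bigcup_n _ = drift_domain t w `\ t).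
    have [mD mf] := drift_measurable t w.
    have mD1 : measurable (drift_domain t w `\ t) by exact: measurableD.
    rewrite integral_setD1//; apply: measurable_funS mf => //; exact: subDsetl.
  apply/seteqP; split => s /=.
    move=> [n _ [/andP[s0 su] sT]]; split; last by move=> st; move: (ut n); rewrite -st ltNge su.
    by split => //; rewrite s0 (le_trans su)// ltW.
  move=> [[/andP[s0 st] sT]] /eqP sNt.
  have {sNt}st : s < t by rewrite lt_neqAle sNt.
  (* Chosen so that t / (n + 1) <= t - s. *)
  exists (Num.truncn (t / (t - s))) => //; split => //; rewrite s0/=.
  rewrite /u lerBrDl -lerBrDr ler_pdivrMr ?ltr0n// -ler_pdivrMl ?subr_gt0// mulrC.
  by rewrite ltW// truncnS_gt.
apply: ge0_nondecreasing_set_cvg_integral => //.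
- move=> m n mn; apply/subsetPset => s [/andP[s0 su] sT]; split => //.
  by rewrite s0 (le_trans su)// und.
- by move=> n; case: (drift_measurable (u n) w).
- by move=> n; case: (drift_measurable (u n) w).
- by move=> n s; exact: drift_integrand_ge0.
Qed.

Lemma jump_size_ge0 i w : 0 <= jump_size Y i w.
Proof.
rewrite /jump_size /absorption_time.
have [[u Su]|ne] := pselect ([set u | 0 <= u /\ Y i u w = None] !=set0).
  by apply: lb_le_inf; [exists u|move=> v []].
rewrite (_ : [set u | _] = set0) ?inf0//.
by apply/seteqP; split => // u Su; apply: ne; exists u.
Qed.

(** In the equation the drift and the Ito integral converge along times increasing to [t], so the
    path can jump at [t] only through the jump sum, and that sum gains at most one term. *)
Lemma ae_regular x : l < x -> {ae P x, forall w, regular x w}.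
Proof.
move=> lx.
have P1 : P x setT = 1%E by exact: prob_kernel.
have pN := jd_poisson Z lx.
have aeS := jd_start Z x.
have aeN := ae_no_double_jump P1 (jd_filtration Z) lam0 pN.
have aeA : {ae P x, forall w, forall i u v, 0 <= u -> u <= v -> Y i u w = None -> Y i v w = None}.
  by apply: ae_foralln => i; apply: ae_absorbed; exact: jd_chain.
have aeF : {ae P x, forall w, forall i, exists2 u, 0 <= u & Y i u w = None}.
  by apply: ae_foralln => i; apply: (ae_eventually_absorbed (jd_chain Z lx i)).
have [I [_ aeI _] aeE] := jd_sde Z lx.
have := ae_and (ae_and aeS aeN) (ae_and (ae_and aeA aeF) (ae_and aeI aeE)).
apply: filterS => w [[S Nj] [[A0 F0] [cI E]]].
split=> //.
- exact: N0 pN w.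
- by move=> s t s0 st; exact: (N_mono pN).
- by move=> t t0; exact: (N_right_constant pN).
- move=> t t0 tT.
  have Nm s s' : 0 <= s -> s <= s' -> (N s w <= N s' w)%N by exact: (N_mono pN).
  pose u n := t - t / n.+1%:R.
  have ut n : u n < t by rewrite gtrDl oppr_lt0 divr_gt0.
  have u0 n : 0 <= u n by rewrite subr_ge0 ler_pdivrMr ?ltr0n// ler_peMr ?ler1n// ltW.
  have uc : u n @[n --> \oo] --> t.
    rewrite -[X in _ --> X]subr0; apply: cvgB; first exact: cvg_cst.
    by rewrite -[X in _ --> X](mulr0 t); apply: cvgMr; exact: cvg_invn.
  have [_ /(_ t0) cV] := jd_cadlag Z w (ltW t0).
  have Vc : X (u n) w @[n --> \oo] --> left_limit t w.
    have /cvg_at_leftP H : X ^~ w @ t^'- --> left_limit t w by exact: cV.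
    by apply: H; split.
  have Ic : I (u n) w @[n --> \oo] --> I t w.
    move: cI; rewrite (_ : [set t | 0 <= t] = `[0, +oo[%classic); last first.
      by apply/seteqP; split => s /=; rewrite in_itv/= andbT.
    move=> /continuous_within_itvcyP[cI _].
    have cIt : I ^~ w @ t --> I t w by apply: cI; rewrite in_itv/= t0.
    by have := @cvg_comp _ _ _ u (I ^~ w) \oo (nbhs t) (nbhs (I t w)) uc cIt.
  have Jt s : 0 <= s -> s <= t ->
      ((X s w)%:E = (X 0 w)%:E + drift s w + (I s w)%:E - (\sum_(i < N s w) jump_size Y i w)%:E)%E.
    move=> s0 st; rewrite (E s s0) /jump_sum.
    by rewrite min_l//; apply: le_trans tT; rewrite lee_fin.
  have dfin s : 0 <= s -> s <= t -> drift s w = (fine (drift s w))%:E.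
    by move=> s0 st; have := Jt s s0 st; case: (drift s w).
  have Jr s : 0 <= s -> s <= t ->
      X s w = X 0 w + fine (drift s w) + I s w - \sum_(i < N s w) jump_size Y i w.
    by move=> s0 st; have := Jt s s0 st; rewrite {1}dfin// => -[].
  have Dc : fine (drift (u n) w) @[n --> \oo] --> fine (drift t w).
    have H := @drift_left_continuous t w t0.
    rewrite [drift t w](dfin t (ltW t0) (lexx _)) in H.
    exact: (@fine_cvg _ _ _ _ _ _ H).
  have key i s : 0 <= s -> s < t -> (forall v, s <= v -> v < t -> N v w = i) ->
      X t w = left_limit t w + \sum_(j < i) jump_size Y j w - \sum_(j < N t w) jump_size Y j w.
    move=> s0 st Ni; rewrite (Jr t (ltW t0) (lexx _)).
    suff -> : left_limit t w = X 0 w + fine (drift t w) + I t w - \sum_(j < i) jump_size Y j w.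
      by ring.
    apply: (cvg_unique _ Vc) => //.
    have H : X 0 w + fine (drift (u n) w) + I (u n) w - \sum_(j < i) jump_size Y j w
        @[n --> \oo] --> X 0 w + fine (drift t w) + I t w - \sum_(j < i) jump_size Y j w.
      by apply: cvgB; [apply: cvgD => //; apply: cvgD => //|]; exact: cvg_cst.
    apply: cvg_trans H; apply: near_eq_cvg.
    have /cvgrPdist_lt/(_ (t - s)) := uc; rewrite subr_gt0 => /(_ st).
    apply: filterS => n; rewrite gtr0_norm ?subr_gt0// ltrD2l ltrN2 => su.
    by rewrite (Jr (u n)) ?(ltW (ut n))// Ni// ltW.
  have [s [s0 st Ns]] := Nj t t0.
  have [[v [v0 vt Nv]]|nv] := pselect (exists v, [/\ 0 <= v, v < t & N v w = N t w]).
    left; split; first by exists v => //; rewrite v0.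
    rewrite (key (N t w) v)// ?addrK// => v' vv' v't.
    apply/eqP; rewrite eqn_leq Nm ?(le_trans v0)//= ?ltW//.
    by rewrite -Nv Nm.
  right; have Nlt v : 0 <= v -> v < t -> (N v w < N t w)%N.
    move=> v0 vt; rewrite ltn_neqAle (Nm _ _ v0 (ltW vt)) andbT; apply/eqP => Nv.
    by apply: nv; exists v.
  have NtE : N t w = (N s w).+1 by apply/eqP; rewrite eqn_leq Ns Nlt.
  have Ni v : s <= v -> v < t -> N v w = N s w.
    move=> sv vt; apply/eqP; rewrite eqn_leq -ltnS -NtE Nlt ?(le_trans s0)//=.
    exact: Nm.
  exists (N s w); first by split => //; exists s => //; rewrite s0 st.
  by rewrite (key (N s w) s)// NtE big_ord_recr/=; ring.
- by move=> i t t0; exact: (chain_right_constant (jd_chain Z lx i)).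
Qed.

Lemma left_limit_cvg t w : 0 < t -> X s w @[s --> t^'-] --> left_limit t w.
Proof. by move=> t0; have [_ /(_ t0) cV] := jd_cadlag Z w (ltW t0); exact: cV. Qed.

Definition before_seq (t : R) (n : nat) : R := t - t / n.+1%:R.

Lemma before_seq_lt t n : 0 < t -> before_seq t n < t.
Proof. by move=> t0; rewrite gtrDl oppr_lt0 divr_gt0. Qed.

Lemma before_seq_ge0 t n : 0 <= t -> 0 <= before_seq t n.
Proof.
by move=> t0; rewrite subr_ge0 ler_pdivrMr ?ltr0n// ler_peMr// ler1n.
Qed.

Lemma before_seq_cvg t : before_seq t n @[n --> \oo] --> t.
Proof.
rewrite -[X in _ --> X]subr0; apply: cvgB; first exact: cvg_cst.
by rewrite -[X in _ --> X](mulr0 t); apply: cvgMr; exact: cvg_invn.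
Qed.

Lemma left_limit_seq t w (u : nat -> R) : 0 < t -> (forall n, u n < t) ->
  u n @[n --> \oo] --> t -> X (u n) w @[n --> \oo] --> left_limit t w.
Proof.
move=> t0 ut uc.
have /cvg_at_leftP H : X ^~ w @ t^'- --> left_limit t w by exact: left_limit_cvg.
by apply: H.
Qed.

(* At time 0 the left limit is junk; the value [X 0 w] is used instead. *)
Definition value_before (T : Om -> R) (w : Om) : R :=
  if T w == 0 then X 0 w else left_limit (T w) w.

(** Where [T w = 0] the approximating times [before_seq (T w) n] are all 0, which agrees with the
    convention chosen for time 0. *)
Lemma value_before_measurable (T : Om -> R) : measurable_fun setT T -> (forall w, 0 <= T w) ->
  measurable_fun setT (value_before T).
Proof.
move=> mT T0.
apply: (@measurable_fun_cvg _ _ R _ (fun n w => X (before_seq (T w) n) w)).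
  move=> n; apply: (@X_eval_measurable _ _ _ _ _ _ _ _ _ _ Z (fun w => before_seq (T w) n)).
    by apply: measurable_funB => //; exact: measurable_funM.
  by move=> w; exact: before_seq_ge0.
move=> w _; rewrite /value_before; have [T0w|T0w] := eqVneq (T w) 0.
  rewrite T0w (_ : (fun n => _) = fun=> X 0 w); first exact: cvg_cst.
  by apply/funext => n; rewrite /before_seq mul0r subr0.
have Tp : 0 < T w by rewrite lt_neqAle eq_sym T0w T0.
apply: left_limit_seq => //; last exact: before_seq_cvg.
by move=> n; exact: before_seq_lt.
Qed.

Lemma left_limit_ge a t w : 0 < t -> (forall s, 0 <= s -> s < t -> a <= X s w) ->
  a <= left_limit t w.
Proof.
move=> t0 aX; have := @left_limit_seq t w _ t0 (fun n => before_seq_lt n t0) (@before_seq_cvg t).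
move=> H; rewrite -(cvg_lim _ H)//; apply: limr_ge; first by apply/cvg_ex; eexists; exact: H.
by apply: nearW => n; apply: aX; [exact/before_seq_ge0/ltW|exact: before_seq_lt].
Qed.

Lemma left_limit_le b t w : 0 < t -> (forall s, 0 <= s -> s < t -> X s w <= b) ->
  left_limit t w <= b.
Proof.
move=> t0 aX; have := @left_limit_seq t w _ t0 (fun n => before_seq_lt n t0) (@before_seq_cvg t).
move=> H; rewrite -(cvg_lim _ H)//; apply: limr_le; first by apply/cvg_ex; eexists; exact: H.
by apply: nearW => n; apply: aX; [exact/before_seq_ge0/ltW|exact: before_seq_lt].
Qed.

Lemma regular_no_upward_jump x w t : regular x w -> 0 < t -> (t%:E <= T_exit Z w)%E ->
  X t w <= left_limit t w.
Proof.
move=> rw t0 tT; have [[_ ->]//|[i _ ->]] := regular_path rw t0 tT.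
by rewrite gerBl jump_size_ge0.
Qed.

Lemma T_exit_frozen w t s : T_exit Z w = t%:E -> t <= s -> X s w <= l.
Proof.
move=> Tt ts; have Xt : X t w <= l.
  by apply: (first_time_le_le Tt); exact: X_right_continuous.
have t0 : 0 <= t by rewrite -lee_fin -Tt; exact: (@first_time_ge0 R _ (X ^~ w)).
by rewrite (jd_absorbed t0 ts Xt).
Qed.

(** After the exit the path is frozen at or below [l], so [b] cannot be passed later. *)
Lemma T_above_le_exit b w : l <= b -> (T_above Z b w < +oo)%E ->
  (T_above Z b w <= T_exit Z w)%E.
Proof.
move=> lb Tb; rewrite leNgt; apply/negP => ET.
have [t Tt] : exists t, T_exit Z w = t%:E.
  have := lt_le_trans ET (leey _) => /first_time_fine[t _ Tt].
  by exists t.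
have [s s0 Ts] := first_time_fine Tb.
have [u [su _ /= bu]] := first_time_near Ts ltr01.
have : X u w <= l.
  apply: (T_exit_frozen Tt); move: ET; rewrite -/(first_time _ _) in Ts.
  by rewrite /T_above /hitting -/(first_time _ _) Ts Tt lte_fin => /ltW/le_trans; apply.
by rewrite leNgt (le_lt_trans lb).
Qed.

(** Time 0 is special: the left limit makes no sense there, and [x <= b] gives the upper bound
    instead. *)
Lemma X_at_T_above x b w : regular x w -> l <= b -> x <= b ->
  (T_above Z b w < +oo)%E -> X_at Z (T_above Z b) w = b.
Proof.
move=> rw lb xb Tb; have TbE := T_above_le_exit lb Tb.
have [t t0 Tt] := first_time_fine Tb.
have Tt' : T_above Z b w = t%:E by exact: Tt.
rewrite /X_at Tt' /=; apply: le_anti.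
rewrite (first_time_above_ge Tt) ?andbT; last exact: X_right_continuous.
have [t00|t0n] := eqVneq t 0; first by rewrite t00 (regular_start rw).
have {}t0 : 0 < t by rewrite lt_neqAle eq_sym t0n.
rewrite Tt' in TbE; apply: le_trans (regular_no_upward_jump rw t0 TbE) _.
apply: left_limit_le => // s s0 st; rewrite leNgt; apply/negP => bs.
by have := @first_time_le _ [set z | b < z] (X ^~ w) s s0 bs; rewrite Tt lee_fin leNgt st.
Qed.

Lemma T_below_le_exit a w : l < a -> (T_below Z a w <= T_exit Z w)%E.
Proof.
move=> la; apply/ereal_infP => _ [t [t0 Xt] <-].
by apply: first_time_le => //=; exact: le_lt_trans la.
Qed.

Lemma X_at_T_below_le a w : (T_below Z a w < +oo)%E -> X_at Z (T_below Z a) w <= a.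
Proof.
move=> /first_time_fine[t t0 Tt]; have Tt' : T_below Z a w = t%:E by exact: Tt.
rewrite /X_at Tt'; apply: (first_time_below_le Tt); exact: X_right_continuous.
Qed.

Lemma before_T_below a w t s : T_below Z a w = t%:E -> 0 <= s -> s < t -> a <= X s w.
Proof.
move=> Tt s0 st; rewrite leNgt; apply/negP => Xa.
have : (T_below Z a w <= s%:E)%E by exact: (@first_time_le _ _ (X ^~ w) s s0 Xa).
by rewrite Tt lee_fin leNgt st.
Qed.

(** Without a jump the path would sit at its left limit, which is at least [a]. *)
Lemma T_below_jump x a w t : regular x w -> l < a -> T_below Z a w = t%:E ->
  0 < t -> X t w < a ->
  exists2 i, jumps_from t w i & X t w = left_limit t w - jump_size Y i w.
Proof.
move=> rw la Tt t0 Xa.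
have tE : (t%:E <= T_exit Z w)%E by rewrite -Tt T_below_le_exit.
have [[_ XE]|//] := regular_path rw t0 tE.
have : a <= left_limit t w.
  by apply: left_limit_ge => // s s0 st; exact: before_T_below Tt _ _.
by rewrite -XE leNgt Xa.
Qed.

End PathJumps.

(** * Independence of a jump and its past *)

Section SigmaAlgebraClosure.
Context {T : Type} (G : set_system T) (sG : sigma_algebra setT G).

Lemma sigma_algebra_closedC A : G A -> G (~` A).
Proof. by move=> GA; case: sG => _ /(_ _ GA) + _; rewrite setTD. Qed.

Lemma sigma_algebra_closedU A1 A2 : G A1 -> G A2 -> G (A1 `|` A2).
Proof.
move=> GA1 GA2; case: sG => G0 _ GU.
rewrite -bigcup2E; apply: GU => -[//|[//|n]]; exact: G0.
Qed.

Lemma sigma_algebra_closedI A1 A2 : G A1 -> G A2 -> G (A1 `&` A2).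
Proof.
move=> GA1 GA2; rewrite -[X in G X]setCK setCI.
by apply: sigma_algebra_closedC; apply: sigma_algebra_closedU; exact: sigma_algebra_closedC.
Qed.

End SigmaAlgebraClosure.

Lemma sigma_path_preimage {R : realType} {d : measure_display}
    {Om : measurableType d} {S : Type} (G : set_system S)
    (V : R -> Om -> S) t D : 0 <= t -> G D -> sigma_path G V (V t @^-1` D).
Proof.
move=> t0 GD; apply: sub_sigma_algebra; exists t => //.
by exists D => //; rewrite setTI.
Qed.

Lemma bounded_cvg_integral {R : realType} {d : measure_display}
    {Om : measurableType d} (m : {measure set Om -> \bar R}) (A : set Om)
    (f : nat -> Om -> R) (g : Om -> R) : m setT = 1%E -> measurable A ->
  (forall n, measurable_fun setT (f n)) -> measurable_fun setT g ->
  (forall n w, 0 <= f n w <= 1) ->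
  {ae m, forall w, f n w @[n --> \oo] --> g w} ->
  (\int[m]_(w in A) (f n w)%:E)%E @[n --> \oo] --> (\int[m]_(w in A) (g w)%:E)%E.
Proof.
move=> m1 mA mf mg f01 fg.
have mAf n : measurable_fun A (fun w => (f n w)%:E).
  by apply/measurable_EFinP; exact: measurable_funTS.
have mAg : measurable_fun A (fun w => (g w)%:E).
  by apply/measurable_EFinP; exact: measurable_funTS.
have hcv : {ae m, forall w, A w -> (f n w)%:E @[n --> \oo] --> (g w)%:E}.
  by apply: filterS fg => w fgw _; apply: cvg_EFin => //; exact: nearW.
have hint : m.-integrable A (fun=> 1%E).
  apply/integrableP; split => //.
  rewrite (eq_integral (fun=> 1%E)); last by move=> w _; rewrite abse1.
  rewrite integral_cst// mul1e (@le_lt_trans _ _ (m setT)) ?m1 ?ltry//.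
  by rewrite -m1; apply: le_measure; rewrite ?inE.
have hbd : {ae m, forall w, forall n, A w -> (`|(f n w)%:E| <= 1%E)%E}.
  apply: filterE => w n _; case/andP: (f01 n w) => f0 f1.
  by rewrite /= lee_fin ger0_norm.
by have [_ _] := dominated_convergence mA mAf mAg hcv hint hbd.
Qed.

Section JumpIndependence.
Context {R : realType} {d : measure_display} {Om : measurableType d} {K : nat}.
Context {l lam : R} {c sigma : R -> R} {beta : 'rV[R]_K} {B : 'M[R]_K}.
Variable Z : @jump_diffusion R d Om K l lam c sigma beta B.
Local Notation X := (jd_X Z).
Local Notation P := (jd_P Z).
Local Notation N := (jd_N Z).
Local Notation Y := (jd_Y Z).
Local Notation F := (jd_F Z).
Variables (x : R) (lx : l < x).

Let pN := jd_poisson Z lx.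

Variables (v1 v2 : R) (S1 S2 : set (option 'I_K)).
Hypotheses (v10 : 0 <= v1) (v20 : 0 <= v2).

(** Two times are observed because the overshoot law asks for the phase when the level is crossed
    and for survival some time later. *)
Definition mark_event (i : nat) : set Om := Y i v1 @^-1` S1 `&` Y i v2 @^-1` S2.

Lemma mark_measurable i v (S : set (option 'I_K)) : 0 <= v -> measurable (Y i v @^-1` S).
Proof.
move=> v0; rewrite (_ : _ @^-1` S = \bigcup_(s in S) (Y i v @^-1` [set s])).
  apply: fin_bigcup_measurable => [|s _]; first exact: finite_finset.
  exact: (chain_measurable (jd_chain Z lx i)).
by apply/seteqP; split => w /=; [move=> Sw; exists (Y i v w)|move=> [s Ss ->]].
Qed.

Lemma mark_event_measurable i : measurable (mark_event i).
Proof. by apply: measurableI; exact: mark_measurable. Qed.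

Variable pE : R.
Hypotheses (pE0 : 0 <= pE) (PE : forall i, P x (mark_event i) = pE%:E).

Definition increment s t : set Om := [set w | (1 <= N t w - N s w)%N].

(** Sort by the value j of [N s]: the chain j is independent of [N], and its event has the same
    probability for every j. *)
Lemma future_mark_prob s t : 0 <= s -> s < t ->
  P x (increment s t `&` [set w | mark_event (N s w) w]) = (P x (increment s t) * pE%:E)%E.
Proof.
move=> s0 st; have t0 : 0 <= t by rewrite (le_trans s0)// ltW.
pose C j := N s @^-1` [set j] `&` N t @^-1` [set n | (1 <= n - j)%N].
have mI : measurable (increment s t).
  by apply: (increment_measurable (jd_filtration Z) pN [set n | (1 <= n)%N]) => //; exact: ltW.
have mC j : measurable (C j).
  by apply: measurableI; apply: (N_measurable (jd_filtration Z) pN).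
have PC j : P x (C j `&` mark_event j) = (P x (C j) * pE%:E)%E.
  pose A (k : option (option nat)) := match k with
    | Some None => C j | Some (Some _) => mark_event j | None => setT end.
  have := @jd_independent _ _ _ _ _ _ _ _ _ _ Z x lx [:: Some None; Some (Some j)] A.
  rewrite !big_cons big_nil mule1 /= (PE j) => <-//.
  - congr (P x _); apply/seteqP; split => w.
      by move=> [Cw Ew] k; rewrite /mkset !inE => /orP[] /eqP ->.
    by move=> H; split; [apply: (H (Some None))|apply: (H (Some (Some j)))];
      rewrite /mkset !inE eqxx ?orbT.
  - move=> k; rewrite !inE => /orP[] /eqP -> /=.
    + have sN := smallest_sigma_algebra setT
        (\bigcup_(t in [set t : R | 0 <= t]) preimage_set_system setT (N t) setT).
      by apply: (sigma_algebra_closedI sN); exact: sigma_path_preimage.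
    + have sY := smallest_sigma_algebra setT
        (\bigcup_(t in [set t : R | 0 <= t]) preimage_set_system setT (Y j t) setT).
      by apply: (sigma_algebra_closedI sY); exact: sigma_path_preimage.
have tC (G : nat -> set Om) : trivIset setT (fun j => C j `&` G j).
  by apply/trivIsetP => i j _ _ /eqP ij; apply/seteqP; split => w //=;
    move=> [[[Ni _] _] [[Nj _] _]]; apply: ij; rewrite -Ni -Nj.
rewrite (_ : _ `&` _ = \bigcup_j (C j `&` mark_event j)); last first.
  apply/seteqP; split => w /=; first by move=> [Iw Ew]; exists (N s w).
  by move=> [j _ [[/= Nj Iw] Ew]]; rewrite /increment/= Nj.
rewrite measure_bigcup//; last by move=> j _; apply: measurableI => //; exact: mark_event_measurable.
rewrite (_ : increment s t = \bigcup_j (C j `&` setT)); last first.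
  apply/seteqP; split => w /=; first by move=> Iw; exists (N s w).
  by move=> [j _ [[/= Nj Iw] _]]; rewrite /increment/= Nj.
rewrite measure_bigcup//; last by move=> j _; rewrite setIT.
under eq_eseriesr do rewrite PC.
under [in RHS]eq_eseriesr do rewrite setIT.
by rewrite muleC -nneseriesZl//; apply: eq_eseriesr => j _; rewrite muleC.
Qed.

(** The noise after [s] numbers its chains from [N s w] on, so the event of the chain with this
    random index and the increment both lie in it, and are independent of the past at [s]. *)
Lemma past_future_prob s t A : 0 <= s -> s < t -> F s A ->
  P x (A `&` (increment s t `&` [set w | mark_event (N s w) w])) =
    (P x A * (P x (increment s t) * pE%:E))%E /\
  P x (A `&` increment s t) = (P x A * P x (increment s t))%E.
Proof.
move=> s0 st FA; have ts0 : 0 <= t - s by rewrite subr_ge0 ltW.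
pose G : set_system Om := sigma_path measurable (fun u w => jd_W Z (s + u) w - jd_W Z s w)
      `|` sigma_path setT (fun u w => N (s + u)%R w - N s w)%N
      `|` \bigcup_i sigma_path setT (fun v w => Y (N s w + i)%N v w).
have sG : sigma_algebra setT (future_noise (jd_W Z) N Y s) by exact: smallest_sigma_algebra.
have fI : future_noise (jd_W Z) N Y s (increment s t).
  apply: sub_sigma_algebra; left; right.
  rewrite (_ : increment s t =
    (fun w => N (s + (t - s))%R w - N s w)%N @^-1` [set n | (1 <= n)%N]).
    exact: (@sigma_path_preimage R d Om nat setT (fun u w => N (s + u)%R w - N s w)%N (t - s)).
  by rewrite addrC subrK.
have fE : future_noise (jd_W Z) N Y s [set w | mark_event (N s w) w].
  rewrite (_ : [set w | _] = (fun w => Y (N s w + 0)%N v1 w) @^-1` S1 `&`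
    (fun w => Y (N s w + 0)%N v2 w) @^-1` S2); last first.
    by apply/seteqP; split => w /=; rewrite addn0.
  by apply: (sigma_algebra_closedI sG); apply: sub_sigma_algebra; right; exists 0%N => //;
    [exact: (@sigma_path_preimage R d Om _ setT (fun u w => Y (N s w + 0)%N u w) v1)
    |exact: (@sigma_path_preimage R d Om _ setT (fun u w => Y (N s w + 0)%N u w) v2)].
have ind := @jd_future _ _ _ _ _ _ _ _ _ _ Z x lx s s0; split.
  rewrite ind//; last exact: (sigma_algebra_closedI sG).
  by rewrite future_mark_prob.
exact: ind.
Qed.

(** On [A] the random index [N s w] is the constant [i], and [X s] belongs to the past at [s]; the
    event of the chain [i] therefore splits off from the law of [X s] as the factor [pE]. *)
Lemma frozen_integral s t i A (phi : R -> R) : 0 <= s -> s < t -> F s A ->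
  A `<=` N s @^-1` [set i] -> measurable_fun setT phi -> (forall y, 0 <= phi y) ->
  (\int[P x]_(w in A `&` increment s t `&` mark_event i) (phi (X s w))%:E =
   pE%:E * \int[P x]_(w in A `&` increment s t) (phi (X s w))%:E)%E.
Proof.
move=> s0 st FA AN mphi phi0.
have mI : measurable (increment s t).
  by apply: (increment_measurable (jd_filtration Z) pN [set n | (1 <= n)%N]) => //; exact: ltW.
have mA : measurable A := past_time_measurable s0 FA.
set A1 := A `&` increment s t `&` mark_event i; set A2 := A `&` increment s t.
have mA2 : measurable A2 by exact: measurableI.
have mA1 : measurable A1 by apply: measurableI => //; exact: mark_event_measurable.
have mX := X_measurable Z s0.
pose L1 := weighted_law P mX (measurable_indic mA1) (indic_ge0 A1) x.
pose L2 := weighted_law P mX (measurable_indic mA2) (indic_ge0 A2) x.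
have L (A' : set Om) (mA' : measurable A') D : measurable D ->
    weighted_law P mX (measurable_indic mA') (indic_ge0 A') x D = P x (A' `&` X s @^-1` D).
  move=> mD; rewrite weighted_lawE// integral_indic//.
  by rewrite -[X in measurable X]setTI; exact: (mX measurableT).
have I (A' : set Om) (mA' : measurable A') :
    (\int[weighted_law P mX (measurable_indic mA') (indic_ge0 A') x]_y (phi y)%:E =
     \int[P x]_(w in A') (phi (X s w))%:E)%E.
  rewrite integral_weighted_law//; last exact/measurable_EFinP.
  rewrite preimage_setT [RHS]integral_mkcond; apply: eq_integral => w _.
  by rewrite patchE indicE; case: (w \in A'); rewrite ?mul1e ?mul0e.
rewrite -(I _ mA1) -(I _ mA2).
rewrite (eq_measure_integral (mscale (NngNum pE0) L2)); last first.
  move=> D mD _; transitivity (P x (A1 `&` X s @^-1` D)); first exact: (L _ mA1 D mD).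
  transitivity (pE%:E * P x (A2 `&` X s @^-1` D))%E; last first.
    by rewrite -(L _ mA2 D mD).
  have FD : F s (A `&` X s @^-1` D).
    have [sF _ _] := jd_filtration Z; apply: (sigma_algebra_closedI (sF s s0)) => //.
    exact: (jd_adapted Z).
  have [H1 H2] := past_future_prob s0 st FD.
  rewrite (_ : A2 `&` _ = (A `&` X s @^-1` D) `&` increment s t); last first.
    by rewrite /A2 setIAC.
  rewrite H2 (_ : A1 `&` _ = (A `&` X s @^-1` D) `&`
    (increment s t `&` [set w | mark_event (N s w) w])).
    by rewrite H1 muleA muleC.
  apply/seteqP; split => w /=.
    move=> [[[Aw Iw] Ew] Dw]; have Ni : N s w = i := AN _ Aw.
    by split=> //; split => //; rewrite Ni.
  move=> [[Aw Dw] [Iw Ew]]; have Ni : N s w = i := AN _ Aw.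
  by rewrite Ni in Ew; split.
rewrite ge0_integral_mscale//; first exact/measurable_EFinP.
by move=> y _; rewrite lee_fin.
Qed.

(** [N] is read as a real process so that the lemmas on first passage apply; as jumps are numbered
    from 0, jump [i] is the passage above i. *)
Definition jump_time (i : nat) : Om -> \bar R :=
  hitting [set z | i%:R < z] (fun t w => (N t w)%:R).

Lemma N_right_continuous w : rcontinuous (fun t => (N t w)%:R : R).
Proof.
move=> t t0; apply: cvg_near_cst.
by have := N_right_constant pN w t0; apply: filterS => s ->.
Qed.

Lemma jump_time_measurable i : measurable_fun setT (jump_time i).
Proof.
apply: measurable_hitting => [w|t t0].
  by apply: first_time_open; [exact: open_gt|exact: N_right_continuous].
rewrite (_ : _ @^-1` _ = N t @^-1` [set n | (i < n)%N]).
  exact: (N_measurable (jd_filtration Z) pN).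
by apply/seteqP; split => w /=; rewrite ltr_nat.
Qed.

Lemma jump_time_ge0 i w : (0 <= jump_time i w)%E.
Proof. exact: (@first_time_ge0 R _ (fun t => (N t w)%:R)). Qed.

Lemma jump_time_le i t w : 0 <= t -> (i < N t w)%N -> (jump_time i w <= t%:E)%E.
Proof.
move=> t0 iN; apply: (@first_time_le R _ (fun t => (N t w)%:R)) => //=.
by rewrite ltr_nat.
Qed.

Lemma jump_time_before i t s w : jump_time i w = t%:E -> 0 <= s -> s < t -> (N s w <= i)%N.
Proof.
move=> it s0 st; rewrite leqNgt; apply/negP => /(jump_time_le s0).
by rewrite it lee_fin leNgt st.
Qed.

Lemma jump_time_after i t s w : jump_time i w = t%:E -> t <= s -> (i < N s w)%N.
Proof.
move=> it ts; have t0 : 0 <= t by rewrite -lee_fin -it jump_time_ge0.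
apply: leq_trans (N_mono pN w t0 ts).
have [e /= e0 He] := N_right_constant pN w t0.
have [u [tu ute /=]] := first_time_near (it : first_time _ (fun t => (N t w)%:R) = _) e0.
rewrite ltr_nat; move: tu; rewrite le_eqVlt => /orP[/eqP <-//|tu].
rewrite He//= /ball_/= distrC gtr0_norm ?subr_gt0//; lra.
Qed.

Lemma jump_time_gt0 i t w : jump_time i w = t%:E -> 0 < t.
Proof.
move=> it; rewrite lt_neqAle; apply/andP; split; last first.
  by rewrite -lee_fin -it jump_time_ge0.
apply/eqP => t0; have := jump_time_after it (lexx t).
by rewrite -t0 (N0 pN).
Qed.

Lemma jumps_from_time i t w : 0 < t -> jumps_from Z t w i -> jump_time i w = t%:E.
Proof.
move=> t0 [Nt [s /andP[s0 st] Ns]]; apply: le_anti; apply/andP; split.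
  by apply: jump_time_le; [exact: ltW|rewrite Nt].
apply/ereal_infP => _ [u [u0 /=]] + <-; rewrite ltr_nat lee_fin leNgt => iu.
apply/negP => ut; have := Ns (Num.max s u).
rewrite le_max lexx gt_max st ut => /(_ isT isT) Nm.
have := N_mono pN w u0 (_ : u <= Num.max s u).
by rewrite le_max lexx orbT Nm leqNgt iu => /(_ isT).
Qed.

Lemma jump_time_jumps i t w : regular Z x w -> jump_time i w = t%:E -> jumps_from Z t w i.
Proof.
move=> rw it; have t0 := jump_time_gt0 it.
have [s [s0 st Ns]] := regular_N_simple rw t0.
have iN := jump_time_after it (lexx t).
have Nsi : N s w = i.
  apply/eqP; rewrite eqn_leq (jump_time_before it)//=.
  by rewrite -ltnS (leq_trans iN).
split.
  by apply/eqP; rewrite eqn_leq iN andbT -Nsi.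
exists s; first by rewrite s0.
move=> u su ut; apply/eqP; rewrite eqn_leq (jump_time_before it) ?(le_trans s0)//=.
by rewrite -Nsi (N_mono pN).
Qed.

Variables (T : Om -> \bar R) (oT : optional_time F T) (i : nat) (q : R) (q0 : 0 <= q).
Variables (phi : R -> R) (cphi : continuous phi) (phi0 : forall y, 0 <= phi y)
  (phi1 : forall y, phi y <= 1).

Definition pre_jump_value : Om -> R := value_before Z (fun w => fine (jump_time i w)).

Lemma pre_jump_value_measurable : measurable_fun setT pre_jump_value.
Proof.
apply: value_before_measurable => [|w]; last exact/fine_ge0/jump_time_ge0.
exact/measurableT_comp/jump_time_measurable.
Qed.

(** The inequality is weak because the jump may itself bring about [T]. On the grids it is tested at
    the last grid point before the jump. *)
Definition at_jump_event : set Om := [set w | (jump_time i w <= T w)%E].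

Lemma at_jump_event_measurable : measurable at_jump_event.
Proof.
rewrite -[X in measurable X]setTI; apply: measurable_lee => //.
  exact: jump_time_measurable.
exact: optional_time_measurable oT.
Qed.

Definition at_jump (w : Om) : R :=
  \1_at_jump_event w * (discount q (jump_time i w) * phi (pre_jump_value w)).

Let grid (n k : nat) : R := k%:R / n.+1%:R.
Let gridS n k : grid n k < grid n k.+1.
Proof. by rewrite ltr_pM2r ?invr_gt0 ?ltr0n// ltr_nat. Qed.
Let grid_ge0 n k : 0 <= grid n k. Proof. by rewrite divr_ge0. Qed.
Let grid_mono n k m : (k <= m)%N -> grid n k <= grid n m.
Proof. by move=> km; rewrite ler_wpM2r ?invr_ge0// ler_nat. Qed.

(* Given [grid_past n k], which belongs to the past of [grid n k], the chain
   of the jump [i] is the first chain of the future noise. *)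
Definition grid_past n k : set Om := [set w | N (grid n k) w = i /\ ((grid n k)%:E <= T w)%E].

Lemma grid_past_F n k : F (grid n k) (grid_past n k).
Proof.
have [sF _ _] := jd_filtration Z; have sG := sF _ (grid_ge0 n k).
rewrite (_ : grid_past n k = N (grid n k) @^-1` [set i] `&`
   ~` [set w | (T w < (grid n k)%:E)%E]).
  apply: sigma_algebra_closedI => //; first by case: pN => aN _ _ _; exact: aN.
  by apply: sigma_algebra_closedC => //; case: oT => _; apply.
apply/seteqP; split => w [Nk Tk]; split => //.
  by rewrite /setC/= ltNge Tk.
by move: Tk; rewrite /setC/= => /negP; rewrite -leNgt.
Qed.

Definition grid_event n k := grid_past n k `&` increment (grid n k) (grid n k.+1).

Lemma grid_event_measurable n k : measurable (grid_event n k).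
Proof.
apply: measurableI; first exact: (past_time_measurable (grid_ge0 n k) (grid_past_F n k)).
by apply: (increment_measurable (jd_filtration Z) pN [set n | (1 <= n)%N]) => //; exact: ltW.
Qed.

Definition grid_term n k w : R :=
  \1_(grid_event n k) w * (expR (- q * grid n k) * phi (X (grid n k) w)).

(** (n + 1)^2 cells of width 1 / (n + 1) reach time n + 1, so every finite jump time is eventually
    covered. The jump lies in a single cell, hence at most one term is nonzero. *)
Definition grid_sum n w : R := \sum_(k < n.+1 * n.+1) grid_term n k w.

Lemma grid_term_ge0 n k w : 0 <= grid_term n k w.
Proof. by rewrite mulr_ge0// mulr_ge0 ?expR_ge0. Qed.

Lemma grid_term_le1 n k w : grid_term n k w <= 1.
Proof.
rewrite mulr_ile1 ?indic_le1// ?mulr_ge0 ?expR_ge0// mulr_ile1 ?expR_ge0//.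
by rewrite mulNr expR_le1 oppr_le0 mulr_ge0.
Qed.

Lemma grid_term_measurable n k : measurable_fun setT (grid_term n k).
Proof.
apply: measurable_funM; first exact/measurable_indic/grid_event_measurable.
apply: measurable_funM => //; apply: measurableT_comp; first exact: continuous_measurable_fun.
exact: X_measurable.
Qed.

Lemma grid_event_unique n k m w : grid_event n k w -> grid_event n m w -> k = m.
Proof.
wlog km : k m / (k <= m)%N.
  by move=> H; case: (leqP k m) => [|/ltnW] km A1 A2; [exact: H|apply/esym; exact: H].
move=> [[Nk _] Ik] [[Nm _] _]; move: km; rewrite leq_eqVlt => /orP[/eqP//|km]; exfalso.
have := N_mono pN w (grid_ge0 n k.+1) (grid_mono n km).
move: Ik; rewrite /increment/= Nk Nm subn_gt0 => /leq_trans H /H.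
by rewrite ltnn.
Qed.

Lemma grid_sumE n k w : (k < n.+1 * n.+1)%N -> grid_event n k w -> grid_sum n w = grid_term n k w.
Proof.
move=> kn Ek; rewrite /grid_sum (bigD1 (Ordinal kn))//= big1 ?addr0// => m mk.
rewrite /grid_term indicE memNset ?mul0r// => Em; move: mk.
by rewrite -val_eqE/= (grid_event_unique Em Ek) eqxx.
Qed.

Lemma grid_sum0 n w : (forall k, ~ grid_event n k w) -> grid_sum n w = 0.
Proof.
by move=> nE; rewrite /grid_sum big1// => k _; rewrite /grid_term indicE memNset ?mul0r.
Qed.

Lemma grid_sum_le1 n w : 0 <= grid_sum n w <= 1.
Proof.
rewrite sumr_ge0 => [|k _]; last exact: grid_term_ge0.
have [[k kE]|nE] := pselect (exists2 k : 'I_(n.+1 * n.+1), true & grid_event n k w).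
  by move=> E; rewrite (grid_sumE (ltn_ord k) E) grid_term_le1.
rewrite /grid_sum big1 ?ler01// => k _; rewrite /grid_term indicE memNset ?mul0r//.
by move=> E; apply: nE; exists k.
Qed.

(** The left end of the cell of the jump tends to the jump time from below, so the path there tends
    to its left limit; this is where [phi] has to be continuous. *)
Lemma grid_sum_cvg w : regular Z x w -> grid_sum n w @[n --> \oo] --> at_jump w.
Proof.
move=> rw; have [[t it]|noT] := pselect (exists t, jump_time i w = t%:E); last first.
  have joo : jump_time i w = +oo%E.
    have := jump_time_ge0 i w; case E : (jump_time i w) => [r| |]// _.
    by exfalso; apply: noT; exists r.
  rewrite /at_jump joo /= mul0r mulr0 (_ : (fun n => _) = fun=> 0); first exact: cvg_cst.
  apply/funext => n; apply: grid_sum0 => k [[Nk _] Ik].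
  have := @jump_time_le i (grid n k.+1) w (grid_ge0 n k.+1).
  by move: Ik; rewrite /increment/= Nk subn_gt0 => -> /(_ isT); rewrite joo leye_eq.
have t0 := jump_time_gt0 it.
have [Nt [s /andP[s0 st] Ns]] := jump_time_jumps rw it.
have [k kP] := choice (fun n => grid_cell n t0).
have kt n : grid n (k n) < t by case: (kP n).
have tk n : t <= grid n (k n).+1 by case: (kP n).
have kc : grid n (k n) @[n --> \oo] --> t.
  apply: (@squeeze_cvgr _ _ _ _ (fun n => t - n.+1%:R^-1) (fun=> t)); last exact: cvg_cst.
    apply: nearW => n; rewrite (ltW (kt n)) andbT lerBlDr; apply: le_trans (tk n) _.
    by rewrite /grid -natr1 mulrDl mul1r.
  rewrite -[X in _ --> X]subr0; apply: cvgB; [exact: cvg_cst|exact: cvg_invn].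
have near_s : \forall n \near \oo, s <= grid n (k n) /\ (k n < n.+1 * n.+1)%N.
  near=> n; split.
    near: n; have /cvgrPdist_lt/(_ (t - s)) := kc; rewrite subr_gt0 => /(_ st).
    by apply: filterS => n; rewrite gtr0_norm ?subr_gt0// ltrD2l ltrN2 => /ltW.
  rewrite -(@ltr_nat R) natrM; have := kt n; rewrite ltr_pdivrMr ?ltr0n// => /lt_le_trans; apply.
  rewrite ler_wpM2r// -natr1; apply: (@le_trans _ _ (n%:R)); last by rewrite lerDl.
  by near: n; exact: nbhs_infty_ger.
have Xc : X (grid n (k n)) w @[n --> \oo] --> left_limit Z t w by exact: left_limit_seq.
have Vw : pre_jump_value w = left_limit Z t w.
  by rewrite /pre_jump_value /value_before it/= (gt_eqF t0).
have termE n : s <= grid n (k n) -> (k n < n.+1 * n.+1)%N -> ((grid n (k n))%:E <= T w)%E ->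
    grid_sum n w = expR (- q * grid n (k n)) * phi (X (grid n (k n)) w).
  move=> sk kn Tk; have E : grid_event n (k n) w.
    split; first by split => //; exact: Ns.
    rewrite /increment/= (Ns _ sk (kt n)) subn_gt0; exact: jump_time_after it _.
  by rewrite (grid_sumE kn E) /grid_term indicE mem_set// mul1r.
have event_k n m : grid_event n m w -> m = k n.
  move=> [[Nm _] Im].
  have mt : grid n m < t.
    rewrite ltNge; apply/negP => tm; have := jump_time_after it tm.
    by rewrite Nm ltnn.
  have tm : t <= grid n m.+1.
    rewrite leNgt; apply/negP => mt1; have := jump_time_before it (grid_ge0 n m.+1) mt1.
    by move: Im; rewrite /increment/= Nm subn_gt0 => /leq_trans H /H; rewrite ltnn.
  have := lt_le_trans mt (tk n); have := lt_le_trans (kt n) tm.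
  rewrite !ltr_pM2r ?invr_gt0 ?ltr0n// !ltr_nat => km mk.
  by apply/eqP; rewrite eqn_leq -ltnS mk -ltnS km.
rewrite /at_jump Vw it; have [tT|Tt] := leP t%:E (T w).
  rewrite indicE mem_set ?mul1r; last by rewrite /at_jump_event/= it.
  have H : expR (- q * grid n (k n)) * phi (X (grid n (k n)) w) @[n --> \oo] -->
      expR (- q * t) * phi (left_limit Z t w).
    have qc : - q * grid n (k n) @[n --> \oo] --> - q * t.
      by apply: cvgM => //; exact: cvg_cst.
    apply: cvgM; first exact: (@cvg_comp _ _ _ _ _ _ _ _ qc (@continuous_expR R _)).
    have cV : phi y @[y --> left_limit Z t w] --> phi (left_limit Z t w) by exact: cphi.
    by have := @cvg_comp _ _ _ (fun n => X (grid n (k n)) w) phi \oo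
      (nbhs (left_limit Z t w)) (nbhs (phi (left_limit Z t w))) Xc cV.
  apply: cvg_trans H; apply: near_eq_cvg; apply: filterS near_s => n [sk kn].
  by rewrite termE//; apply: le_trans tT; rewrite lee_fin ltW.
rewrite indicE memNset ?mul0r; last by rewrite /at_jump_event/= it leNgt Tt.
(* Here [T] lies strictly before the jump, hence eventually before the left end of its cell, where
   the test against [T] fails. *)
apply: cvg_near_cst.
have [u Tu] : exists u, T w = u%:E.
  by move: (oT.1 w) Tt; case: (T w) => // u _ _; exists u.
rewrite Tu lte_fin in Tt.
have /cvgrPdist_lt/(_ (t - u)) := kc; rewrite subr_gt0 => /(_ Tt).
apply: filterS => n; rewrite gtr0_norm ?subr_gt0// ltrD2l ltrN2 => uk.
apply: grid_sum0 => m Em; move: (Em) => [[_ + ] _].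
by rewrite (event_k _ _ Em) Tu lee_fin leNgt uk.
Unshelve. all: end_near. Qed.

Lemma grid_sum_measurable n : measurable_fun setT (grid_sum n).
Proof. by apply: measurable_sum => k; exact: grid_term_measurable. Qed.

Lemma discount_measurable (U : Om -> \bar R) : measurable_fun setT U ->
  (forall w, (0 <= U w)%E) -> measurable_fun setT (fun w => discount q (U w)).
Proof.
move=> mU U0.
rewrite (_ : (fun w => _) =
  (fun w => \1_[set w | (U w < +oo)%E] w * expR (- q * fine (U w)))).
  apply: measurable_funM.
    apply: measurable_indic; rewrite -[X in measurable X]setTI.
    exact: (emeasurable_fun_infty_o measurableT mU).
  apply: (measurableT_comp (@measurable_expR R)); apply: measurable_funM => //.
  exact: measurableT_comp.
apply/funext => w; rewrite indicE; move: (U0 w).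
case E : (U w) => [r| |]//= _; last by rewrite memNset ?mul0r//= E.
by rewrite mem_set ?mul1r//= E ltry.
Qed.

Lemma discount_ge0 (y : \bar R) : 0 <= discount q y.
Proof. by case: y => //= r; exact: expR_ge0. Qed.

Lemma discount_le1 (y : \bar R) : (0 <= y)%E -> discount q y <= 1.
Proof. by case: y => //= r r0; rewrite mulNr expR_le1 oppr_le0 mulr_ge0. Qed.

Lemma at_jump_measurable : measurable_fun setT at_jump.
Proof.
apply: measurable_funM; first exact/measurable_indic/at_jump_event_measurable.
apply: measurable_funM.
  by apply: discount_measurable; [exact: jump_time_measurable|exact: jump_time_ge0].
apply: measurableT_comp; first exact: continuous_measurable_fun.
exact: pre_jump_value_measurable.
Qed.

Hypothesis aeR : {ae P x, forall w, regular Z x w}.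

Lemma grid_integral_cvg A : measurable A ->
  (\int[P x]_(w in A) (grid_sum n w)%:E)%E @[n --> \oo] --> (\int[P x]_(w in A) (at_jump w)%:E)%E.
Proof.
move=> mA; apply: bounded_cvg_integral => //.
- exact: prob_kernel.
- exact: grid_sum_measurable.
- exact: at_jump_measurable.
- exact: grid_sum_le1.
- by apply: filterS aeR => w rw; exact: grid_sum_cvg.
Qed.

Lemma grid_term_integral n k A : measurable A ->
  (\int[P x]_(w in A) (grid_term n k w)%:E = (expR (- q * grid n k))%:E *
   \int[P x]_(w in A `&` grid_event n k) (phi (X (grid n k) w))%:E)%E.
Proof.
move=> mA; have mE := grid_event_measurable n k.
have mX : measurable_fun setT (fun w => phi (X (grid n k) w)).
  by apply: measurableT_comp; [exact: continuous_measurable_fun|exact: X_measurable].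
rewrite -ge0_integralZl//; last 3 first.
- exact: measurableI.
- by apply/measurable_EFinP; exact: measurable_funTS mX.
- by move=> w _; rewrite lee_fin.
rewrite [RHS]integral_mkcondr; apply: eq_integral => w _.
by rewrite patchE /grid_term indicE; case: (w \in grid_event n k); rewrite ?mul1r ?mul0r.
Qed.

Lemma grid_sum_integral n : (\int[P x]_(w in mark_event i) (grid_sum n w)%:E =
  pE%:E * \int[P x]_w (grid_sum n w)%:E)%E.
Proof.
have S A : measurable A -> (\int[P x]_(w in A) (grid_sum n w)%:E =
    \sum_(k < n.+1 * n.+1) \int[P x]_(w in A) (grid_term n k w)%:E)%E.
  move=> mA; rewrite -ge0_integral_sum//.
  - by apply: eq_integral => w _; rewrite sumEFin.
  - by move=> k; apply/measurable_EFinP; exact: measurable_funTS (grid_term_measurable n k).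
  - by move=> k w _; rewrite lee_fin grid_term_ge0.
rewrite !S//; last exact: mark_event_measurable.
rewrite ge0_sume_distrr; last by move=> k _; apply: integral_ge0 => w _; rewrite lee_fin grid_term_ge0.
apply: eq_bigr => k _; rewrite !grid_term_integral//; last exact: mark_event_measurable.
rewrite setTI setIC /grid_event (frozen_integral (grid_ge0 n k) (gridS n k) (grid_past_F n k))//.
- by rewrite muleCA.
- by move=> w [].
- exact: continuous_measurable_fun.
Qed.

(** The grid identity in the limit: the chain of jump [i] is independent of the time of that jump,
    of the value just before it, and of whether [T] has already passed. *)
Lemma at_jump_integral : (\int[P x]_(w in mark_event i) (at_jump w)%:E =
  pE%:E * \int[P x]_w (at_jump w)%:E)%E.
Proof.
have C1 := grid_integral_cvg (mark_event_measurable i).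
have C2 := @grid_integral_cvg setT measurableT.
rewrite -(cvg_lim _ C1)//; apply: cvg_lim => //.
under eq_fun do rewrite grid_sum_integral.
by apply: cvgeZl.
Qed.

End JumpIndependence.

(** * The chain of a jump observed at a random clock *)

Section Ramp.
Context {R : realType}.

(* Continuous approximations of the indicator of [y < v]. *)
Definition ramp (m : nat) (v y : R) : R := Num.min 1 (Num.max 0 (m%:R * (v - y))).

Lemma ramp_ge0 m v y : 0 <= ramp m v y.
Proof. by rewrite le_min ler01 le_max lexx. Qed.

Lemma ramp_le1 m v y : ramp m v y <= 1.
Proof. by rewrite ge_min lexx. Qed.

Lemma continuous_ramp m v : continuous (ramp m v).
Proof.
move=> y; rewrite /ramp.
have c1 : (fun z => m%:R * (v - z)) z @[z --> y] --> m%:R * (v - y).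
  by apply: cvgMr; apply: cvgB; [exact: cvg_cst|exact: cvg_id].
apply: (@continuous_min _ _ (fun=> 1) (fun y => Num.max 0 (m%:R * (v - y))) y).
  exact: cvg_cst.
by apply: (@continuous_max _ _ (fun=> 0) (fun y => m%:R * (v - y)) y); first exact: cvg_cst.
Qed.

Lemma ramp_cvg v y : ramp m v y @[m --> \oo] --> (\1_[set z | z < v] y : R).
Proof.
apply: cvg_near_cst; have [yv|vy] := ltP y v.
  rewrite indicE mem_set//; near=> m; rewrite /ramp.
  have m1 : 1 <= m%:R * (v - y).
    rewrite -ler_pdivrMr ?subr_gt0//; near: m; exact: nbhs_infty_ger.
  by rewrite max_r ?min_l// (le_trans ler01).
rewrite indicE memNset/= ?ltNge ?vy//; apply: nearW => m; rewrite /ramp.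
by rewrite max_l ?min_r ?ler01// mulr_ge0_le0// subr_le0.
Unshelve. all: end_near. Qed.

End Ramp.

Lemma measurable_indic_inv {R : realType} {d : measure_display}
    {Om : measurableType d} (A : set Om) :
  measurable_fun setT (\1_A : Om -> R) -> measurable A.
Proof.
move=> mA; have := mA measurableT [set 1] (measurable_set1 1).
rewrite setTI; congr measurable; apply/seteqP; split => w /=; rewrite indicE.
  by case: (boolP (w \in A)) => [|_ /eqP]; rewrite ?inE// eq_sym oner_eq0.
by move=> Aw; rewrite mem_set.
Qed.

Section Freezing.
Context {R : realType} {d : measure_display} {Om : measurableType d} {K : nat}.
Context {l lam : R} {c sigma : R -> R} {beta : 'rV[R]_K} {B : 'M[R]_K}.
Variable Z : @jump_diffusion R d Om K l lam c sigma beta B.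
Hypothesis B_sub : nonsingular_subgenerator B.
Local Notation X := (jd_X Z).
Local Notation P := (jd_P Z).
Local Notation N := (jd_N Z).
Local Notation Y := (jd_Y Z).
Local Notation F := (jd_F Z).
Variables (x : R) (lx : l < x).
Hypothesis aeR : {ae P x, forall w, regular Z x w}.
Variables (T : Om -> \bar R) (oT : optional_time F T) (i : nat) (q : R) (q0 : 0 <= q).
Local Notation V := (pre_jump_value Z i).

Definition jump_weight (w : Om) : R :=
  \1_(at_jump_event Z T i) w * discount q (jump_time Z i w).

Lemma jump_weight_ge0 w : 0 <= jump_weight w.
Proof. by rewrite mulr_ge0// discount_ge0. Qed.

Lemma jump_weight_le1 w : jump_weight w <= 1.
Proof.
rewrite mulr_ile1 ?discount_ge0// ?indic_le1// discount_le1//; exact: jump_time_ge0.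
Qed.

Lemma jump_weight_measurable : measurable_fun setT jump_weight.
Proof.
apply: measurable_funM; first exact/measurable_indic/(at_jump_event_measurable lx oT).
apply: (@discount_measurable _ _ _ q (jump_time Z i)) => [|w]; first exact (jump_time_measurable Z lx i).
exact: jump_time_ge0.
Qed.

Let mV : measurable_fun setT V := pre_jump_value_measurable Z lx i.

(** Ramps turn the continuous weights into indicators of half-lines, and these determine a finite
    measure on the values before the jump. *)
Lemma mark_weight v1 v2 S1 S2 pE D : 0 <= v1 -> 0 <= v2 -> 0 <= pE ->
  (forall j, P x (mark_event Z v1 v2 S1 S2 j) = pE%:E) -> measurable D ->
  (\int[P x]_(w in mark_event Z v1 v2 S1 S2 i `&` V @^-1` D) (jump_weight w)%:E =
   pE%:E * \int[P x]_(w in V @^-1` D) (jump_weight w)%:E)%E.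
Proof.
move=> v10 v20 pE0 PE; move: D.
set E := mark_event Z v1 v2 S1 S2 i.
have mE : measurable E by exact: (@mark_event_measurable _ _ _ _ _ _ _ _ _ _ Z x lx).
pose w1 w := \1_E w * jump_weight w.
have mw1 : measurable_fun setT w1.
  by apply: measurable_funM; [exact: measurable_indic|exact: jump_weight_measurable].
have w10 w : 0 <= w1 w by rewrite mulr_ge0// jump_weight_ge0.
have w11 w : w1 w <= 1 by rewrite mulr_ile1 ?indic_le1// ?jump_weight_ge0 ?jump_weight_le1.
pose L1 := weighted_law P mV mw1 w10 x.
pose L2 := weighted_law P mV jump_weight_measurable jump_weight_ge0 x.
have E1 D : measurable D -> L1 D = (\int[P x]_(w in E `&` V @^-1` D) (jump_weight w)%:E)%E.
  move=> mD; rewrite /L1 weighted_lawE// [RHS]integral_mkcondl; apply: eq_integral => w _.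
  by rewrite patchE /w1 indicE; case: (w \in E); rewrite ?mul1r ?mul0r.
have E2 D : measurable D -> L2 D = (\int[P x]_(w in V @^-1` D) (jump_weight w)%:E)%E.
  by move=> mD; rewrite /L2 weighted_lawE//; exact: jump_weight_le1.
suff H D : measurable D -> L1 D = mscale (NngNum pE0) L2 D.
  by move=> D mD; rewrite -(E1 D mD) -(E2 D mD); exact: (H D mD).
move: D; apply: real_measure_unique_lt; first exact: weighted_law_lty.
move=> v; rewrite E1//.
transitivity (pE%:E * L2 `]-oo, v[%classic)%E; last by [].
rewrite E2//.
pose Lt := V @^-1` `]-oo, v[%classic.
have mLt : measurable Lt by rewrite -[X in measurable X]setTI; exact: (mV measurableT).
have C A : measurable A -> (\int[P x]_(w in A) (at_jump Z T i q (ramp m v) w)%:E)%E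
    @[m --> \oo] --> (\int[P x]_(w in A `&` Lt) (jump_weight w)%:E)%E.
  move=> mA; have -> : (\int[P x]_(w in A `&` Lt) (jump_weight w)%:E =
      \int[P x]_(w in A) (jump_weight w * \1_Lt w)%:E)%E.
    rewrite [LHS]integral_mkcondr; apply: eq_integral => w _.
    by rewrite patchE indicE; case: (w \in Lt); rewrite ?mulr1 ?mulr0.
  apply: bounded_cvg_integral => //.
  - exact: prob_kernel.
  - move=> m; apply: (@at_jump_measurable _ _ _ _ _ _ _ _ _ _ Z x lx T oT); exact: continuous_ramp.
  - by apply: measurable_funM; [exact: jump_weight_measurable|exact: measurable_indic].
  - move=> m w; rewrite /at_jump mulrA -/(jump_weight w).
    rewrite mulr_ge0 ?jump_weight_ge0 ?ramp_ge0//=.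
    by rewrite mulr_ile1 ?jump_weight_ge0 ?jump_weight_le1 ?ramp_ge0 ?ramp_le1.
  - apply: filterE => w; rewrite /at_jump.
    under eq_fun do rewrite mulrA -/(jump_weight w).
    apply: cvgMr; have := @ramp_cvg R v (V w).
    by congr (_ --> _); rewrite !indicE; congr (_%:R); apply/idP/idP; rewrite !inE /Lt/= in_itv.
have C1 := C E mE; have := C setT measurableT; rewrite setTI => C2.
rewrite -(cvg_lim _ C1)//; apply: cvg_lim => //.
under eq_fun => m do rewrite (at_jump_integral lx v10 v20 pE0 PE oT i q0
  (@continuous_ramp R m v) (ramp_ge0 m v) (ramp_le1 m v) aeR).
by apply: cvgeZl.
Qed.

Lemma phase_at_measurable (U : Om -> R) (S : set (option 'I_K)) :
  measurable_fun setT U -> (forall w, 0 <= U w) -> measurable [set w | S (Y i (U w) w)].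
Proof.
move=> mU U0; apply: (@measurable_indic_inv R).
rewrite (_ : \1_ _ = (fun w => (fun t w => \1_S (Y i t w) : R) (U w) w)); last first.
  by apply/funext => w; rewrite !indicE; congr (_%:R); apply/idP/idP; rewrite !inE.
apply: (@measurable_eval R d Om (fun t w => \1_S (Y i t w)) U) => //.
  move=> t t0; rewrite (_ : (fun w => _) = \1_(Y i t @^-1` S)).
    apply: measurable_indic; exact: (@mark_measurable _ _ _ _ _ _ _ _ _ _ Z x lx).
  by apply/funext => w; rewrite !indicE; congr (_%:R); apply/idP/idP; rewrite !inE.
move=> w t t0; apply: cvg_near_cst.
by have := chain_right_constant (jd_chain Z lx i) w t0; apply: filterS => u ->.
Qed.

Variables (a : R) (k : 'I_K).
(* The chain of the jump [i] crosses the level [a] at its own time [V w - a]. *)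
Definition overshoot_clock (w : Om) : R := Num.max 0 (V w - a).
Local Notation U := overshoot_clock.

Let mU : measurable_fun setT U.
Proof. by apply: measurable_maxr => //; exact: measurable_funB. Qed.

Let U0 w : 0 <= U w. Proof. by rewrite le_max lexx. Qed.

(** With [W] the crossing clock, this reads: the level is crossed in phase [k] and more than [y] of
    the jump is left. For [y = 0] only the phase condition remains. *)
Definition phase_event (y : R) (W : Om -> R) : set Om :=
  [set w | Y i (W w) w = Some k /\ Y i (W w + y) w <> None].

Lemma phase_event_measurable (y : R) (W : Om -> R) : 0 <= y -> measurable_fun setT W -> (forall w, 0 <= W w) ->
  measurable (phase_event y W).
Proof.
move=> y0 mW W0; apply: measurableI.
  exact: (phase_at_measurable [set Some k]).
apply: (phase_at_measurable (U := fun w => W w + y) (~` [set None])).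
  exact: measurable_funD.
by move=> w; rewrite addr_ge0.
Qed.

Let cell n j : set R := `[j%:R / n.+1%:R, j.+1%:R / n.+1%:R[%classic.

Let cell_disjoint n : trivIset setT (fun j => U @^-1` cell n j).
Proof.
apply/trivIsetP => j m _ _ /eqP jm; apply/seteqP; split => w //= [].
rewrite /cell/= !in_itv/= !ler_pdivrMr ?ltr0n// !ltr_pdivlMr ?ltr0n// => H1 H2.
by apply: jm; rewrite -(truncn_def H1) (truncn_def H2).
Qed.

Let cell_cover n w : exists j, cell n j (U w).
Proof.
exists (Num.truncn (U w * n.+1%:R)); rewrite /cell/= in_itv/=.
rewrite ler_pdivrMr ?ltr0n// ltr_pdivlMr ?ltr0n//.
exact: truncn_itv (mulr_ge0 _ _).
Qed.

Let cell_mass n j : \bar R := (\int[P x]_(w in U @^-1` cell n j) (jump_weight w)%:E)%E.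

Let grid_phaseE n y : phase_event y (fun w => grid_up n (U w)) =
  \bigcup_j (mark_event Z (j.+1%:R / n.+1%:R) (j.+1%:R / n.+1%:R + y)
      [set Some k] (~` [set None]) i `&` U @^-1` cell n j).
Proof.
have gE w j : cell n j (U w) -> grid_up n (U w) = j.+1%:R / n.+1%:R.
  rewrite /cell/= in_itv/= ler_pdivrMr ?ltr0n// ltr_pdivlMr ?ltr0n// => H.
  by rewrite /grid_up (truncn_def H).
apply/seteqP; split => w.
  have [j jU] := cell_cover n w; move=> [Y1 Y2]; exists j => //; split => //.
  by rewrite /mark_event -(gE _ _ jU).
by move=> [j _ [[Y1 Y2] /gE jU]]; rewrite /phase_event/= jU.
Qed.

Let mcell n j : measurable (cell n j).
Proof. exact: measurable_itv. Qed.

(** On a cell the rounded clock is a constant, so [mark_weight] applies; the dependence on [y] is a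
    factor [survival B k y], the same for all cells. *)
Let mark_cell n j y : 0 <= y ->
  (\int[P x]_(w in mark_event Z (j.+1%:R / n.+1%:R) (j.+1%:R / n.+1%:R + y)
      [set Some k] (~` [set None]) i `&` U @^-1` cell n j) (jump_weight w)%:E =
   (survival B k y)%:E * ((phase_law beta B (j.+1%:R / n.+1%:R) (Some k))%:E *
     cell_mass n j))%E.
Proof.
move=> y0; set u := j.+1%:R / n.+1%:R; have u0 : 0 <= u by rewrite divr_ge0.
have PE m : P x (mark_event Z u (u + y) [set Some k] (~` [set None]) m) =
    (phase_law beta B u (Some k) * survival B k y)%:E.
  by rewrite -(chain_stays (jd_chain Z lx m) k u0 y0).
have pE0 : 0 <= phase_law beta B u (Some k) * survival B k y by rewrite -lee_fin -(PE 0%N).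
have uy0 : 0 <= u + y by rewrite addr_ge0.
pose D := (fun v : R => Num.max 0 (v - a)) @^-1` cell n j.
have mD : measurable D.
  rewrite -[X in measurable X]setTI.
  have H : measurable_fun setT (fun v : R => Num.max 0 (v - a)).
    by apply: measurable_maxr => //; exact: measurable_funB.
  exact: (H measurableT).
rewrite [LHS](mark_weight u0 uy0 pE0 PE mD) EFinM.
by rewrite [X in (X * _)%E]muleC -muleA.
Qed.

Lemma grid_phase_event_integral n y : 0 <= y ->
  (\int[P x]_(w in phase_event y (fun w => grid_up n (U w))) (jump_weight w)%:E =
   (survival B k y)%:E *
   \sum_(0 <= j <oo) ((phase_law beta B (j.+1%:R / n.+1%:R) (Some k))%:E * cell_mass n j))%E.
Proof.
move=> y0; rewrite grid_phaseE ge0_integral_bigcup.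
- under eq_eseriesr => j _ do rewrite (mark_cell n j y0).
  rewrite nneseriesZl// => j _; apply: mule_ge0.
    by rewrite lee_fin; apply: (phase_law_ge0 (jd_chain Z lx 0)); rewrite divr_ge0.
  by apply: integral_ge0 => w _; rewrite lee_fin jump_weight_ge0.
- move=> j; apply: measurableI.
    by apply: (@mark_event_measurable _ _ _ _ _ _ _ _ _ _ Z x lx); rewrite ?addr_ge0// divr_ge0.
  by rewrite -[X in measurable X]setTI; exact: (mU measurableT).
- by apply/measurable_EFinP; exact: measurable_funTS jump_weight_measurable.
- by move=> w _; rewrite lee_fin jump_weight_ge0.
- exact: trivIset_setIl.
Qed.

Let grid_phase_event_measurable n y : 0 <= y ->
  measurable (phase_event y (fun w => grid_up n (U w))).
Proof.
move=> y0; rewrite grid_phaseE; apply: bigcup_measurable => j _; apply: measurableI.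
  by apply: (@mark_event_measurable _ _ _ _ _ _ _ _ _ _ Z x lx); rewrite ?addr_ge0// divr_ge0.
by rewrite -[X in measurable X]setTI; exact: (mU measurableT).
Qed.

(** Chains are right-constant and the clock is rounded to the right, so from some n on the rounding
    no longer changes the two observed states. *)
Lemma phase_event_integral_cvg y : 0 <= y ->
  (\int[P x]_(w in phase_event y (fun w => grid_up n (U w))) (jump_weight w)%:E)%E
    @[n --> \oo] --> (\int[P x]_(w in phase_event y U) (jump_weight w)%:E)%E.
Proof.
move=> y0.
have I (A : set Om) : (\int[P x]_(w in A) (jump_weight w)%:E =
    \int[P x]_w (\1_A w * jump_weight w)%:E)%E.
  rewrite [LHS]integral_mkcond; apply: eq_integral => w _.
  by rewrite patchE indicE; case: (w \in A); rewrite ?mul1r ?mul0r.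
rewrite I; under eq_fun do rewrite I.
apply: (@bounded_cvg_integral _ _ _ (P x) setT
  (fun n w => \1_(phase_event y (fun w => grid_up n (U w))) w * jump_weight w)) => //.
- exact: prob_kernel.
- move=> n; apply: measurable_funM; last exact: jump_weight_measurable.
  exact/measurable_indic/grid_phase_event_measurable.
- apply: measurable_funM; last exact: jump_weight_measurable.
  exact/measurable_indic/phase_event_measurable.
- move=> n w; rewrite mulr_ge0 ?jump_weight_ge0//=.
  by rewrite mulr_ile1 ?indic_le1// ?jump_weight_ge0 ?jump_weight_le1.
- apply: filterE => w; apply: cvgMl; apply: cvg_near_cst.
  have Uy0 : 0 <= U w + y by rewrite addr_ge0.
  have [e1 /= e10 H1] := chain_right_constant (jd_chain Z lx i) w (U0 w).
  have [e2 /= e20 H2] := chain_right_constant (jd_chain Z lx i) w Uy0.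
  have gc := @cvg_grid_up R (U w) (U0 w).
  have /cvgrPdist_lt/(_ e1 e10) N1 := gc; have /cvgrPdist_lt/(_ e2 e20) N2 := gc.
  near=> n; have gU := @grid_up_gt R n (U w) (U0 w).
  have Y1 : Y i (grid_up n (U w)) w = Y i (U w) w by apply: H1 => //; near: n.
  have Y2 : Y i (grid_up n (U w) + y) w = Y i (U w + y) w.
    apply: H2; last by rewrite ltrD2r.
    by rewrite /ball_/= opprD addrACA subrr addr0; near: n.
  have E : phase_event y (fun w => grid_up n (U w)) w = phase_event y U w.
    by rewrite /phase_event/= Y1 Y2.
  have -> // : \1_(phase_event y (fun w => grid_up n (U w))) w = \1_(phase_event y U) w :> R.
  rewrite !indicE; have [H|H] := pselect (phase_event y U w).
    by rewrite !mem_set// E.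
  by rewrite !memNset// E.
Unshelve. all: end_near. Qed.

Lemma phase_event_integral y : 0 <= y ->
  (\int[P x]_(w in phase_event y U) (jump_weight w)%:E =
   (survival B k y)%:E * \int[P x]_(w in phase_event 0 U) (jump_weight w)%:E)%E.
Proof.
move=> y0; have Cy := phase_event_integral_cvg y0; have C0 := phase_event_integral_cvg (lexx 0).
rewrite -(cvg_lim _ Cy)//; apply: cvg_lim => //.
have H n : (\int[P x]_(w in phase_event y (fun w => grid_up n (U w))) (jump_weight w)%:E =
    (survival B k y)%:E *
    \int[P x]_(w in phase_event 0 (fun w => grid_up n (U w))) (jump_weight w)%:E)%E.
  by rewrite !grid_phase_event_integral// survival0 mul1e.
under eq_fun do rewrite H.
by apply: cvgeZl.
Qed.

(** The chain is in phase [k] with probability 0 at every grid time, and the events at rounded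
    clocks approximate the event in question. *)
Lemma phase_event_integral_unreachable : ~ reachable beta B k ->
  (\int[P x]_(w in phase_event 0 U) (jump_weight w)%:E = 0)%E.
Proof.
move=> nR; have C0 := phase_event_integral_cvg (lexx 0).
rewrite -(cvg_lim _ C0)//; apply: cvg_lim => //.
rewrite (_ : (fun n => _) = fun=> 0%E); first exact: cvg_cst.
apply/funext => n; rewrite (grid_phase_event_integral _ (lexx 0)) survival0 mul1e.
rewrite eseries0// => j _ _; rewrite (_ : phase_law _ _ _ _ = 0) ?mul0e//.
apply/eqP; apply: contrapT => /negP H; apply: nR.
by exists (j.+1%:R / n.+1%:R) => //; rewrite divr_ge0.
Qed.

End Freezing.

(** * The overshoot law *)

Section DensityMeasure.
Context {R : realType} (f : R -> R).
Hypotheses (mf : measurable_fun setT f) (f0 : forall t, 0 < t -> 0 <= f t).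

(** Cut to the positive half-line, where [f] is known to be nonnegative and where the overshoots of
    jumps live. *)
Definition density_measure (D : set R) : \bar R :=
  (\int[lebesgue_measure]_(t in D `&` (`]0%R, +oo[%classic : set R)) (f t)%:E)%E.

Let fpos (D : set R) t : (D `&` (`]0, +oo[%classic : set R)) t -> (0 <= (f t)%:E)%E.
Proof. by move=> [_ /=]; rewrite in_itv/= andbT => t0; rewrite lee_fin f0. Qed.

Let density_measure0 : density_measure set0 = 0%E.
Proof. by rewrite /density_measure set0I integral_set0. Qed.

Let density_measure_ge0 D : (0 <= density_measure D)%E.
Proof. by apply: integral_ge0 => t; exact: fpos. Qed.

Let density_measure_sigma_additive : semi_sigma_additive density_measure.
Proof.
move=> D mD tD mUD; rewrite /density_measure setI_bigcupl ge0_integral_bigcup//.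
- apply: is_cvg_nneseries => n _ _; apply: integral_ge0 => t; exact: fpos.
- by move=> n; apply: measurableI; [exact: mD|exact: measurable_itv].
- by apply/measurable_EFinP; exact: measurable_funTS.
- by move=> t [n _]; exact: fpos.
- exact: trivIset_setIr.
Qed.

HB.instance Definition _ := isMeasure.Build _ _ _ density_measure
  density_measure0 density_measure_ge0 density_measure_sigma_additive.

Definition measure_of_density : {measure set R -> \bar R} := density_measure.

End DensityMeasure.

Lemma integral_ae_set {R : realType} {d : measure_display} {Om : measurableType d}
    (m : {measure set Om -> \bar R}) (A1 A2 : set Om) (f1 f2 : Om -> R) :
  measurable A1 -> measurable A2 -> measurable_fun setT f1 -> measurable_fun setT f2 ->
  {ae m, forall w, \1_A1 w * f1 w = \1_A2 w * f2 w} ->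
  (\int[m]_(w in A1) (f1 w)%:E = \int[m]_(w in A2) (f2 w)%:E)%E.
Proof.
move=> mA1 mA2 mf1 mf2 H.
have I A (f : Om -> R) : (\int[m]_(w in A) (f w)%:E = \int[m]_w (\1_A w * f w)%:E)%E.
  rewrite [LHS]integral_mkcond; apply: eq_integral => w _.
  by rewrite patchE indicE; case: (w \in A); rewrite ?mul1r ?mul0r.
rewrite (I A1) (I A2); apply: ae_eq_integral => //.
- by apply/measurable_EFinP; apply: measurable_funM => //; exact: measurable_indic.
- by apply/measurable_EFinP; apply: measurable_funM => //; exact: measurable_indic.
- by apply: filterS H => w Hw _; rewrite Hw.
Qed.

Section Overshoot.
Context {R : realType} {d : measure_display} {Om : measurableType d} {K : nat}.
Context {l lam : R} {c sigma : R -> R} {beta : 'rV[R]_K} {B : 'M[R]_K}.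
Variable Z : @jump_diffusion R d Om K l lam c sigma beta B.
Hypothesis B_sub : nonsingular_subgenerator B.
Local Notation X := (jd_X Z).
Local Notation P := (jd_P Z).
Local Notation N := (jd_N Z).
Local Notation Y := (jd_Y Z).
Local Notation F := (jd_F Z).

Lemma optional_hitting S : measurable S -> (forall w, right_open S (X ^~ w)) ->
  optional_time F (hitting S X).
Proof.
move=> mS oS; split=> [w|t t0]; first exact: (@first_time_ge0 R S (X ^~ w)).
have [sF _ mF] := jd_filtration Z.
apply: hitting_lt_measurable => //; first exact: sF.
move=> s s0 st; apply: (mF s t s0 (ltW st)); exact: (jd_adapted Z).
Qed.

Lemma optional_T_below a : optional_time F (T_below Z a).
Proof.
apply: optional_hitting => [|w].
  by rewrite (_ : [set z | z < a] = `]-oo, a[%classic)//; apply/seteqP; split => z /=; rewrite in_itv.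
by apply: first_time_open; [exact: open_lt|exact: X_right_continuous].
Qed.

Lemma optional_T_above b : optional_time F (T_above Z b).
Proof.
apply: optional_hitting => [|w].
  by rewrite (_ : [set z | b < z] = `]b, +oo[%classic)//; apply/seteqP; split => z /=; rewrite in_itv/= andbT.
by apply: first_time_open; [exact: open_gt|exact: X_right_continuous].
Qed.

Variables (x : R) (lx : l < x).
Hypothesis aeR : {ae P x, forall w, regular Z x w}.
Variables (a : R) (la : l < a) (q : R) (q0 : 0 <= q).
Let oT : optional_time F (T_below Z a) := optional_T_below a.
Local Notation T := (T_below Z a).

Definition overshoot (w : Om) : R := a - X_at Z T w.

Lemma overshoot_measurable : measurable_fun setT overshoot.
Proof. by apply: measurable_funB => //; exact: (@X_at_measurable _ _ _ _ _ _ _ _ _ _ Z T oT). Qed.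

Variable k : 'I_K.

Definition jump_crossing : set Om :=
  [set w | [/\ (0 < T w < +oo)%E, X_at Z T w < a & crossing_phase Z a w = Some k]].

Definition positive_crossing : set Om := [set w | (0 < T w < +oo)%E /\ X_at Z T w < a].

Lemma positive_crossing_measurable : measurable positive_crossing.
Proof.
have mT := @optional_time_measurable _ _ _ _ _ _ _ _ _ _ Z T oT.
have m1 := emeasurable_fun_infty_o measurableT mT +oo%E.
have m2 := emeasurable_fun_o_infty measurableT mT 0%E.
have m3 : measurable (X_at Z T @^-1` `]-oo, a[).
  rewrite -[X in measurable X]setTI.
  exact: (@X_at_measurable _ _ _ _ _ _ _ _ _ _ Z T oT measurableT).
rewrite (_ : positive_crossing = (([set: Om] `&` [set w | (0 < T w)%E]) `&`
  ([set: Om] `&` [set w | (T w < +oo)%E])) `&` X_at Z T @^-1` `]-oo, a[).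
  by apply: measurableI => //; exact: measurableI.
rewrite !setTI; apply/seteqP; split => w /=; rewrite in_itv/=.
  by move=> [/andP[]].
by move=> [[T0 Too] Xa]; split=> //; apply/andP.
Qed.

Definition jump_index (w : Om) : nat := (N (fine (T w)) w).-1.

Lemma jump_index_measurable i : measurable (jump_index @^-1` [set i]).
Proof.
have H : measurable_fun setT (fun w => (N (fine (T w)) w)%:R : R).
  apply: (@measurable_eval R d Om (fun t w => (N t w)%:R) (fun w => fine (T w))).
  - move=> t t0 _ D mD; rewrite setTI.
    exact: (@N_measurable _ _ _ _ _ _ _ (jd_filtration Z) (jd_poisson Z lx) t
      [set n | D n%:R] t0).
  - by move=> w; exact: (@N_right_continuous _ _ _ _ _ _ _ _ _ _ Z x lx w).
  - apply/measurableT_comp => //.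
    exact: (@optional_time_measurable _ _ _ _ _ _ _ _ _ _ Z T oT).
  - by move=> w; apply: fine_ge0; exact: oT.1.
rewrite (_ : _ @^-1` _ = \bigcup_(n in [set n : nat | n.-1 = i])
    ((fun w => (N (fine (T w)) w)%:R : R) @^-1` [set n%:R])).
  apply: bigcup_measurable => n _; rewrite -[X in measurable X]setTI; exact: H.
apply/seteqP; split => w /=; first by move=> E; exists (N (fine (T w)) w).
by move=> [n <- /= /eqP]; rewrite eqr_nat => /eqP E; rewrite /jump_index E.
Qed.

Let V0 (w : Om) : R := Num.max 0 (value_before Z (fun w => fine (T w)) w - a).

Lemma crossing_phaseE w : (0 < T w < +oo)%E ->
  crossing_phase Z a w = Y (jump_index w) (V0 w) w.
Proof.
move=> /andP[T0 Too]; rewrite /crossing_phase -/(jump_index w); congr (Y _ _ w).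
have [t t0 Tt] : exists2 t, 0 <= t & T w = t%:E by exact: (@first_time_fine R _ (X ^~ w) Too).
rewrite Tt lte_fin in T0.
rewrite /V0 /value_before Tt/= gt_eqF// /X_before Tt/= max_r// subr_ge0.
by apply: left_limit_ge => // s s0 st; exact: before_T_below Tt s0 st.
Qed.

Let V0_ge0 w : 0 <= V0 w. Proof. by rewrite le_max lexx. Qed.

Let mV0 : measurable_fun setT V0.
Proof.
apply: measurable_maxr => //; apply: measurable_funB => //.
apply: value_before_measurable => [|w]; last by apply: fine_ge0; exact: oT.1.
apply/measurableT_comp => //.
exact: (@optional_time_measurable _ _ _ _ _ _ _ _ _ _ Z T oT).
Qed.

Lemma jump_crossing_measurable : measurable jump_crossing.
Proof.
rewrite (_ : jump_crossing = \bigcup_i (positive_crossing `&` jump_index @^-1` [set i] `&`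
    [set w | Y i (V0 w) w = Some k])).
  apply: bigcup_measurable => i _; apply: measurableI.
    by apply: measurableI; [exact: positive_crossing_measurable|exact: jump_index_measurable].
  exact: (@phase_at_measurable _ _ _ _ _ _ _ _ _ _ Z x lx i V0 [set Some k]).
apply/seteqP; split => w.
  by move=> [H1 H2 H3]; exists (jump_index w) => //; split => //=; rewrite -crossing_phaseE.
move=> [i _ [[[H1 H2] iE] YE]]; have {}iE : jump_index w = i := iE.
by split=> //; rewrite crossing_phaseE// iE.
Qed.

Let event i y : set Om :=
  jump_crossing `&` overshoot @^-1` (`]y, +oo[%classic : set R) `&` jump_index @^-1` [set i].

(** Before [T] the path is at least [a], hence so is its left limit, and the truncated clock equals
    the true distance to [a]. *)
Lemma jump_crossing_data i t w : regular Z x w -> jump_time Z i w = t%:E ->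
  (t%:E <= T w)%E -> [/\ 0 < t, a <= left_limit Z t w,
    overshoot_clock Z i a w = left_limit Z t w - a &
    X t w = left_limit Z t w - jump_size Y i w].
Proof.
move=> rw it tT; have t0 := jump_time_gt0 lx it.
have aV : a <= left_limit Z t w.
  apply: left_limit_ge => // s s0 st; rewrite leNgt; apply/negP => Xa.
  have Ts : (T w <= s%:E)%E by exact: (@first_time_le _ _ (X ^~ w) s s0 Xa).
  by have := le_trans tT Ts; rewrite lee_fin leNgt st.
split => //.
  by rewrite /overshoot_clock /pre_jump_value /value_before it/= gt_eqF// max_r ?subr_ge0.
have [Nt [s /andP[s0 st] Ns]] := jump_time_jumps lx rw it.
have tE : (t%:E <= T_exit Z w)%E by apply: le_trans tT _; exact: T_below_le_exit.
have [[[v /andP[v0 vt] Nv] _]|[j [Nj _] ->]] := regular_path rw t0 tE.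
  by have := jump_time_before it v0 vt; rewrite Nv Nt ltnn.
by move: Nj; rewrite Nt => -[->].
Qed.

Lemma jump_size_gt w i v : regular Z x w -> 0 <= v -> v < jump_size Y i w <-> Y i v w <> None.
Proof.
move=> rw; apply: absorption_gtP; first exact: (regular_right rw).
  exact: (regular_absorbed rw).
exact: (regular_finite rw).
Qed.

(** This trades a crossing by jump [i] for a condition on the chain [i] read at the clock given by
    the pre-jump value. Conversely, a chain that outlives the clock pushes the path below [a], which
    forces [T] to be the time of that jump. *)
Lemma jump_crossing_weightE i y w : regular Z x w -> 0 <= y ->
  \1_(event i y) w * discount q (T w) =
  \1_(phase_event Z i k y (overshoot_clock Z i a)) w * jump_weight Z T i q w.
Proof.
move=> rw y0.
have [A|nA] := pselect (event i y w).
  have [[[/andP[T0 Too] Xa cr] ov] iE] := A.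
  have [t t0 Tt] : exists2 t, 0 <= t & T w = t%:E by exact: (@first_time_fine R _ (X ^~ w) Too).
  rewrite Tt lte_fin in T0; rewrite /X_at Tt/= in Xa.
  have [j jf Xt] := T_below_jump rw la Tt T0 Xa.
  have ji : j = i by rewrite -iE /jump_index Tt/= (proj1 jf).
  rewrite ji in jf Xt; have it := jumps_from_time lx T0 jf.
  have tT : (t%:E <= T w)%E by rewrite Tt.
  have [_ aV UE _] := jump_crossing_data rw it tT.
  have crE : Y i (left_limit Z t w - a) w = Some k.
    rewrite -cr crossing_phaseE ?Tt ?lte_fin ?T0 ?ltry// iE; congr (Y i _ w).
    by rewrite /V0 /value_before Tt/= gt_eqF// max_r// subr_ge0.
  have ph : phase_event Z i k y (overshoot_clock Z i a) w.
    rewrite /phase_event/= UE; split => //.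
    apply/(jump_size_gt i rw); first by rewrite addr_ge0// subr_ge0.
    have : y < overshoot w by move: ov; rewrite /= in_itv/= andbT.
    rewrite /overshoot /X_at Tt/= Xt -subr_gt0 => H; rewrite -subr_gt0.
    by rewrite [ltRHS](_ : _ = a - (left_limit Z t w - jump_size Y i w) - y)//; ring.
  have aj : at_jump_event Z T i w by rewrite /at_jump_event/= it.
  by rewrite /jump_weight !indicE !mem_set// !mul1r Tt it.
rewrite [LHS](_ : _ = 0); last by rewrite indicE memNset// mul0r.
apply/esym; rewrite /jump_weight.
have [ph|nph] := pselect (phase_event Z i k y (overshoot_clock Z i a) w); last first.
  by rewrite indicE memNset// mul0r.
have [aj|naj] := pselect (at_jump_event Z T i w); last first.
  by rewrite [X in _ * (X * _)]indicE memNset// mul0r mulr0.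
case it : (jump_time Z i w) => [t| |]; rewrite /= ?mulr0//; exfalso; apply: nA.
rewrite /at_jump_event/= it in aj.
have [t0 aV UE Xt] := jump_crossing_data rw it aj.
move: ph; rewrite /phase_event/= UE => -[ph1 ph2].
have Cy : left_limit Z t w - a + y < jump_size Y i w.
  by apply/(jump_size_gt i rw) => //; rewrite addr_ge0// subr_ge0.
have Xa : X t w < a by rewrite Xt; lra.
have Tt : T w = t%:E.
  apply: le_anti; rewrite aj andbT.
  exact: (@first_time_le _ _ (X ^~ w) t (ltW t0) Xa).
have [Nt _] := jump_time_jumps lx rw it.
have iE : jump_index w = i by rewrite /jump_index Tt/= Nt.
split => //; split; last first.
  by rewrite /= in_itv/= andbT /overshoot /X_at Tt/= Xt; lra.
split; [by rewrite Tt lte_fin t0 ltry|by rewrite /X_at Tt|].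
rewrite crossing_phaseE ?Tt ?lte_fin ?t0 ?ltry// iE -ph1; congr (Y i _ w).
by rewrite /V0 /value_before Tt/= gt_eqF// max_r// subr_ge0.
Qed.

Let event_measurable i y : measurable (event i y).
Proof.
apply: measurableI; last exact: jump_index_measurable.
apply: measurableI; first exact: jump_crossing_measurable.
by rewrite -[X in measurable X]setTI; exact: (overshoot_measurable measurableT).
Qed.

Let mdisc : measurable_fun setT (fun w => discount q (T w)).
Proof.
apply: (@discount_measurable _ _ _ q T) => [|w]; last exact: oT.1.
exact: (@optional_time_measurable _ _ _ _ _ _ _ _ _ _ Z T oT).
Qed.

(** Crossings are sorted by the index of the jump, after which each term concerns a single chain. *)
Lemma overshoot_tail y : 0 <= y ->
  (\int[P x]_(w in jump_crossing `&` overshoot @^-1` (`]y, +oo[%classic : set R)) (discount q (T w))%:E =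
   \sum_(0 <= i <oo) \int[P x]_(w in phase_event Z i k y (overshoot_clock Z i a))
      (jump_weight Z T i q w)%:E)%E.
Proof.
move=> y0.
have -> : jump_crossing `&` overshoot @^-1` (`]y, +oo[%classic : set R) = \bigcup_i event i y.
  apply/seteqP; split => w; first by move=> H; exists (jump_index w).
  by move=> [i _ []].
rewrite ge0_integral_bigcup//.
- apply: eq_eseriesr => i _; apply: integral_ae_set => //.
  + apply: (@phase_event_measurable _ _ _ _ _ _ _ _ _ _ Z x lx i k y (overshoot_clock Z i a) y0).
      apply: measurable_maxr => //; apply: measurable_funB => //.
      exact: (pre_jump_value_measurable Z lx i).
    by move=> w; rewrite le_max lexx.
  + exact: (@jump_weight_measurable _ _ _ _ _ _ _ _ _ _ Z x lx T oT).
  + by apply: filterS aeR => w rw; exact: jump_crossing_weightE.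
- by apply/measurable_EFinP; exact: measurable_funTS.
- by move=> w _; rewrite lee_fin discount_ge0.
- apply/trivIsetP => i j _ _ /eqP ij; apply/seteqP; split => w //=.
  by move=> [[_ /= Ei] [_ /= Ej]]; apply: ij; rewrite -Ei -Ej.
Qed.

Definition crossing_mass : \bar R :=
  (\int[P x]_(w in jump_crossing) (discount q (T w))%:E)%E.

Lemma jump_crossing_overshoot y : y <= 0 ->
  jump_crossing `&` overshoot @^-1` (`]y, +oo[%classic : set R) = jump_crossing.
Proof.
move=> y0; apply/seteqP; split => w; first by case.
move=> H; split => //; case: H => _ Xa _.
by rewrite /overshoot/= in_itv/= andbT (le_lt_trans y0)// subr_gt0.
Qed.

Lemma overshoot_tail_survival y : 0 <= y ->
  (\int[P x]_(w in jump_crossing `&` overshoot @^-1` (`]y, +oo[%classic : set R)) (discount q (T w))%:E =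
   (survival B k y)%:E * crossing_mass)%E.
Proof.
move=> y0; rewrite overshoot_tail//.
rewrite /crossing_mass -(jump_crossing_overshoot (lexx 0)) overshoot_tail//.
rewrite -nneseriesZl; last first.
  move=> i _; apply: integral_ge0 => w _; rewrite lee_fin; exact: jump_weight_ge0.
by apply: eq_eseriesr => i _; rewrite (phase_event_integral lx aeR oT _ q0).
Qed.

Lemma crossing_mass_unreachable : ~ reachable beta B k -> crossing_mass = 0%E.
Proof.
move=> nR; rewrite /crossing_mass -(jump_crossing_overshoot (lexx 0)) overshoot_tail//.
by rewrite eseries0// => i _ _; rewrite (phase_event_integral_unreachable lx aeR oT).
Qed.

Lemma crossing_mass_fin : crossing_mass \is a fin_num.
Proof.
rewrite ge0_fin_numE; last by apply: integral_ge0 => w _; rewrite lee_fin discount_ge0.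
apply: (@le_lt_trans _ _ (P x jump_crossing)); last first.
  have H : (P x jump_crossing <= P x setT)%E.
    by apply: le_measure; rewrite ?inE//; exact: jump_crossing_measurable.
  by apply: le_lt_trans H _; rewrite prob_kernel ltry.
rewrite -[leRHS]mul1e -integral_cst; last exact: jump_crossing_measurable.
apply: ge0_le_integral => //.
- exact: jump_crossing_measurable.
- by move=> w _; rewrite lee_fin discount_ge0.
- by apply/measurable_EFinP; exact: measurable_funTS.
- by move=> w _; rewrite lee_fin discount_le1//; exact: oT.1.
Qed.

(** Two finite measures with the same tails: for y >= 0, the tail of either is the crossing mass
    times [survival B k y]. *)
Lemma overshoot_law (D : set R) : measurable D -> D `<=` (`]0, +oo[%classic : set R) ->
  (\int[P x]_(w in jump_crossing `&` overshoot @^-1` D) (discount q (T w))%:E =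
   crossing_mass * \int[lebesgue_measure]_(t in D) (exit_density B k t)%:E)%E.
Proof.
move=> mD D0.
have mO := overshoot_measurable.
have mD' A : measurable A -> measurable (jump_crossing `&` overshoot @^-1` A).
  move=> mA; apply: measurableI; first exact: jump_crossing_measurable.
  by rewrite -[X in measurable X]setTI; exact: (mO measurableT).
have [rk|nrk] := pselect (reachable beta B k); last first.
  rewrite crossing_mass_unreachable// mul0e; apply/eqP; rewrite eq_le.
  apply/andP; split; last by apply: integral_ge0 => w _; rewrite lee_fin discount_ge0.
  rewrite -(crossing_mass_unreachable nrk) /crossing_mass; apply: ge0_subset_integral => //.
  - exact: mD'.
  - exact: jump_crossing_measurable.
  - by apply/measurable_EFinP; exact: measurable_funTS.
  - by move=> w _; rewrite lee_fin discount_ge0.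
have ge0 := reachable_expmx_ge0 (jd_chain Z lx 0) rk.
have f0 t : 0 < t -> 0 <= exit_density B k t by move=> /ltW; exact: exit_density_ge0.
have mf : measurable_fun setT (exit_density B k).
  exact: continuous_measurable_fun (@continuous_exit_density R K B k).
pose w1 w := \1_jump_crossing w * discount q (T w).
have mw1 : measurable_fun setT w1.
  by apply: measurable_funM => //; exact/measurable_indic/jump_crossing_measurable.
have w10 w : 0 <= w1 w by rewrite mulr_ge0// discount_ge0.
have w11 w : w1 w <= 1.
  by rewrite mulr_ile1 ?indic_le1 ?discount_ge0// discount_le1//; exact: oT.1.
pose L1 := weighted_law P mO mw1 w10 x.
have cm0 : 0 <= fine crossing_mass.
  by apply: fine_ge0; apply: integral_ge0 => w _; rewrite lee_fin discount_ge0.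
pose L2 := mscale (NngNum cm0) (measure_of_density mf f0).
have E1 A : measurable A -> L1 A = (\int[P x]_(w in jump_crossing `&` overshoot @^-1` A) (discount q (T w))%:E)%E.
  move=> mA; rewrite /L1 weighted_lawE// [RHS]integral_mkcondl; apply: eq_integral => w _.
  by rewrite patchE /w1 indicE; case: (w \in jump_crossing); rewrite ?mul1r ?mul0r.
have cmE : (fine crossing_mass)%:E = crossing_mass by rewrite fineK// crossing_mass_fin.
have E2 A : L2 A = (crossing_mass * \int[lebesgue_measure]_(t in A `&` (`]0%R, +oo[%classic : set R)) (exit_density B k t)%:E)%E.
  by rewrite -cmE.
rewrite -E1//.
transitivity (L2 D); last by rewrite E2 (setIidl D0).
apply: real_measure_unique_gt => //; first exact: weighted_law_lty.
move=> y; rewrite E1//; apply: etrans (esym (E2 _)).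
have [y0|y0] := leP y 0.
  rewrite jump_crossing_overshoot// (_ : _ `&` _ = `]0, +oo[%classic); last first.
    by apply/seteqP; split => t /=; rewrite !in_itv/= !andbT; [case|move=> t0; rewrite (le_lt_trans y0)].
  by rewrite integral_exit_density// survival0 mule1.
rewrite overshoot_tail_survival ?ltW// (_ : _ `&` _ = `]y, +oo[%classic); last first.
  by apply/seteqP; split => t /=; rewrite !in_itv/= !andbT; [case|move=> yt; rewrite yt (lt_trans y0)].
by rewrite integral_exit_density ?ltW// muleC.
Qed.

End Overshoot.

(** * A fatal first jump *)

(** A path that has reached ]-oo, l] is frozen, so this closed set is never left. *)
Lemma absorbed_right_open {R : realType} (l : R) (p : R -> R) :
  absorbed_path l p -> right_open [set z | z <= l] p.
Proof.
move=> ap t t0 /= pt; near=> u.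
by rewrite (ap t u)//; near: u; exact: nbhs_right_ge.
Unshelve. all: end_near. Qed.

Section FatalJump.
Context {R : realType} {d : measure_display} {Om : measurableType d} {K : nat}.
Context {l lam : R} {c sigma : R -> R} {beta : 'rV[R]_K} {B : 'M[R]_K}.
Variable Z : @jump_diffusion R d Om K l lam c sigma beta B.
Hypotheses (lam0 : 0 < lam) (beta_prob : probability_row beta)
  (B_sub : nonsingular_subgenerator B).
Local Notation X := (jd_X Z).
Local Notation P := (jd_P Z).
Local Notation N := (jd_N Z).
Local Notation Y := (jd_Y Z).
Local Notation F := (jd_F Z).
Variables (x b : R) (lx : l < x) (xb : x < b).
Hypothesis aeR : {ae P x, forall w, regular Z x w}.
Let lb : l < b := lt_trans lx xb.
Let oT : optional_time F (T_above Z b) := optional_T_above Z b.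
Local Notation T := (T_above Z b).
Let P1 : P x setT = 1%E := prob_kernel x.
Let pN := jd_poisson Z lx.

(* Before time [1 / j.+1] there is neither a jump nor a passage above [b]; a jump
   just afterwards has positive probability. *)
Definition quiet (j : nat) : set Om :=
  [set w | N j.+1%:R^-1 w = 0%N /\ ((j.+1%:R^-1)%:E <= T w)%E].

Lemma quiet_measurable j : measurable (quiet j).
Proof.
apply: measurableI; first exact: (N_measurable (jd_filtration Z) pN [set 0%N]).
rewrite -[X in measurable X]setTI; apply: measurable_lee => //.
exact: (@optional_time_measurable _ _ _ _ _ _ _ _ _ _ Z T oT).
Qed.

(** By right continuity of [N] and [X] at time 0 almost every path is quiet for some j, so these
    events cannot all be null. *)
Lemma quiet_prob : exists j, (0 < P x (quiet j))%E.
Proof.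
apply: contrapT => nq.
have q0 j : P x (quiet j) = 0%E.
  apply: le_anti; rewrite measure_ge0 andbT leNgt; apply/negP => H; apply: nq.
  by exists j.
have Q0 : P x (\bigcup_j quiet j) = 0%E.
  apply/eqP; rewrite -measure_le0.
  apply: le_trans (generalized_Boole_inequality _ _ _) _.
  - exact: quiet_measurable.
  - by apply: bigcup_measurable => j _; exact: quiet_measurable.
  - by rewrite eseries0// => j _ _; exact: q0.
have aeF : {ae P x, forall w, False}.
  apply: filterS (ae_and aeR (ae_null (P := P x) (Q := fun w => ~ (\bigcup_j quiet j) w)
    (bigcup_measurable (fun j _ => quiet_measurable j)) Q0 (fun w => @contrapT _))) => w [rw nQ].
  apply: nQ.
  have [e1 /= e10 H1] := N_right_constant pN w (lexx 0).
  have Xb : X 0 w < b by rewrite (regular_start rw).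
  have oS : open [set z : R | z < b] by exact: open_lt.
  have [e2 /= e20 H2] := @first_time_open R [set z | z < b] (X ^~ w) oS (@X_right_continuous _ _ _ _ _ _ _ _ _ _ Z w) 0 (lexx 0) Xb.
  have [j je] : exists j : nat, (Num.min e1 e2)^-1 < j.+1%:R.
    by exists (Num.truncn (Num.min e1 e2)^-1); exact: truncnS_gt.
  have m0 : 0 < Num.min e1 e2 by rewrite lt_min e10.
  have je' : j.+1%:R^-1 < Num.min e1 e2 by rewrite -[ltRHS]invrK ltf_pV2 ?posrE ?invr_gt0 ?ltr0n.
  move: je'; rewrite lt_min => /andP[j1 j2].
  have j0 : 0 < j.+1%:R^-1 :> R by rewrite invr_gt0 ltr0n.
  exists j => //; split.
    by rewrite H1 ?(N0 pN)//= /ball_/= sub0r normrN gtr0_norm.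
  apply/ereal_infP => _ [t [t0 /= bt] <-]; rewrite lee_fin leNgt; apply/negP => tj.
  move: bt; rewrite ltNge ltW//; move: t0; rewrite le_eqVlt => /orP[/eqP <-//|t0].
  by apply: H2 => //=; rewrite /ball_/= sub0r normrN gtr0_norm// (lt_trans tj).
have := aeF; rewrite /almost_everywhere => -[A [mA A0 HA]].
have : A = setT by apply/seteqP; split => // w _; exact: HA.
by move=> AT; move: A0; rewrite AT P1 => /eqP; rewrite onee_eq0.
Qed.

Local Notation gridsum := (grid_sum Z T 0 0 (fun=> 1)).

(** A bound uniform in [n]. At each grid point up to h = 1 / (j + 1) the past event contains
    [quiet j] and is independent of the next increment. The cells cover ]0, h], so the probabilities
    of their increments add up to at least P(N_h >= 1). *)
Lemma grid_sum_lower j n : (0 < n)%N ->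
  (P x (quiet j) * P x (increment Z 0 j.+1%:R^-1) <= \int[P x]_w (gridsum n w)%:E)%E.
Proof.
move=> n0; pose h : R := j.+1%:R^-1.
have h0 : 0 < h by rewrite invr_gt0 ltr0n.
have h1 : h <= 1 by rewrite invf_le1 ?ltr0n// ler1n.
pose m := (Num.truncn (h * n.+1%:R)).+1.
pose t k : R := k%:R / n.+1%:R.
have t0 k : 0 <= t k by rewrite divr_ge0.
have tS k : t k < t k.+1 by rewrite ltr_pM2r ?invr_gt0 ?ltr0n// ltr_nat.
have hm : h <= t m by rewrite /t ler_pdivlMr ?ltr0n// ltW// truncnS_gt.
(* Covering [0, h] may take up to n + 2 cells, which are among the (n + 1)^2 available as soon as n
   >= 1. *)
have sq k : (0 < k)%N -> (k.+2 <= k.+1 * k.+1)%N.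
  case: k => [//|k] _; apply: (@leq_trans (k.+2 * 2)); last by rewrite leq_mul2l.
  by rewrite muln2 -addnn !addSn !addnS !ltnS leqW// leq_addr.
have mn : (m <= n.+1 * n.+1)%N.
  apply: (@leq_trans n.+2); last exact: sq.
  rewrite ltnS -(@ler_nat R); apply: le_trans (_ : h * n.+1%:R <= _).
    by have /andP[] := truncn_itv (mulr_ge0 (ltW h0) (ler0n R n.+1)).
  by rewrite ler_piMl.
have th k : (k < m)%N -> t k <= h.
  rewrite ltnS => km; rewrite /t ler_pdivrMr ?ltr0n//.
  apply: (@le_trans _ _ (Num.truncn (h * n.+1%:R))%:R); first by rewrite ler_nat.
  by have /andP[] := truncn_itv (mulr_ge0 (ltW h0) (ler0n R n.+1)).
have minc k : measurable (increment Z (t k) (t k.+1)).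
  by apply: (increment_measurable (jd_filtration Z) pN [set n | (1 <= n)%N]) => //; exact: ltW.
have mev k := @grid_event_measurable _ _ _ _ _ _ _ _ _ _ Z x lx T oT 0%N n k.
(* A trivial chain event, of probability 1, leaves the mere independence of past and increment. *)
have PE k : P x (grid_event Z T 0 n k) = (P x (grid_past Z T 0 n k) * P x (increment Z (t k) (t k.+1)))%E.
  have := @past_future_prob _ _ _ _ _ _ _ _ _ _ Z x lx 0 0 setT setT (lexx 0) (lexx 0) 1 _ (t k) (t k.+1)
    _ (t0 k) (tS k) (@grid_past_F _ _ _ _ _ _ _ _ _ _ Z x lx T oT 0%N n k).
  move=> H; apply: (proj2 (H _)) => i; rewrite /mark_event !preimage_setT setIT; exact: P1.
have qp k : (k < m)%N -> (P x (quiet j) <= P x (grid_past Z T 0 n k))%E.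
  move=> km; apply: le_measure; rewrite ?inE//; first exact: quiet_measurable.
    exact: (past_time_measurable (t0 k) (@grid_past_F _ _ _ _ _ _ _ _ _ _ Z x lx T oT 0%N n k)).
  move=> w [Nw Tw]; split; last by apply: le_trans Tw; rewrite lee_fin th.
  by apply/eqP; rewrite -leqn0 -Nw; apply: (N_mono pN); rewrite ?th.
apply: (@le_trans _ _ (\sum_(k < m) P x (quiet j) * P x (increment Z (t k) (t k.+1)))%E).
  rewrite -ge0_sume_distrr//; apply: lee_wpmul2l => //.
  apply: (@le_trans _ _ (P x (\big[setU/set0]_(k < m) increment Z (t k) (t k.+1)))).
    apply: le_measure; rewrite ?inE.
    - by apply: (increment_measurable (jd_filtration Z) pN [set n | (1 <= n)%N]) => //; exact: ltW.
    - by apply: bigsetU_measurable => k _; exact: minc.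
    - move=> w Iw; rewrite -(bigcup_mkord _ (fun k => increment Z (t k) (t k.+1))).
      apply: contrapT => nI; have Nt k : (k <= m)%N -> N (t k) w = 0%N.
        elim: k => [|k IH] km; first by rewrite /t mul0r (N0 pN).
        apply/eqP; rewrite -leqn0 leqNgt; apply/negP => Nk; apply: nI; exists k => //.
        by rewrite /increment/= (IH (ltnW km)) subn0.
      have := N_mono pN w (ltW h0) hm; rewrite (Nt m (leqnn _)) leqn0 => /eqP Nh.
      by move: Iw; rewrite /increment/= -/h Nh.
  apply: le_trans (Boole_inequality (P x) (A := fun k : nat => _) (fun k _ => minc k)) _.
  by [].
apply: (@le_trans _ _ (\sum_(k < m) P x (grid_event Z T 0 n k))%E).
  by apply: lee_sum => k _; rewrite PE; apply: lee_wpmul2r => //; exact: qp.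
have -> : (\int[P x]_w (gridsum n w)%:E = \sum_(k < n.+1 * n.+1) P x (grid_event Z T 0 n k))%E.
  transitivity (\int[P x]_w \sum_(k < n.+1 * n.+1) (\1_(grid_event Z T 0 n k) w)%:E)%E.
    apply: eq_integral => w _; rewrite sumEFin; congr (_%:E); apply: eq_bigr => k _.
    by rewrite /grid_term oppr0 mul0r expR0 !mulr1.
  rewrite ge0_integral_sum//.
  - by apply: eq_bigr => k _; rewrite integral_indic// setIT.
  - by move=> k; apply/measurable_EFinP; exact: measurable_indic.
rewrite -!(big_mkord xpredT (fun k => P x (grid_event Z T 0 n k))).
rewrite [leRHS](big_cat_nat _ mn)//= leeDl// sume_ge0//.
Qed.

Lemma first_jump_before_prob : (0 < \int[P x]_w (jump_weight Z T 0 0 w)%:E)%E.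
Proof.
have [j qj] := quiet_prob.
have j0 : 0 < j.+1%:R^-1 :> R by rewrite invr_gt0 ltr0n.
have incj : (0 < P x (increment Z 0 j.+1%:R^-1))%E.
  exact: (increment_gt0_prob P1 (jd_filtration Z) lam0 pN (lexx 0) j0).
have pos : (0 < P x (quiet j) * P x (increment Z 0 j.+1%:R^-1))%E by rewrite mule_gt0.
apply: lt_le_trans pos _.
have c1 : continuous (fun _ : R => 1 : R) by move=> y; exact: cvg_cst.
have := @grid_integral_cvg _ _ _ _ _ _ _ _ _ _ Z x lx T oT 0%N 0 (lexx 0) (fun=> 1) c1
  (fun=> ler01) (fun=> lexx 1) aeR setT measurableT.
have -> : (\int[P x]_w (at_jump Z T 0 0 (fun=> 1) w)%:E = \int[P x]_w (jump_weight Z T 0 0 w)%:E)%E.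
  by apply: eq_integral => w _; rewrite /at_jump mulr1.
move=> C; rewrite -(cvg_lim _ C)//; apply: lime_ge; first by apply/cvg_ex; eexists; exact: C.
by exists 1%N => // n /= n1; exact: grid_sum_lower.
Qed.

Lemma not_absorbed_uniform t : 0 <= t -> exists2 p : R, 0 < p &
  forall i, P x (mark_event Z t t (~` [set None]) (~` [set None]) i) = p%:E.
Proof.
move=> t0; exists (\sum_i beta 0 i * survival B i t).
  rewrite -lte_fin -(not_absorbed_prob (jd_chain Z lx 0) t0).
  exact: (not_absorbed_gt0 (jd_chain Z lx 0) beta_prob B_sub t0).
by move=> i; rewrite /mark_event setIid -(not_absorbed_prob (jd_chain Z lx i) t0).
Qed.

(* A chain alive at time [b - l] makes a jump larger than [b - l], which leads
   from [b] or below to [l] or below. *)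
Lemma fatal_jump w : regular Z x w ->
  mark_event Z (b - l) (b - l) (~` [set None]) (~` [set None]) 0 w ->
  0 < jump_weight Z T 0 0 w -> ~ (T w < T_exit Z w)%E.
Proof.
move=> rw [Yb _]; rewrite /jump_weight; have [aj|naj] := pselect (at_jump_event Z T 0 w); last first.
  by rewrite indicE memNset// mul0r ltxx.
rewrite indicE mem_set// mul1r; case it : (jump_time Z 0 w) => [t| |]; rewrite /= ?ltxx// => _ TE.
rewrite /at_jump_event/= it in aj.
have t0 := jump_time_gt0 lx it.
have tE : (t%:E <= T_exit Z w)%E by apply/ltW/(le_lt_trans aj).
have [Nt [s /andP[s0 st] Ns]] := jump_time_jumps lx rw it.
have Xt : X t w = left_limit Z t w - jump_size Y 0 w.
  have [[[v /andP[v0 vt] Nv] _]|[i [Ni _] ->]] := regular_path rw t0 tE.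
    by have := jump_time_before it v0 vt; rewrite Nv Nt.
  by move: Ni; rewrite Nt => -[<-].
have Vb : left_limit Z t w <= b.
  apply: left_limit_le => // u u0 ut; rewrite leNgt; apply/negP => bu.
  have : (T w <= u%:E)%E by exact: (@first_time_le _ _ (X ^~ w) u u0 bu).
  by move=> /(le_trans aj); rewrite lee_fin leNgt ut.
have C : b - l < jump_size Y 0 w.
  by apply/(jump_size_gt 0 rw) => //; rewrite subr_ge0 ltW.
have Xl : X t w <= l by rewrite Xt; lra.
have : (T_exit Z w <= t%:E)%E by exact: (@first_time_le _ _ (X ^~ w) t (ltW t0) Xl).
by move=> /(lt_le_trans TE); rewrite ltNge aj.
Qed.

Lemma T_above_exit_measurable : measurable [set w | (T w < T_exit Z w)%E].
Proof.
rewrite -[X in measurable X]setTI; apply: measurable_lte => //.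
  exact: (@optional_time_measurable _ _ _ _ _ _ _ _ _ _ Z T oT).
apply: measurable_hitting => [w|t t0].
  apply: absorbed_right_open => s t; exact: jd_absorbed.
rewrite (_ : [set z | z <= l] = `]-oo, l]%classic).
  by rewrite -[X in measurable X]setTI; exact: X_measurable.
by apply/seteqP; split => z /=; rewrite in_itv.
Qed.

(** The first jump occurs no later than the passage above [b] with positive probability and,
    independently, its chain is alive at time b - l; all such paths miss the event. *)
Lemma above_before_exit_lt1 : (P x [set w | (T w < T_exit Z w)%E] < 1)%E.
Proof.
have bl0 : 0 <= b - l by rewrite subr_ge0 ltW.
have [p p0 PE] := not_absorbed_uniform bl0.
have MW := mark_weight lx aeR oT 0 (lexx 0) bl0 bl0 (ltW p0) PE measurableT.
rewrite preimage_setT setIT in MW.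
set M := mark_event _ _ _ _ _ _ in MW.
have mM : measurable M by exact: (@mark_event_measurable _ _ _ _ _ _ _ _ _ _ Z x lx _ _ _ _ bl0 bl0).
have pos : (0 < \int[P x]_(w in M) (jump_weight Z T 0 0 w)%:E)%E.
  by rewrite MW mule_gt0// first_jump_before_prob.
pose A := [set w | (T w < T_exit Z w)%E].
have mA : measurable A := T_above_exit_measurable.
have le : (\int[P x]_(w in M) (jump_weight Z T 0 0 w)%:E <= P x (~` A))%E.
  rewrite -[leRHS]mul1e -integral_cst; last exact: measurableC.
  have mW := @jump_weight_measurable _ _ _ _ _ _ _ _ _ _ Z x lx T oT 0%N 0.
  rewrite (@integral_ae_set _ _ _ _ M (M `&` ~` A) (jump_weight Z T 0 0) (jump_weight Z T 0 0))//; last 2 first.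
  - by apply: measurableI => //; exact: measurableC.
  - apply: filterS aeR => w rw; rewrite !indicE.
    have [Mw|nM] := pselect (M w); last by rewrite !memNset// => -[].
    have [Aw|nA] := pselect (A w); last by rewrite !mem_set.
    rewrite [in RHS]memNset; last by case.
    rewrite mem_set// mul0r mul1r; apply: le_anti; rewrite jump_weight_ge0 andbT leNgt.
    by apply/negP => H; exact: (fatal_jump rw Mw H Aw).
  apply: (@le_trans _ _ (\int[P x]_(w in M `&` ~` A) 1)%E).
    apply: ge0_le_integral => //.
    - by apply: measurableI => //; exact: measurableC.
    - by move=> w _; rewrite lee_fin jump_weight_ge0.
    - by apply/measurable_EFinP; exact: measurable_funTS.
    - by move=> w _; rewrite lee_fin jump_weight_le1.
  have mMA : measurable (M `&` ~` A) by apply: measurableI => //; exact: measurableC.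
  apply: ge0_subset_integral => //; do ?[exact: measurableC | exact: subIsetr].
have := measure_split (P x) measurableT mA; rewrite !setTI P1 => E.
have PA : P x A \is a fin_num by exact: fin_measure.
have PC : P x (~` A) \is a fin_num by apply: fin_measure => //; exact: measurableC.
rewrite -/A; move: E (lt_le_trans pos le); rewrite -(fineK PA) -(fineK PC) -EFinD.
by move=> -[E]; rewrite !lte_fin => ?; lra.
Qed.

End FatalJump.

(** * Decomposition at the first exit from [a, b] *)

Section StoppedPath.
Context {R : realType} {d : measure_display} {Om : measurableType d} {K : nat}.
Context {l lam : R} {c sigma : R -> R} {beta : 'rV[R]_K} {B : 'M[R]_K}.
Variable Z : @jump_diffusion R d Om K l lam c sigma beta B.
Local Notation X := (jd_X Z).
Local Notation F := (jd_F Z).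
Implicit Types (S : set R) (t : R) (w : Om).

(** If the first time lies below both the second one and [t], a rational lies in between, and at a
    rational time the comparison is an event of the past. *)
Lemma past_hitting_lt S1 S2 : measurable S1 -> measurable S2 ->
  (forall w, right_open S1 (X ^~ w)) -> (forall w, right_open S2 (X ^~ w)) ->
  past F (hitting S1 X) [set w | (hitting S1 X w < hitting S2 X w)%E].
Proof.
move=> mS1 mS2 o1 o2; have [sF _ mF] := jd_filtration Z.
have T1 := @optional_hitting _ _ _ _ _ _ _ _ _ _ Z S1 mS1 o1; have T2 := @optional_hitting _ _ _ _ _ _ _ _ _ _ Z S2 mS2 o2.
split.
  rewrite -[X in measurable X]setTI; apply: measurable_lte => //.
    exact: (@optional_time_measurable _ _ _ _ _ _ _ _ _ _ Z _ T1).
  exact: (@optional_time_measurable _ _ _ _ _ _ _ _ _ _ Z _ T2).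
move=> t t0.
rewrite (_ : _ `&` _ = \bigcup_(r in [set r : rat | 0 <= ratr r :> R /\ ratr r < t])
   ([set w | (hitting S1 X w < (ratr r)%:E)%E] `&` ~` [set w | (hitting S2 X w < (ratr r)%:E)%E])).
  apply: sigma_algebra_bigcup_count => [|r [r0 rt]]; first exact: sF.
  apply: (sigma_algebra_closedI (sF t t0)).
    by apply: (mF _ _ r0 (ltW rt)); apply: T1.2.
  apply: (sigma_algebra_closedC (sF t t0)).
  by apply: (mF _ _ r0 (ltW rt)); apply: T2.2.
apply/seteqP; split => w /=; last first.
  move=> [r /= [r0 rt] [H1 /negP]]; rewrite -leNgt => H2; split.
    exact: lt_le_trans H2.
  by apply: lt_trans H1 _; rewrite lte_fin.
move=> [H12 H1t].
have [s s0 sE] := @first_time_fine R S1 (X ^~ w) (lt_le_trans H12 (leey _)).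
have {}sE : hitting S1 X w = s%:E := sE.
have [u us] : exists2 u : R, s < u & (u%:E <= hitting S2 X w)%E /\ u <= t.
  rewrite sE in H12 H1t; rewrite lte_fin in H1t.
  move: H12; case: (hitting S2 X w) => [v| |]//.
    rewrite lte_fin => sv; exists (Num.min v t); first by rewrite lt_min sv.
    by rewrite lee_fin !ge_min !lexx orbT.
  by move=> _; exists t => //; rewrite leey.
move=> [uH ut]; have [r] := rat_in_itvoo us; rewrite in_itv/= => /andP[sr ru].
exists r => /=; first by rewrite (le_trans s0 (ltW sr)) (lt_le_trans ru ut).
split; first by rewrite sE lte_fin.
by apply/negP; rewrite -leNgt; apply: le_trans uH; rewrite lee_fin ltW.
Qed.

Lemma hitting_path_from S t w : 0 <= t -> (t%:E <= hitting S X w)%E ->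
  hitting S X w = (t%:E + hitting S (@coordinate R l) (path_from Z t w))%E.
Proof.
move=> t0 tS; transitivity (first_time S (X ^~ w)) => //; rewrite (@first_time_shift _ S (X ^~ w) t)//.
  congr (_ + first_time S _)%E; apply/funext => u.
  by rewrite /coordinate/= /shifted_path max_r.
move=> u u0 ut; apply: (@first_time_gt _ S (X ^~ w)) => //; apply: lt_le_trans tS.
by rewrite lte_fin.
Qed.

Lemma discountD q t (T : \bar R) : (0 <= T)%E ->
  discount q (t%:E + T)%E = discount q t%:E * discount q T.
Proof. by case: T => [u| |]//= _; rewrite ?mulr0// -expRD mulrDr. Qed.

Lemma coordinate_hitting S t w (h := hitting S (@coordinate R l) (path_from Z t w)) :
  0 <= t -> (t%:E <= hitting S X w)%E -> (h < +oo)%E ->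
  coordinate (fine h) (path_from Z t w) = X_at Z (hitting S X) w.
Proof.
move=> t0 tS hoo; have h0 : (0 <= h)%E by exact: (@first_time_ge0 R S ((@coordinate R l) ^~ (path_from Z t w))).
rewrite /X_at (hitting_path_from t0 tS) -/h /coordinate/= /shifted_path max_r//.
by rewrite fineD// ge0_fin_numE.
Qed.

End StoppedPath.

Section PathFunctionals.
Context {R : realType} (l : R).
Local Notation hit S := (hitting S (@coordinate R l)).
Implicit Types (p : path_space l).

Lemma coordinate_right_continuous p : rcontinuous ((@coordinate R l) ^~ p).
Proof. exact: (@path_right_continuous R l p). Qed.

Lemma path_hitting_measurable (S : set R) : measurable S ->
  (forall p, right_open S ((@coordinate R l) ^~ p)) -> measurable_fun setT (hit S).
Proof.
move=> mS oS; apply: measurable_hitting => // t t0.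
by rewrite -[X in measurable X]setTI; exact: (@measurable_coordinate R l t t0 measurableT).
Qed.

Lemma measurable_lt_set (a : R) : measurable [set z : R | z < a].
Proof. by rewrite (_ : [set z | z < a] = `]-oo, a[%classic)//; apply/seteqP; split => z /=; rewrite in_itv. Qed.

Lemma measurable_gt_set (a : R) : measurable [set z : R | a < z].
Proof. by rewrite (_ : [set z | a < z] = `]a, +oo[%classic)//; apply/seteqP; split => z /=; rewrite in_itv/= andbT. Qed.

Lemma measurable_le_set (a : R) : measurable [set z : R | z <= a].
Proof. by rewrite (_ : [set z | z <= a] = `]-oo, a]%classic)//; apply/seteqP; split => z /=; rewrite in_itv. Qed.

Lemma path_below_measurable a : measurable_fun setT (hit [set z | z < a]).
Proof.
apply: path_hitting_measurable => [|p]; first exact: measurable_lt_set.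
by apply: first_time_open; [exact: open_lt|exact: coordinate_right_continuous].
Qed.

Lemma path_above_measurable b : measurable_fun setT (hit [set z | b < z]).
Proof.
apply: path_hitting_measurable => [|p]; first exact: measurable_gt_set.
by apply: first_time_open; [exact: open_gt|exact: coordinate_right_continuous].
Qed.

Lemma path_exit_measurable : measurable_fun setT (hit [set z | z <= l]).
Proof.
apply: path_hitting_measurable => [|p]; first exact: measurable_le_set.
apply: absorbed_right_open; exact: (@path_absorbed R l p).
Qed.

(** The integrand of I_y(G) as a function of the path, the form to which the strong Markov property
    applies. If the level is never passed, the coordinate is taken at a default time and the
    discount 0 removes it. *)
Definition below_functional (a q : R) (G : R -> R) p : R :=
  discount q (hit [set z | z < a] p) *
  G (a - coordinate (fine (hit [set z | z < a] p)) p).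

Definition above_functional (b q : R) p : R :=
  discount q (hit [set z | b < z] p) *
  \1_[set p' | (hit [set z | (b < z)%R] p' < hit [set z | (z <= l)%R] p')%E] p.

Let hit_ge0 S p : (0 <= hit S p)%E.
Proof. exact: (@first_time_ge0 R S ((@coordinate R l) ^~ p)). Qed.

Lemma below_functional_measurable a q G : measurable_fun setT G ->
  measurable_fun setT (below_functional a q G).
Proof.
move=> mG; apply: measurable_funM.
  by apply: (@discount_measurable _ _ _ q _ (path_below_measurable a)) => p; exact: hit_ge0.
apply: (measurableT_comp mG); apply: measurable_funB => //.
apply: measurable_eval.
- exact: measurable_coordinate.
- exact: coordinate_right_continuous.
- by apply: measurableT_comp => //; exact: path_below_measurable.
- by move=> p; apply: fine_ge0; exact: hit_ge0.
Qed.

Lemma above_functional_measurable b q : measurable_fun setT (above_functional b q).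
Proof.
apply: measurable_funM.
  by apply: (@discount_measurable _ _ _ q _ (path_above_measurable b)) => p; exact: hit_ge0.
apply: measurable_indic; rewrite -[X in measurable X]setTI; apply: measurable_lte => //.
  exact: path_above_measurable.
exact: path_exit_measurable.
Qed.

Lemma below_functional_ge0 a q G : (forall y, 0 <= G y) -> forall p, 0 <= below_functional a q G p.
Proof. by move=> G0 p; rewrite mulr_ge0// discount_ge0. Qed.

Lemma below_functional_le1 a q G : 0 <= q -> (forall y, 0 <= G y) -> (forall y, G y <= 1) ->
  forall p, below_functional a q G p <= 1.
Proof. by move=> q0 G0 G1 p; rewrite mulr_ile1// ?discount_ge0// discount_le1//; exact: hit_ge0. Qed.

Lemma above_functional_ge0 b q p : 0 <= above_functional b q p.
Proof. by rewrite mulr_ge0// discount_ge0. Qed.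

Lemma above_functional_le1 b q : 0 <= q -> forall p, above_functional b q p <= 1.
Proof. by move=> q0 p; rewrite mulr_ile1// ?discount_ge0// ?indic_le1// discount_le1//; exact: hit_ge0. Qed.

End PathFunctionals.

Section TwoSidedExit.
Context {R : realType} {d : measure_display} {Om : measurableType d} {K : nat}.
Context {l lam : R} {c sigma : R -> R} {beta : 'rV[R]_K} {B : 'M[R]_K}.
Variable Z : @jump_diffusion R d Om K l lam c sigma beta B.
Local Notation X := (jd_X Z).
Local Notation P := (jd_P Z).
Local Notation F := (jd_F Z).
Variables (q : R) (q0 : 0 <= q) (a b : R) (la : l < a) (ab : a < b).
Hypothesis aeR : forall x, l < x -> {ae P x, forall w, regular Z x w}.
Local Notation T := (T_below Z a).
Local Notation U := (T_above Z b).
Local Notation E := (T_exit Z).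
Let lb : l < b := lt_trans la ab.

Lemma below_functional0 G w :
  below_functional a q G (path_from Z 0 w) = discount q (T w) * G (overshoot Z a w).
Proof. by rewrite /below_functional /hitting /coordinate path_from0E. Qed.

Lemma above_functional0 w :
  above_functional b q (path_from Z 0 w) =
  \1_[set w | (U w < E w)%E] w * discount q (U w).
Proof.
have h S : hitting S (@coordinate R l) (path_from Z 0 w) = hitting S X w.
  by rewrite /hitting /coordinate path_from0E.
rewrite /above_functional h mulrC !indicE; congr ((nat_of_bool _)%:R * _).
apply/idP/idP; rewrite !inE => H.
  by change (hitting [set z | (b < z)%R] X w < hitting [set z | (z <= l)%R] X w)%E; rewrite -!h.
change (hitting [set z | (b < z)%R] (@coordinate R l) (path_from Z 0 w) <
  hitting [set z | (z <= l)%R] (@coordinate R l) (path_from Z 0 w))%E.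
by rewrite !h.
Qed.

Let oT := optional_T_below Z a.
Let oU := optional_T_above Z b.
Let mT : measurable_fun setT T := @optional_time_measurable _ _ _ _ _ _ _ _ _ _ Z T oT.
Let mU : measurable_fun setT U := @optional_time_measurable _ _ _ _ _ _ _ _ _ _ Z U oU.
Let mdT : measurable_fun setT (fun w => discount q (T w)).
Proof. by apply: (@discount_measurable _ _ _ q T mT) => w; exact: oT.1. Qed.
Let mdU : measurable_fun setT (fun w => discount q (U w)).
Proof. by apply: (@discount_measurable _ _ _ q U mU) => w; exact: oU.1. Qed.

Lemma optional_exit : optional_time F E.
Proof.
apply: optional_hitting => [|w]; first exact: measurable_le_set.
by apply: absorbed_right_open; exact: X_absorbed.
Qed.
Let mE : measurable_fun setT E := @optional_time_measurable _ _ _ _ _ _ _ _ _ _ Z E optional_exit.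

(** At a common finite time the path would be both at most [a] and at least [b]. Ties thus occur at
    infinity only, where the discount vanishes. *)
Lemma T_below_neq_T_above w : T w = U w -> T w = +oo%E.
Proof.
move=> TU; have [//|] := eqVneq (T w) +oo%E; rewrite -ltey => Too.
have Xa := @X_at_T_below_le _ _ _ _ _ _ _ _ _ _ Z a w Too.
have Uoo : (U w < +oo)%E by rewrite -TU.
have [t t0 Ut] := @first_time_fine R _ (X ^~ w) Uoo.
have := first_time_above_ge Ut (@X_right_continuous _ _ _ _ _ _ _ _ _ _ Z w).
have {}Ut : U w = t%:E := Ut.
move: Xa; rewrite /X_at TU Ut/= => /le_lt_trans/(_ ab); by rewrite ltNge => /negbTE ->.
Qed.

Lemma past_above_below : past F U [set w | (U w < T w)%E].
Proof.
apply: past_hitting_lt; [exact: measurable_gt_set|exact: measurable_lt_set| |] => w.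
  by apply: first_time_open; [exact: open_gt|exact: X_right_continuous].
by apply: first_time_open; [exact: open_lt|exact: X_right_continuous].
Qed.

Lemma past_below_above : past F T [set w | (T w < U w)%E].
Proof.
apply: past_hitting_lt; [exact: measurable_lt_set|exact: measurable_gt_set| |] => w.
  by apply: first_time_open; [exact: open_lt|exact: X_right_continuous].
by apply: first_time_open; [exact: open_gt|exact: X_right_continuous].
Qed.

Lemma restart_expectation_measurable (Phi : path_space l -> R) :
  measurable_fun setT Phi -> (forall p, 0 <= Phi p) ->
  measurable_fun setT (fun z => \int[P z]_w (Phi (path_from Z 0 w))%:E)%E.
Proof.
move=> mPhi Phi0.
apply: measurable_fun_integral_kernel; first exact: measurable_kernel.
  by move=> w; rewrite lee_fin.
apply/measurable_EFinP; apply: (measurableT_comp mPhi).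
exact: (@measurable_path_from _ _ _ _ _ _ _ _ _ _ Z (fun=> 0)).
Qed.

Definition above_mass x : \bar R :=
  (\int[P x]_(w in [set w | (U w < T w)%E]) (discount q (U w))%:E)%E.

Definition discounted_overshoot x (G : R -> R) : \bar R :=
  (\int[P x]_w (discount q (T w) * G (overshoot Z a w))%:E)%E.

Definition early_overshoot x (G : R -> R) : \bar R :=
  (\int[P x]_(w in [set w | (T w < U w)%E]) (discount q (T w) * G (overshoot Z a w))%:E)%E.

Lemma measurable_lt_time (S1 S2 : Om -> \bar R) : measurable_fun setT S1 ->
  measurable_fun setT S2 -> measurable [set w | (S1 w < S2 w)%E].
Proof. by move=> m1 m2; rewrite -[X in measurable X]setTI; exact: measurable_lte. Qed.

Let mover : measurable_fun setT (overshoot Z a) := @overshoot_measurable _ _ _ _ _ _ _ _ _ _ Z a.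

Lemma overshoot_after_above x (G : R -> R) : l < x -> x <= b -> measurable_fun setT G ->
  (forall y, 0 <= G y) -> (forall y, G y <= 1) ->
  discounted_overshoot x G =
  (early_overshoot x G + above_mass x * discounted_overshoot b G)%E.
Proof.
move=> lx xb mG G0 G1.
have mD : measurable_fun setT (fun w => discount q (T w) * G (overshoot Z a w)).
  by apply: measurable_funM => //; exact: measurableT_comp.
pose A := [set w | (U w < T w)%E].
have mA : measurable A by exact: measurable_lt_time.
have AU : A `&` [set w | (U w < +oo)%E] = A.
  by apply/setIidl => w /= H; apply: lt_le_trans H (leey _).
have D0 w : 0 <= discount q (T w) * G (overshoot Z a w) by rewrite mulr_ge0// discount_ge0.
have SM := @strong_markov_discount _ _ _ _ _ _ _ _ _ _ Z U oU x A q (below_functional a q G) q0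
  past_above_below (below_functional_ge0 a q G0) (below_functional_le1 a q0 G0 G1)
  (below_functional_measurable a q mG).
rewrite AU in SM.
have SM1 : (\int[P x]_(w in A) (discount q (T w) * G (overshoot Z a w))%:E =
    above_mass x * discounted_overshoot b G)%E.
  transitivity (\int[P x]_(w in A) (discount q (U w) *
      below_functional a q G (path_from Z (fine (U w)) w))%:E)%E.
    apply: eq_integral => w; rewrite inE => Aw; congr (_%:E).
    have [t t0 Ut] := @first_time_fine R _ (X ^~ w) (lt_le_trans Aw (leey _)).
    have {}Ut : U w = t%:E := Ut.
    have tT : (t%:E <= T w)%E by rewrite -Ut ltW.
    rewrite Ut /below_functional mulrA; have TE := hitting_path_from t0 tT.
    have -> : discount q (T w) = discount q t%:E * discount q (hitting [set z | z < a] (@coordinate R l) (path_from Z t w)).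
      rewrite /T_below TE discountD//.
      exact: (@first_time_ge0 R _ ((@coordinate R l) ^~ (path_from Z t w))).
    have [h|] := ltP (hitting [set z | z < a] (@coordinate R l) (path_from Z t w)) +oo%E.
      by congr (_ * G (a - _)); rewrite -(coordinate_hitting t0 tT).
    by rewrite leye_eq => /eqP ->; rewrite /= mulr0 !mul0r.
  rewrite SM /above_mass; set M := discounted_overshoot b G.
  have M0 : (0 <= M)%E by apply: integral_ge0 => w _; rewrite lee_fin.
  transitivity (\int[P x]_(w in A) ((discount q (U w))%:E * M))%E.
    apply: ae_eq_integral => //.
    - apply: emeasurable_funM; first by apply/measurable_EFinP; exact: measurable_funTS.
      apply: measurable_funTS.
      apply: (measurableT_comp (restart_expectation_measurable (below_functional_measurable a q mG) (below_functional_ge0 a q G0))).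
      exact: (@X_at_measurable _ _ _ _ _ _ _ _ _ _ Z U oU).
    - by apply: emeasurable_funM => //; apply/measurable_EFinP; exact: measurable_funTS.
    apply: filterS (aeR lx) => w rw Aw; congr (_ * _)%E.
    rewrite (X_at_T_above rw (ltW lb) xb (lt_le_trans Aw (leey _))).
    by apply: eq_integral => w' _; rewrite below_functional0.
  rewrite ge0_integralZr//.
  - by apply/measurable_EFinP; exact: measurable_funTS.
  - by move=> w _; rewrite lee_fin discount_ge0.
have mB : measurable [set w | (T w < U w)%E] by exact: measurable_lt_time.
rewrite -SM1 /discounted_overshoot.
rewrite -(setUv A) ge0_integral_setU//=; last 4 first.
- exact: measurableC.
- by apply/measurable_EFinP; rewrite setUv.
- by move=> w _; rewrite lee_fin.
- by rewrite /disj_set setICr.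
rewrite addeC; congr (_ + _)%E; apply: integral_ae_set => //; first exact: measurableC.
apply: nearW => w; rewrite !indicE.
have [TU|UT|TU] := ltgtP (T w) (U w).
- have nA : (~` A) w by move=> /= UT; have := lt_trans TU UT; rewrite ltxx.
  by rewrite !mem_set.
- have nA : ~ (~` A) w by move=> /(_ UT).
  have nB : ~ [set w | (T w < U w)%E] w by move=> /= TU; have := lt_trans TU UT; rewrite ltxx.
  by rewrite !memNset.
- by rewrite (T_below_neq_T_above TU) /= mul0r !mulr0.
Qed.

(** Equal to H x / H b for l < x <= b and to 0 for x <= l. As a kernel integral it is measurable in
    [x], which gives access to the measurability that [is_H] does not provide. *)
Definition exit_value x : \bar R :=
  (\int[P x]_(w in [set w | (U w < E w)%E]) (discount q (U w))%:E)%E.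

Lemma exit_valueE x : exit_value x = (\int[P x]_w (above_functional b q (path_from Z 0 w))%:E)%E.
Proof.
rewrite /exit_value [LHS]integral_mkcond; apply: eq_integral => w _.
by rewrite patchE above_functional0 indicE; case: ifP; rewrite ?mul1r ?mul0r.
Qed.

Lemma exit_value_ge0 x : (0 <= exit_value x)%E.
Proof. by apply: integral_ge0 => w _; rewrite lee_fin discount_ge0. Qed.

Lemma exit_value_measurable : measurable_fun setT exit_value.
Proof.
rewrite (_ : exit_value = fun x => (\int[P x]_w (above_functional b q (path_from Z 0 w))%:E)%E).
  apply: restart_expectation_measurable; first exact: above_functional_measurable.
  exact: above_functional_ge0.
by apply/funext => x; exact: exit_valueE.
Qed.

Lemma exit_value_le x : (exit_value x <= P x [set w | (U w < E w)%E])%E.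
Proof.
have mUE : measurable [set w | (U w < E w)%E] by exact: measurable_lt_time.
rewrite -[leRHS]mul1e -integral_cst//; apply: ge0_le_integral => //.
- by move=> w _; rewrite lee_fin discount_ge0.
- by apply/measurable_EFinP; exact: measurable_funTS.
- by move=> w _; rewrite lee_fin discount_le1//; exact: oU.1.
Qed.

Lemma exit_value_le1 x : (exit_value x <= 1)%E.
Proof.
apply: le_trans (exit_value_le x) _; rewrite -(prob_kernel (s := P) x).
by apply: le_measure; rewrite ?inE//; exact: measurable_lt_time.
Qed.

Lemma exit_value_fin x : exit_value x \is a fin_num.
Proof. by rewrite ge0_fin_numE ?exit_value_ge0// (le_lt_trans (exit_value_le1 x))// ltry. Qed.

(* The function [G] of the second use of the strong Markov property, [H (a - y) / H b]. *)
Definition overshoot_value (y : R) : R := fine (exit_value (a - y)).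

Lemma overshoot_value_measurable : measurable_fun setT overshoot_value.
Proof.
apply: measurableT_comp => //; apply: (measurableT_comp exit_value_measurable).
exact: measurable_funB.
Qed.

Lemma overshoot_value_ge0 y : 0 <= overshoot_value y.
Proof. by rewrite fine_ge0// exit_value_ge0. Qed.

Lemma overshoot_value_le1 y : overshoot_value y <= 1.
Proof. by rewrite -lee_fin fineK ?exit_value_fin// exit_value_le1. Qed.

(** [T_below] never exceeds the exit time, so a passage above [b] before the exit falls before [T]
    or after it; in the latter case the remaining times are those of the path restarted at [T]. *)
Lemma exit_value_split x :
  exit_value x = (above_mass x + early_overshoot x overshoot_value)%E.
Proof.
pose A := [set w | (U w < T w)%E]; pose C := [set w | (T w < U w)%E].
pose D := [set w | (U w < E w)%E].
have mA : measurable A by exact: measurable_lt_time.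
have mC : measurable C by exact: measurable_lt_time.
have mD : measurable D by exact: measurable_lt_time.
have TE w : (T w <= E w)%E by exact: T_below_le_exit.
have DE : D = A `|` (C `&` D).
  apply/seteqP; split => w; last first.
    by move=> [Aw|[]//]; exact: lt_le_trans Aw (TE w).
  move=> Dw; have [TU|UT|TU] := ltgtP (T w) (U w); [by right|by left|].
  by move: Dw; rewrite /D/= -TU (T_below_neq_T_above TU) ltNge leey.
rewrite /exit_value -/D DE ge0_integral_setU//; last 4 first.
- exact: measurableI.
- by apply/measurable_EFinP; exact: measurable_funTS.
- by move=> w _; rewrite lee_fin discount_ge0.
- rewrite /disj_set; apply/eqP/seteqP; split => w //= [UT [TU _]].
  by have := lt_trans TU UT; rewrite ltxx.
congr (_ + _)%E; rewrite integral_mkcondr.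
have CT : C `&` [set w | (T w < +oo)%E] = C.
  by apply/setIidl => w /= H; apply: lt_le_trans H (leey _).
have SM := @strong_markov_discount _ _ _ _ _ _ _ _ _ _ Z T oT x C q (above_functional b q) q0
  past_below_above (above_functional_ge0 b q) (above_functional_le1 b q0)
  (above_functional_measurable b q).
rewrite CT in SM.
transitivity (\int[P x]_(w in C) (discount q (T w) *
    above_functional b q (path_from Z (fine (T w)) w))%:E)%E.
  apply: eq_integral => w; rewrite inE => Cw.
  have [t t0 Tt] := @first_time_fine R _ (X ^~ w) (lt_le_trans Cw (leey _)).
  have {}Tt : T w = t%:E := Tt.
  have tU : (t%:E <= U w)%E by rewrite -Tt ltW.
  have tE : (t%:E <= E w)%E by rewrite -Tt.
  rewrite patchE Tt /above_functional indicE mulrA.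
  have -> : discount q (t%:E) * discount q (hitting [set z | b < z] (@coordinate R l) (path_from Z t w)) = discount q (U w).
    rewrite /T_above (hitting_path_from t0 tU) discountD//.
    exact: (@first_time_ge0 R _ ((@coordinate R l) ^~ (path_from Z t w))).
  have -> : (path_from Z t w \in [set p' | (hitting [set z | (b < z)%R] (@coordinate R l) p' <
      hitting [set z | (z <= l)%R] (@coordinate R l) p')%E]) = (w \in D).
    have key : (hitting [set z | (b < z)%R] (@coordinate R l) (path_from Z t w) <
      hitting [set z | (z <= l)%R] (@coordinate R l) (path_from Z t w))%E = (U w < E w)%E.
      by rewrite /T_above /T_exit (hitting_path_from t0 tU) (hitting_path_from t0 tE) lteD2lE.
    by apply/idP/idP; rewrite !inE /D /= -key.
  by case: ifP; rewrite ?mulr1 ?mulr0.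
rewrite SM; apply: eq_integral => w _.
rewrite -exit_valueE /overshoot_value /overshoot opprB addrC subrK EFinM fineK//.
exact: exit_value_fin.
Qed.

End TwoSidedExit.

(** * Ruin probabilities *)

Section DensityIntegral.
Context {R : realType} (f : R -> R).
Hypotheses (mf : measurable_fun setT f) (f0 : forall t, 0 < t -> 0 <= f t).
Local Notation pos := (`]0%R, +oo[%classic : set R).
Local Notation mu := (@lebesgue_measure R).
Import HBNNSimple.

Let f_ge0 t : pos t -> 0 <= f t. Proof. by rewrite /= in_itv/= andbT; exact: f0. Qed.

Let density_nnsfun (g : {nnsfun R >-> R}) :
  (\int[measure_of_density mf f0]_t (g t)%:E =
   \int[mu]_(t in pos) ((f t)%:E * (g t)%:E))%E.
Proof.
have mg (r : R) : measurable (g @^-1` [set r]) by apply: measurable_funPTI; exact: measurable_set1.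
under [LHS]eq_integral do rewrite fimfunE -fsumEFin//.
rewrite [LHS]ge0_integral_fsum//; last 2 first.
  - by move=> r; exact/measurable_EFinP/measurableT_comp.
  - by move=> n x _; rewrite EFinM nnfun_muleindic_ge0.
under [RHS]eq_integral => t tp.
  rewrite fimfunE -fsumEFin// ge0_mule_fsumr; last first.
    by move=> r; rewrite EFinM nnfun_muleindic_ge0.
  over.
rewrite [RHS]ge0_integral_fsum//; last 2 first.
  - move=> r; apply: emeasurable_funM; apply/measurable_EFinP; apply: measurable_funTS => //.
    by apply: measurable_funM => //; apply: measurable_indic; exact: (mg r).
  - by move=> n t /f_ge0 ft; rewrite EFinM mule_ge0// nnfun_muleindic_ge0.
apply: eq_fsbigr => r _.
have [r0|r0] := ltP r 0.
  rewrite !integral0_eq//= => t _; rewrite preimage_nnfun0// indic0/= !mulr0 ?mule0//.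
under [RHS]eq_integral do rewrite EFinM muleCA.
rewrite integralZl_indic_nnsfun// integral_indic// setIT ge0_integralZl//; last 2 first.
- apply: emeasurable_funM; apply/measurable_EFinP; apply: measurable_funTS => //.
  by apply: measurable_indic; exact: (mg r).
- by move=> t /f_ge0 ft; rewrite -EFinM lee_fin mulr_ge0.
congr (_ * _)%E; rewrite /measure_of_density/= /density_measure setIC integral_mkcondr.
apply: eq_integral => t _; rewrite patchE indicE; case: ifP; rewrite ?mule1 ?mule0//.
Qed.

Lemma integral_measure_of_density (g : R -> \bar R) :
  measurable_fun setT g -> (forall t, 0 <= g t)%E ->
  (\int[measure_of_density mf f0]_t g t = \int[mu]_(t in pos) ((f t)%:E * g t))%E.
Proof.
move=> mg g0; pose g_ := nnsfun_approx measurableT mg.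
transitivity (lim (\int[measure_of_density mf f0]_t (g_ n t)%:E @[n --> \oo])%E).
  rewrite -monotone_convergence//.
  - apply: eq_integral => t _; apply/esym/cvg_lim => //.
    exact: cvg_nnsfun_approx.
  - by move=> n; exact/measurable_EFinP/measurable_funTS.
  - by move=> n ? _; rewrite lee_fin.
  - by move=> ? _ ? ? mn; rewrite lee_fin; exact/lefP/nd_nnsfun_approx.
under eq_fun do rewrite density_nnsfun.
rewrite -monotone_convergence//=.
- apply: eq_integral => t; rewrite inE => /f_ge0 ft; apply/cvg_lim => //=.
  apply: cvgeZl => //; exact: cvg_nnsfun_approx.
- move=> n; apply: emeasurable_funM; apply/measurable_EFinP; first exact: measurable_funTS.
  exact: (measurable_funTS (@measurable_funPT _ _ _ _ (g_ n))).
- by move=> n t /f_ge0 ft; rewrite -EFinM lee_fin mulr_ge0.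
- move=> t /f_ge0 ft m n mn; apply: lee_wpmul2l; first by rewrite lee_fin.
  by rewrite lee_fin; apply: (lefP _ _ (nd_nnsfun_approx measurableT mg mn)).
Qed.

End DensityIntegral.

Section CrossingDecomposition.
Context {R : realType} {d : measure_display} {Om : measurableType d} {K : nat}.
Context {l lam : R} {c sigma : R -> R} {beta : 'rV[R]_K} {B : 'M[R]_K}.
Variable Z : @jump_diffusion R d Om K l lam c sigma beta B.
Hypothesis B_sub : nonsingular_subgenerator B.
Local Notation X := (jd_X Z).
Local Notation P := (jd_P Z).
Variables (x : R) (lx : l < x).
Hypothesis aeR : {ae P x, forall w, regular Z x w}.
Variables (a : R) (la : l < a) (q : R) (q0 : 0 <= q).
Local Notation T := (T_below Z a).
Local Notation pos := (`]0%R, +oo[%classic : set R).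
Local Notation mu := (@lebesgue_measure R).
Let oT := optional_T_below Z a.
Let mT : measurable_fun setT T := @optional_time_measurable _ _ _ _ _ _ _ _ _ _ Z T oT.
Let mdT : measurable_fun setT (fun w => discount q (T w)).
Proof. by apply: (@discount_measurable _ _ _ q T mT) => w; exact: oT.1. Qed.
Let mover : measurable_fun setT (overshoot Z a) := @overshoot_measurable _ _ _ _ _ _ _ _ _ _ Z a.
Variables (G : R -> R) (mG : measurable_fun setT G) (G0 : forall y, 0 <= G y)
  (G1 : forall y, G y <= 1).
Let mD : measurable_fun setT (fun w => discount q (T w) * G (overshoot Z a w)).
Proof. by apply: measurable_funM => //; exact: measurableT_comp. Qed.
Let D0 w : 0 <= discount q (T w) * G (overshoot Z a w).
Proof. by rewrite mulr_ge0// discount_ge0. Qed.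

(** [overshoot_law] integrated against [G]; the positive half-line suffices since a crossing by a
    jump has positive overshoot. *)
Lemma crossing_integral k :
  (\int[P x]_(w in jump_crossing Z a k) (discount q (T w) * G (overshoot Z a w))%:E =
   crossing_mass Z x a q k * \int[mu]_(t in pos) (exit_density B k t * G t)%:E)%E.
Proof.
have mJ := @jump_crossing_measurable _ _ _ _ _ _ _ _ _ _ Z x lx a k.
have [rk|nrk] := pselect (reachable beta B k); last first.
  have cm0 := crossing_mass_unreachable lx aeR la q0 nrk.
  rewrite cm0 mul0e; apply/eqP; rewrite eq_le; apply/andP; split; last first.
    by apply: integral_ge0 => w _; rewrite lee_fin.
  rewrite -cm0 /crossing_mass; apply: ge0_le_integral => //.
  - by move=> w _; rewrite lee_fin.
  - by apply/measurable_EFinP; exact: measurable_funTS.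
  - by apply/measurable_EFinP; exact: measurable_funTS.
  - by move=> w _; rewrite lee_fin ler_piMr// discount_ge0.
have ge0 := reachable_expmx_ge0 (jd_chain Z lx 0) rk.
have f0 t : 0 < t -> 0 <= exit_density B k t by move=> /ltW; exact: exit_density_ge0.
have mf : measurable_fun setT (exit_density B k).
  exact: continuous_measurable_fun (@continuous_exit_density R K B k).
pose w1 w := \1_(jump_crossing Z a k) w * discount q (T w).
have mw1 : measurable_fun setT w1.
  by apply: measurable_funM => //; exact: measurable_indic.
have w10 w : 0 <= w1 w by rewrite mulr_ge0// discount_ge0.
have w11 w : w1 w <= 1.
  by rewrite mulr_ile1 ?indic_le1 ?discount_ge0// discount_le1//; exact: oT.1.
pose L1 := weighted_law P mover mw1 w10 x.
have cm0 : 0 <= fine (crossing_mass Z x a q k).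
  by apply: fine_ge0; apply: integral_ge0 => w _; rewrite lee_fin discount_ge0.
have cmE : (fine (crossing_mass Z x a q k))%:E = crossing_mass Z x a q k.
  by rewrite fineK// (@crossing_mass_fin _ _ _ _ _ _ _ _ _ _ Z x lx).
pose L2 := mscale (NngNum cm0) (measure_of_density mf f0).
have mGE : measurable_fun setT (EFin \o G) by exact/measurable_EFinP.
have GE0 t : (0 <= (G t)%:E)%E by rewrite lee_fin.
have L12 A : measurable A -> L1 A = L2 A.
  move=> mA; rewrite /L1 weighted_lawE//.
  have -> : L2 A = (crossing_mass Z x a q k * \int[mu]_(t in A `&` pos) (exit_density B k t)%:E)%E.
    by rewrite -cmE.
  rewrite -(overshoot_law B_sub lx aeR la q0); last 2 first.
  - exact: measurableI.
  - by move=> t [].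
  rewrite [LHS]integral_mkcond [RHS]integral_mkcond; apply: eq_integral => w _.
  rewrite !patchE /w1 indicE; have [J|nJ] := pselect (jump_crossing Z a k w); last first.
    rewrite (memNset nJ) mul0r [in RHS]memNset; last by case.
    by case: ifP.
  have O0 : 0 < overshoot Z a w by case: J => _ Xa _; rewrite subr_gt0.
  rewrite (mem_set J) mul1r; congr (if _ then _ else _).
  apply/idP/idP; rewrite !inE; last by case=> _ [].
  by move=> Aw; split=> //; split=> //; rewrite /= in_itv/= andbT.
transitivity (\int[L1]_y (G y)%:E)%E.
  rewrite /L1 integral_weighted_law// preimage_setT.
  rewrite [LHS]integral_mkcond; apply: eq_integral => w _.
  rewrite patchE /w1 indicE; case: (w \in _); rewrite ?mul0r ?mul0e// mul1r EFinM//.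
rewrite (@eq_measure_integral _ _ _ _ L2) => [|A mA _]; last exact: L12.
rewrite /L2 ge0_integral_mscale// cmE integral_measure_of_density//.
Qed.

(** The jump is longer than the distance to [a], so its chain is still alive when the level is
    crossed; the phases therefore exhaust the crossings by a jump. *)
Lemma crossing_phase_neq_None w : regular Z x w -> (0 < T w < +oo)%E -> X_at Z T w < a ->
  crossing_phase Z a w <> None.
Proof.
move=> rw T0oo Xa; rewrite crossing_phaseE//; have /andP[T0 Too] := T0oo.
have [t t0 Tt'] := @first_time_fine R _ (X ^~ w) Too.
have Tt : T w = t%:E := Tt'.
rewrite Tt lte_fin in T0; rewrite /X_at Tt/= in Xa.
have [j jf Xt] := T_below_jump rw la Tt T0 Xa.
have -> : jump_index Z a w = j by rewrite /jump_index Tt/= (proj1 jf).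
rewrite /value_before Tt/= gt_eqF//; apply/(jump_size_gt j rw); first by rewrite le_max lexx.
rewrite gt_max; have aV : a <= left_limit Z t w.
  by apply: left_limit_ge => // s s0 st; exact: before_T_below Tt s0 st.
by apply/andP; split; lra.
Qed.

Let creep : set Om := [set w | (T w < +oo)%E /\ X_at Z T w = a].

Let creep_measurable : measurable creep.
Proof.
apply: measurableI; first exact: (@measurable_time_finite _ _ _ _ _ _ _ _ _ _ Z T oT).
rewrite -[X in measurable X]setTI.
exact: (@X_at_measurable _ _ _ _ _ _ _ _ _ _ Z T oT measurableT [set a] (measurable_set1 a)).
Qed.

(** At a finite [T] the path either creeps or crosses in exactly one phase, so the integrands agree
    path by path. The hypothesis [a <= x] excludes a start below [a], where [T] would be 0 with a
    positive overshoot. *)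
Lemma crossing_decomposition : a <= x ->
  discounted_overshoot Z q a x G =
  ((\int[P x]_(w in [set w | (T w < +oo)%E /\ X_at Z T w = a]) (discount q (T w))%:E) * (G 0)%:E +
   \sum_k crossing_mass Z x a q k * \int[mu]_(t in pos) (exit_density B k t * G t)%:E)%E.
Proof.
move=> ax; have mJ := @jump_crossing_measurable _ _ _ _ _ _ _ _ _ _ Z x lx a.
have mk k : measurable_fun setT (fun w => \1_(jump_crossing Z a k) w * (discount q (T w) * G (overshoot Z a w))).
  by apply: measurable_funM => //; exact: measurable_indic.
have mc : measurable_fun setT (fun w => \1_creep w * discount q (T w)).
  by apply: measurable_funM => //; exact: measurable_indic.
have Ind (A : set Om) f : (\int[P x]_(w in A) (f w)%:E = \int[P x]_w (\1_A w * f w)%:E)%E.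
  rewrite [LHS]integral_mkcond; apply: eq_integral => w _.
  by rewrite patchE indicE; case: (w \in A); rewrite ?mul1r ?mul0r.
rewrite -/creep Ind -ge0_integralZr//; last 3 first.
- exact/measurable_EFinP.
- by move=> w _; rewrite lee_fin mulr_ge0// discount_ge0.
- by rewrite lee_fin.
under eq_bigr do rewrite -crossing_integral Ind.
rewrite -ge0_integral_sum//; last 2 first.
- by move=> k; exact/measurable_EFinP.
- by move=> k w _; rewrite lee_fin mulr_ge0.
rewrite -ge0_integralD//; last 4 first.
- by move=> w _; rewrite -EFinM lee_fin !mulr_ge0// discount_ge0.
- by apply/measurable_EFinP; exact: measurable_funM.
- by move=> w _; apply: sume_ge0 => k _; rewrite lee_fin mulr_ge0.
- by apply: emeasurable_sum => k; exact/measurable_EFinP.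
apply: ae_eq_integral => //.
- exact/measurable_EFinP.
- apply: emeasurable_funD; first by apply/measurable_EFinP; exact: measurable_funM.
  by apply: emeasurable_sum => k; exact/measurable_EFinP.
apply: filterS aeR => w rw _; rewrite -EFinM sumEFin -EFinD; congr (_%:E).
have [Too|] := ltP (T w) +oo%E; last first.
  by rewrite leye_eq => /eqP ->; rewrite /= mulr0 !mul0r add0r big1// => k _; rewrite mulr0.
have Xle := @X_at_T_below_le _ _ _ _ _ _ _ _ _ _ Z a w Too.
have [Xa|Xa] := eqVneq (X_at Z T w) a.
  have -> : overshoot Z a w = 0 by rewrite /overshoot Xa subrr.
  rewrite indicE mem_set// mul1r big1 ?addr0// => k _.
  by rewrite indicE memNset ?mul0r// => -[_ + _]; rewrite Xa ltxx.
have {}Xa : X_at Z T w < a by rewrite lt_neqAle Xa.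
rewrite indicE memNset ?mul0r ?add0r; last by move=> [_ E]; rewrite E ltxx in Xa.
have T0 : (0 < T w)%E.
  rewrite lt_neqAle oT.1 andbT; apply/eqP => E.
  by move: Xa; rewrite /X_at -E/= (regular_start rw) ltNge ax.
have T0oo : (0 < T w < +oo)%E by rewrite T0.
case cr : (crossing_phase Z a w) => [k|]; last by case: (crossing_phase_neq_None rw T0oo Xa).
rewrite (bigD1 k)//= big1 ?addr0 => [|j jk].
  by rewrite indicE mem_set ?mul1r.
rewrite indicE memNset ?mul0r// => -[_ _]; rewrite cr => -[E].
by rewrite E eqxx in jk.
Qed.

End CrossingDecomposition.

(** * Two-sided exit *)

Section Assembly.
Context {R : realType} {d : measure_display} {Om : measurableType d} {K : nat}.
Context {l lam : R} {c sigma : R -> R} {beta : 'rV[R]_K} {B : 'M[R]_K}.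
Variable Z : @jump_diffusion R d Om K l lam c sigma beta B.
Hypotheses (lam0 : 0 < lam) (mc : measurable_fun `]l, +oo[ c)
  (c_gt0 : forall x, l < x -> 0 < c x) (beta_prob : probability_row beta)
  (B_sub : nonsingular_subgenerator B).
Variables (q : R) (q0 : 0 <= q) (a b : R) (la : l < a) (ab : a < b).
Local Notation X := (jd_X Z).
Local Notation P := (jd_P Z).
Local Notation T := (T_below Z a).
Local Notation U := (T_above Z b).
Local Notation E := (T_exit Z).
Local Notation pos := (`]0%R, +oo[%classic : set R).
Local Notation mu := (@lebesgue_measure R).

Let aeR x (lx : l < x) : {ae P x, forall w, regular Z x w} :=
  @ae_regular _ _ _ _ _ _ _ _ _ _ Z lam0 mc c_gt0 B_sub x lx.
Let lb : l < b := lt_trans la ab.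
Let oT := optional_T_below Z a.
Let oU := optional_T_above Z b.
Let mT : measurable_fun setT T := @optional_time_measurable _ _ _ _ _ _ _ _ _ _ Z T oT.
Let mU : measurable_fun setT U := @optional_time_measurable _ _ _ _ _ _ _ _ _ _ Z U oU.
Let mdT : measurable_fun setT (fun w => discount q (T w)).
Proof. by apply: (@discount_measurable _ _ _ q T mT) => w; exact: oT.1. Qed.
Let mdU : measurable_fun setT (fun w => discount q (U w)).
Proof. by apply: (@discount_measurable _ _ _ q U mU) => w; exact: oU.1. Qed.
Let mover : measurable_fun setT (overshoot Z a) := @overshoot_measurable _ _ _ _ _ _ _ _ _ _ Z a.

Let unit_integral_fin x (A : set Om) (f : Om -> R) : measurable A -> measurable_fun setT f ->
  (forall w, 0 <= f w) -> (forall w, f w <= 1) ->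
  (\int[P x]_(w in A) (f w)%:E)%E \is a fin_num.
Proof.
move=> mA mf f0 f1; rewrite ge0_fin_numE; last by apply: integral_ge0 => w _; rewrite lee_fin.
apply: (@le_lt_trans _ _ (\int[P x]_(w in A) 1)%E).
  apply: ge0_le_integral => //.
  - by move=> w _; rewrite lee_fin.
  - by apply/measurable_EFinP; exact: measurable_funTS.
  - by move=> w _; rewrite lee_fin.
by rewrite integral_cst// mul1e; rewrite -ge0_fin_numE// (fin_measure (prob_kernel x)).
Qed.

(** Controlled for reachable phases only; elsewhere it is multiplied by coefficients built from
    [Psi_J], which vanish there. *)
Definition exit_moment (k : 'I_K) (G : R -> R) : R :=
  \int[mu]_(t in pos) (exit_density B k t * G t).

Section Reachable.
Variables (k : 'I_K) (rk : reachable beta B k).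
Variables (G : R -> R) (mG : measurable_fun setT G) (G0 : forall y, 0 <= G y)
  (G1 : forall y, G y <= 1).

Lemma reachable_density_ge0 t : 0 <= t -> 0 <= exit_density B k t.
Proof. by apply: exit_density_ge0 => // s j s0; exact: (reachable_expmx_ge0 (jd_chain Z lb 0) rk). Qed.

Lemma exit_density_measurable : measurable_fun setT (exit_density B k).
Proof. exact: continuous_measurable_fun (@continuous_exit_density R K B k). Qed.

Lemma exit_moment_fin : (\int[mu]_(t in pos) (exit_density B k t * G t)%:E)%E \is a fin_num.
Proof.
have e0 t : pos t -> 0 <= exit_density B k t.
  by rewrite /= in_itv/= andbT => /ltW; exact: reachable_density_ge0.
have mf := exit_density_measurable.
rewrite ge0_fin_numE; last by apply: integral_ge0 => t tp; rewrite lee_fin mulr_ge0// e0.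
apply: (@le_lt_trans _ _ (\int[mu]_(t in pos) (exit_density B k t)%:E)%E).
  apply: ge0_le_integral => //.
  - by move=> t tp; rewrite lee_fin mulr_ge0// e0.
  - by apply/measurable_EFinP; apply: measurable_funTS; exact: measurable_funM.
  - by apply/measurable_EFinP; exact: measurable_funTS.
  - by move=> t tp; rewrite lee_fin ler_piMr// e0.
rewrite integral_exit_density ?ltry//.
by move=> s j s0; exact: (reachable_expmx_ge0 (jd_chain Z lb 0) rk).
Qed.

End Reachable.

Lemma Psi_JE x k : Psi_J Z q x a 0 k = fine (crossing_mass Z x a q k).
Proof. by rewrite mxE. Qed.

Lemma Psi_J_unreachable x k : l < x -> ~ reachable beta B k -> Psi_J Z q x a 0 k = 0.
Proof. by move=> lx nrk; rewrite Psi_JE (crossing_mass_unreachable lx (aeR lx) la q0 nrk). Qed.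

Let creep_measurable : measurable [set w | (T w < +oo)%E /\ X_at Z T w = a].
Proof.
apply: measurableI; first exact: (@measurable_time_finite _ _ _ _ _ _ _ _ _ _ Z T oT).
rewrite -[X in measurable X]setTI.
exact: (@X_at_measurable _ _ _ _ _ _ _ _ _ _ Z T oT measurableT [set a] (measurable_set1 a)).
Qed.

Section Functional.
Variables (G : R -> R) (mG : measurable_fun setT G) (G0 : forall y, 0 <= G y)
  (G1 : forall y, G y <= 1).

Lemma discounted_overshootE x : a <= x -> discounted_overshoot Z q a x G =
  (Psi_C Z q x a * G 0 + \sum_k Psi_J Z q x a 0 k * exit_moment k G)%:E.
Proof.
move=> ax; have lx := lt_le_trans la ax.
rewrite (crossing_decomposition B_sub lx (aeR lx) la q0 mG G0 G1 ax) EFinD EFinM.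
congr (_ * _ + _)%E.
  rewrite /Psi_C /Rintegral fineK//; apply: unit_integral_fin => // w.
    exact: discount_ge0.
  by rewrite discount_le1//; exact: oT.1.
rewrite -sumEFin; apply: eq_bigr => k _.
have [rk|nrk] := pselect (reachable beta B k); last first.
  by rewrite Psi_J_unreachable// (crossing_mass_unreachable lx (aeR lx) la q0 nrk) mul0e mul0r.
rewrite EFinM Psi_JE /exit_moment /Rintegral (fineK (exit_moment_fin rk mG G0 G1)) fineK//.
exact: (@crossing_mass_fin _ _ _ _ _ _ _ _ _ _ Z x lx).
Qed.

Lemma above_massE x : above_mass Z q a b x = (Psi_bar Z q b x a)%:E.
Proof.
rewrite /Psi_bar /Rintegral fineK//; apply: unit_integral_fin => //.
- exact: measurable_lt_time.
- by move=> w; exact: discount_ge0.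
- by move=> w; rewrite discount_le1//; exact: oU.1.
Qed.

Lemma early_overshootE x : a <= x -> x <= b -> early_overshoot Z q a b x G =
  (fine (discounted_overshoot Z q a x G) -
   Psi_bar Z q b x a * fine (discounted_overshoot Z q a b G))%:E.
Proof.
move=> ax xb; have lx := lt_le_trans la ax.
have := overshoot_after_above q0 la ab aeR lx xb mG G0 G1.
rewrite above_massE (discounted_overshootE (ltW ab)) (discounted_overshootE ax) /= -EFinM.
set e := early_overshoot _ _ _ _ _ _; move=> H.
have ef : e \is a fin_num.
  apply: unit_integral_fin.
  - exact: measurable_lt_time.
  - by apply: measurable_funM => //; exact: measurableT_comp.
  - by move=> w; rewrite mulr_ge0// discount_ge0.
  - by move=> w; rewrite mulr_ile1// ?discount_ge0// discount_le1//; exact: oT.1.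
move: H; rewrite -(fineK ef) -EFinD => -[->]; congr (_%:E); ring.
Qed.

End Functional.

Lemma early_crossing_law x (D : set R) : a <= x -> x <= b ->
  measurable D -> D `<=` pos ->
  \int[P x]_(w in [set w | (T w < U w)%E /\ D (a - X_at Z T w)]) discount q (T w) =
  \sum_k (Psi_J Z q x a 0 k - Psi_bar Z q b x a * Psi_J Z q b a 0 k) * exit_moment k \1_D.
Proof.
move=> ax xb mD D0; have mI : measurable_fun setT (\1_D : R -> R) by exact: measurable_indic.
transitivity (fine (early_overshoot Z q a b x \1_D)).
  congr fine; rewrite [LHS]integral_mkcondr; apply: eq_integral => w _.
  rewrite patchE indicE /overshoot.
  have -> : (w \in [set w | D (a - X_at Z T w)]) = (a - X_at Z T w \in D).
    by apply/idP/idP; rewrite !inE.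
  by case: ifP; rewrite ?mulr1 ?mulr0.
(* The set [D] avoids 0, so creeping does not contribute. *)
have D00 : \1_D (0 : R) = 0 :> R.
  by rewrite indicE memNset// => /D0; rewrite /= in_itv/= ltxx.
rewrite (early_overshootE mI (indic_ge0 D) (indic_le1 D) ax xb).
rewrite (discounted_overshootE mI (indic_ge0 D) (indic_le1 D) ax).
rewrite (discounted_overshootE mI (indic_ge0 D) (indic_le1 D) (ltW ab)) /= D00 !mulr0 !add0r.
rewrite mulr_sumr -sumrB; apply: eq_bigr => k _; ring.
Qed.

(** The finite sum over phases is exchanged with the integral. Each term is integrable: the density
    has finite mass for a reachable phase, and the coefficient is 0 for any other. *)
Lemma early_crossing_density x (D : set R) : a <= x -> measurable D -> D `<=` pos ->
  \int[mu]_(y in D) ((Psi_J Z q x a - Psi_bar Z q b x a *: Psi_J Z q b a)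
         *m expmx (y *: B) *m exit_rates B) 0 0 =
  \sum_k (Psi_J Z q x a 0 k - Psi_bar Z q b x a * Psi_J Z q b a 0 k) * exit_moment k \1_D.
Proof.
move=> ax mD D0; have lx := lt_le_trans la ax.
pose t k := Psi_J Z q x a 0 k - Psi_bar Z q b x a * Psi_J Z q b a 0 k.
have t0 k : ~ reachable beta B k -> t k = 0.
  by move=> nrk; rewrite /t !Psi_J_unreachable// mulr0 subrr.
have mI : measurable_fun setT (\1_D : R -> R) by exact: measurable_indic.
have momE k : (\int[mu]_(y in pos) (exit_density B k y * \1_D y)%:E =
    \int[mu]_(y in D) (exit_density B k y)%:E)%E.
  rewrite [LHS]integral_mkcond [RHS]integral_mkcond; apply: eq_integral => y _.
  rewrite !patchE indicE; have [Dy|nDy] := pselect (D y).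
    by rewrite !mem_set ?mulr1//; exact: D0.
  by rewrite (memNset nDy) mulr0; case: ifP.
have dens_int k : reachable beta B k -> mu.-integrable D (fun y => (exit_density B k y)%:E).
  move=> rk; apply/integrableP; split.
    by apply/measurable_EFinP; apply: measurable_funTS; exact: exit_density_measurable.
  rewrite (_ : (\int[mu]_(y in D) _)%E = (\int[mu]_(y in D) (exit_density B k y)%:E)%E).
    by rewrite -momE; have /fin_numPlt/andP[] := exit_moment_fin rk mI (indic_ge0 D) (indic_le1 D).
  apply: eq_integral => y; rewrite inE => /D0; rewrite /= in_itv/= andbT => y0.
  by rewrite ger0_norm// reachable_density_ge0// ltW.
have int k : mu.-integrable D (fun y => (t k * exit_density B k y)%:E).
  have [rk|nrk] := pselect (reachable beta B k); last first.
    rewrite t0//; under eq_fun do rewrite mul0r; exact: integrable0.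
  under eq_fun do rewrite EFinM; apply: integrableZl => //; exact: dens_int.
have rowE (u v : 'rV[R]_K) s k : (u - s *: v) 0 k = u 0 k - s * v 0 k by rewrite !mxE.
transitivity (fine (\int[mu]_(y in D) \sum_k (t k * exit_density B k y)%:E)%E).
  congr fine; apply: eq_integral => y _; rewrite sumEFin; congr (_%:E).
  by rewrite -mulmxA mxE; apply: eq_bigr => k _; rewrite rowE.
have IS := @integral_sum _ _ _ mu D mD _ _ int (index_enum 'I_K) xpredT.
transitivity (fine (\sum_k \int[mu]_(y in D) (t k * exit_density B k y)%:E)%E).
  by congr fine; exact: IS.
rewrite -sum_fine; last first.
  by move=> k _; exact: (@integrable_fin_num _ _ _ mu D mD _ (int k)).
apply: eq_bigr => k _; rewrite -/(t k) /exit_moment /Rintegral momE.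
have [rk|nrk] := pselect (reachable beta B k); last first.
  by rewrite t0// mul0r integral0_eq// => y _; rewrite mul0r.
under eq_integral do rewrite EFinM.
rewrite integralZl ?fineM//; [|exact: dens_int].
exact: (@integrable_fin_num _ _ _ mu D mD _ (dens_int k rk)).
Qed.

Section ScaleFunction.
Variables (H : R -> R) (hH : is_H Z q H).
Local Notation V := (overshoot_value Z q a b).

Lemma H_gt0 x : l < x -> 0 < H x. Proof. exact: hH.1. Qed.

Lemma exit_value_scale x : l < x -> x <= b -> exit_value Z q b x = (H x / H b)%:E.
Proof.
move=> lx xb; rewrite -(hH.2 _ _ lx xb) /Rintegral fineK//.
apply: (exit_value_fin Z q0 b x).
Qed.

Lemma exit_value_absorbed z : z <= l -> exit_value Z q b z = 0%E.
Proof.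
move=> zl; rewrite /exit_value (@integral_ae_set _ _ _ _ _ set0 _ (fun w => discount q (U w)))//.
- by rewrite integral_set0.
- apply: measurable_lt_time => //.
  exact: (@optional_time_measurable _ _ _ _ _ _ _ _ _ _ Z E (optional_exit Z)).
apply: filterS (jd_start Z z) => w X0; rewrite !indicE in_set0 memNset// => /= UE.
have E0 : (E w <= 0)%E by apply: (@first_time_le _ [set z | z <= l] (X ^~ w) 0) => //=; rewrite X0.
by have := lt_le_trans UE E0; rewrite ltNge oU.1.
Qed.

Lemma H_mono x y : l < x -> x <= y -> H x <= H y.
Proof.
move=> lx xy; have ly := lt_le_trans lx xy.
rewrite -[leRHS]mul1r -ler_pdivrMr ?H_gt0// -(hH.2 _ _ lx xy).
have := exit_value_le1 Z q0 y x.
by rewrite -(fineK (exit_value_fin Z q0 y x)) lee_fin.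
Qed.

(** The ratio H a / H b is at most the probability of passing above [b] before the exit, which a
    fatal first jump keeps below 1. *)
Lemma H_lt : H a < H b.
Proof.
rewrite -[ltRHS]mul1r -ltr_pdivrMr ?H_gt0// -lte_fin -(exit_value_scale la (ltW ab)).
apply: le_lt_trans (exit_value_le Z q0 b a) _.
have := above_before_exit_lt1 lam0 beta_prob B_sub la ab (aeR la); exact.
Qed.

Let mV : measurable_fun setT V := @overshoot_value_measurable _ _ _ _ _ _ _ _ _ _ Z q a b.
Let V0 : forall y, 0 <= V y := overshoot_value_ge0 Z q a b.
Let V1 : forall y, V y <= 1 := overshoot_value_le1 Z q0 a b.

Lemma overshoot_valueE y : 0 <= y -> y < a - l -> V y = H (a - y) / H b.
Proof.
move=> y0 ya; rewrite /overshoot_value exit_value_scale//; first by rewrite ltrBrDl -ltrBrDr.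
by rewrite (le_trans _ (ltW ab))// gerBl.
Qed.

Lemma overshoot_value_absorbed y : a - l <= y -> V y = 0.
Proof. by move=> ya; rewrite /overshoot_value exit_value_absorbed// lerBlDr -lerBlDl. Qed.

Lemma overshoot_value_le y : 0 <= y -> V y <= H a / H b.
Proof.
move=> y0; have Hb0 : 0 < H b by exact: H_gt0.
have [ya|ya] := ltP y (a - l); last first.
  by rewrite overshoot_value_absorbed// divr_ge0// ltW// H_gt0.
rewrite overshoot_valueE// ler_pM2r ?invr_gt0//; apply: H_mono; first lra.
by rewrite gerBl.
Qed.

(** The end points are dropped first: [is_H] says nothing of [H] at [l]. Inside, the integrand is a
    multiple of the one with [V], hence measurable; from a - l on [V] is 0, which extends the range
    to the half-line. *)
Lemma scale_moment k : reachable beta B k ->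
  \int[mu]_(y in `[0, a - l]) (exit_density B k y * H (a - y)) = H b * exit_moment k V.
Proof.
move=> rk; have Hb0 : 0 < H b by exact: H_gt0.
have mfV : measurable_fun setT (fun y => exit_density B k y * V y).
  by apply: measurable_funM => //; exact: exit_density_measurable.
have EQ y : y \in (`]0, a - l[%classic : set R) ->
    exit_density B k y * H (a - y) = H b * (exit_density B k y * V y).
  rewrite inE/= in_itv/= => /andP[y0 ya].
  by rewrite (overshoot_valueE (ltW y0) ya); field; rewrite gt_eqF.
have mo : measurable_fun (`]0%R, a - l[%classic : set R)
    (fun y => (exit_density B k y * H (a - y))%:E).
  apply: (eq_measurable_fun (fun y => (H b * (exit_density B k y * V y))%:E)).
    by move=> y yI; rewrite EQ.
  by apply/measurable_EFinP; apply: measurable_funTS; exact: measurable_funM.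
have mc' : measurable_fun (`[0%R, a - l[%classic : set R)
    (fun y => (exit_density B k y * H (a - y))%:E).
  exact: (proj1 (emeasurable_fun_itv_obnd_cbndP _ _ _) mo).
rewrite /exit_moment /Rintegral -integral_itv_bndo_bndc// -integral_itv_obnd_cbnd//.
transitivity (fine ((H b)%:E * \int[mu]_(t in pos) (exit_density B k t * V t)%:E)%E); last first.
  by rewrite fineM//; exact: exit_moment_fin.
congr fine; rewrite -ge0_integralZl//; last 3 first.
- by apply/measurable_EFinP; exact: measurable_funTS.
- move=> t; rewrite /= in_itv/= andbT => t0.
  by rewrite lee_fin mulr_ge0// reachable_density_ge0// ltW.
- by rewrite lee_fin ltW.
rewrite [LHS]integral_mkcond [RHS]integral_mkcond; apply: eq_integral => y _.
rewrite !patchE; case: ifPn => yI.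
  rewrite ifT; first by rewrite -EFinM EQ.
  by move: yI; rewrite !inE/= !in_itv/= andbT => /andP[].
case: ifPn => // yp; rewrite overshoot_value_absorbed ?mulr0 ?mule0//.
move: yI yp; rewrite notin_setE inE/= !in_itv/= andbT => + y0.
by rewrite y0/= => /negP; rewrite -leNgt.
Qed.

Lemma W_funE x : a <= x -> x <= b ->
  W_fun Z q H x a = H x - H b * fine (discounted_overshoot Z q a x V).
Proof.
move=> ax xb; have lx := lt_le_trans la ax; have Hb0 : 0 < H b by exact: H_gt0.
rewrite (discounted_overshootE mV V0 V1 ax)/= overshoot_valueE ?subr_gt0//.
rewrite /W_fun subr0 mulrDr opprD addrA; congr (_ - _ - _).
  by field; rewrite gt_eqF.
rewrite mxE mulr_sumr; apply: eq_bigr => k _; rewrite [(\col__ _) _ _]mxE.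
have [rk|nrk] := pselect (reachable beta B k); last by rewrite Psi_J_unreachable// !mul0r mulr0.
by rewrite scale_moment// mulrCA.
Qed.

(** Overshoots are nonnegative, and there [V] is at most H a / H b < 1. *)
Lemma discounted_overshoot_scale_lt1 : fine (discounted_overshoot Z q a b V) < 1.
Proof.
have Hb0 : 0 < H b by exact: H_gt0.
have r1 : H a / H b < 1 by rewrite ltr_pdivrMr// mul1r H_lt.
have r0 : 0 <= H a / H b by rewrite divr_ge0// ltW// H_gt0.
apply: le_lt_trans r1; rewrite -lee_fin fineK; last by rewrite (discounted_overshootE mV V0 V1 (ltW ab)).
rewrite -[leRHS]mule1 -(prob_kernel (s := P) b) -integral_cst//.
apply: ge0_le_integral => //.
- by move=> w _; rewrite lee_fin mulr_ge0// discount_ge0.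
- by apply/measurable_EFinP; apply: measurable_funM => //; exact: measurableT_comp.
- move=> w _; rewrite lee_fin; have [Too|] := ltP (T w) +oo%E; last first.
    by rewrite leye_eq => /eqP ->; rewrite /= mul0r.
  rewrite -[leRHS]mul1r; apply: ler_pM => //; [exact: discount_ge0| |].
    by rewrite discount_le1//; exact: oT.1.
  by apply: overshoot_value_le; rewrite subr_ge0; exact: X_at_T_below_le.
Qed.

Lemma W_fun_ratio x : a <= x -> x <= b ->
  W_fun Z q H b a != 0 /\ Psi_bar Z q b x a = W_fun Z q H x a / W_fun Z q H b a.
Proof.
move=> ax xb; have lx := lt_le_trans la ax; have Hb0 : 0 < H b by exact: H_gt0.
have i1 := discounted_overshoot_scale_lt1.
rewrite !W_funE ?(ltW ab)//; set ib := fine (discounted_overshoot Z q a b V) in i1 *.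
have Wb : H b - H b * ib != 0 by rewrite gt_eqF// subr_gt0 gtr_pMr.
split => //; apply/eqP; rewrite -subr_eq0.
have := exit_value_split Z q0 la ab x.
rewrite (exit_value_scale lx xb) above_massE (early_overshootE mV V0 V1 ax xb) -EFinD => -[E1].
(* With the denominator H b cleared, the ratio becomes a rational identity in [Psi_bar]. *)
have E2 : H x = H b * (Psi_bar Z q b x a +
  (fine (discounted_overshoot Z q a x V) - Psi_bar Z q b x a * ib)).
  by rewrite /ib -E1 mulrCA mulfV ?mulr1// gt_eqF.
rewrite E2 subr_eq0; apply/eqP; field; exact: Wb.
Qed.

End ScaleFunction.

End Assembly.

Theorem lemma2 (R : realType) (d : measure_display) (Om : measurableType d)
  (K : nat) (l lam : R) (c sigma : R -> R)
  (beta : 'rV[R]_K) (B : 'M[R]_K)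
  (hlam : 0 < lam)
  (mc : measurable_fun `]l, +oo[ c) (msigma : measurable_fun `]l, +oo[ sigma)
  (hc : forall x, l < x -> 0 < c x) (hsigma : forall x, l < x -> 0 <= sigma x)
  (hbeta : probability_row beta) (hB : nonsingular_subgenerator B)
  (Z : @jump_diffusion R d Om K l lam c sigma beta B)
  (q : R) (hq : 0 <= q) (H : R -> R) (hH : is_H Z q H)
  (a b x : R) (hla : l < a) (hab : a < b) (hax : a <= x) (hxb : x <= b) :
  (W_fun Z q H b a != 0 /\
   Psi_bar Z q b x a = W_fun Z q H x a / W_fun Z q H b a) /\
  (forall D : set R, measurable D -> D `<=` `]0, +oo[ ->
   \int[jd_P Z x]_(w in [set w | (T_below Z a w < T_above Z b w)%E /\
                                 D (a - X_at Z (T_below Z a) w)])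
      discount q (T_below Z a w) =
   \int[lebesgue_measure]_(y in D)
      ((Psi_J Z q x a - Psi_bar Z q b x a *: Psi_J Z q b a)
         *m expmx (y *: B) *m exit_rates B) 0 0).
Proof.
split; first exact: (W_fun_ratio hlam mc hc hbeta hB hq hla hab hH hax hxb).
move=> D mD D0.
rewrite (@early_crossing_law _ _ _ _ _ _ _ _ _ _ Z hlam mc hc hB q hq a b hla hab x D hax hxb mD D0).
by rewrite (@early_crossing_density _ _ _ _ _ _ _ _ _ _ Z hlam mc hc hB q hq a b hla hab x D hax mD D0).
Qed.
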